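(* Let $n\ge 2$, $\lambda\vdash n$, and integers $l,r\ge 0$. Let $D(\alpha)$ be the Laplace–Beltrami operator, $\Delta_0(\alpha)$ the operator of multiplication by $p_1/\alpha$, and $\Delta_k(\alpha) = [D(\alpha),\Delta_{k-1}(\alpha)]$ for $k\ge1$. Then $$\alpha^{-\ell(\lambda)}|C_\lambda|\,a_\lambda^{l,r}(\alpha) = [p_\lambda]\,{D(\alpha)}^r{\Delta_l(\alpha)}^{n-1}(p_1/\alpha),$$ and for $l \geq 2$, $|C_\lambda|a_\lambda^{l,r}(\alpha)$ is a polynomial in $\alpha$ with integer coefficients of degree at most $(n-1)(l-1)+r$, which moreover satisfies for all $i$ $$[\alpha^i]\,|C_\lambda|a_\lambda^{l,r} (\alpha) = (-1)^{(l-1)(n-1)+r+\ell(\lambda)-1}[\alpha^{(l-1)(n-1)+r+\ell(\lambda)-1-i}]\,|C_\lambda|a_\lambda^{l,r} (\alpha).$$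
   Context: $z_\lambda=\prod_i i^{m_i(\lambda)}m_i(\lambda)!$ where $m_i(\lambda)$ is the number of parts equal to $i$; $|C_\lambda|=n!/z_\lambda$ is the size of the conjugacy class of cycle type $\lambda$ in $S_n$. $p_\lambda$ are power sum symmetric functions and $[p_\lambda]F$ denotes the coefficient of $p_\lambda$ in $F$. $\langle p_\lambda,p_\mu\rangle_\alpha=\alpha^{\ell(\lambda)}z_\lambda\delta_{\lambda\mu}$; $J^\alpha_\lambda$ are Jack symmetric functions (orthogonal for $\langle\cdot,\cdot\rangle_\alpha$, triangular with respect to monomial functions $m_\mu$, normalized by $[m_\lambda]J^\alpha_\lambda=\prod_{s\in\lambda}(\alpha a(s)+l(s)+1)$, $a(s),l(s)$ the arm and leg lengths of box $s$). For indeterminates $x^1,\dots,x^s$ and $\lambda^1,\dots,\lambda^s\vdash n$, generalized Jack connection coefficients are defined by $$\sum_{\lambda^i \vdash n}\alpha^{-\ell(\lambda^1)}z_{\lambda^1}^{-1}a_{\lambda^2,\ldots,\lambda^s}^{\lambda^1}(\alpha)\prod_{i=1}^s p_{\lambda^i}(x^i) = \sum_{\gamma \vdash n}\frac{\prod_{i=1}^s J^{\alpha}_\gamma(x^i)}{\langle J^{\alpha}_\gamma,J^{\alpha}_\gamma\rangle_{\alpha}},$$ and $a_\lambda^{l,r}(\alpha)$ denotes $a^\lambda_{\lambda^2,\dots,\lambda^{l+r+1}}(\alpha)$ with $l$ lower indices equal to $(n)$ and $r$ lower indices equal to $[1^{n-2}2]$. The Laplace–Beltrami operator on symmetric functions in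 $x=(x_1,x_2,\dots)$ is $D(\alpha) = \frac{\alpha}{2}\sum_{i}x_i^2\frac{\partial^2}{\partial x_i^2}+\sum_{i}\sum_{j\neq i}\frac{x_ix_j}{x_i-x_j}\frac{\partial}{\partial x_i}$; in power sums, $D(\alpha)=\frac{\alpha-1}{2}\sum_i i(i-1)p_i\frac{\partial}{\partial p_i}+\frac{\alpha}{2}\sum_{i,j}ijp_{i+j}\frac{\partial^2}{\partial p_i\partial p_j}+\frac12\sum_{i,j}(i+j)p_ip_j\frac{\partial}{\partial p_{i+j}}$. $[A,B]=AB-BA$. *)

(* Defs.v *)
From HB Require Import structures.
From mathcomp Require Import all_boot all_order all_algebra.
From mathcomp Require Import fraction.
From mathcomp Require Import mpoly.

Set Implicit Arguments.
Unset Strict Implicit.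
Unset Printing Implicit Defensive.

Import Order.TTheory GRing.Theory Num.Theory.
Local Open Scope ring_scope.

Definition K : fieldType := {fraction {poly rat}}.
Definition alpha : K := @FracField.tofrac _ ('X : {poly rat}).

(* Symmetric functions of degree <= n, in the power-sum presentation:
   Lambda_{<=n} is the degree <= n part of K[p_1, ..., p_n], where the
   variable 'X_i (i : 'I_n) stands for the power sum p_(i+1).
   A partition lambda of n is encoded by its multiplicity vector
   m : 'X_{1..n}, m i = number of parts of lambda equal to i+1;
   then p_lambda is the monomial 'X_[m] and [p_lambda]F = F@_m.      *)
Notation Sym n := {mpoly K[n]}.

Definition wt n (m : 'X_{1..n}) : nat := (\sum_(i < n) i.+1 * m i)%N.
Definition plen n (m : 'X_{1..n}) : nat := mdeg m.
Definition zee n (m : 'X_{1..n}) : nat := (\prod_(i < n) (i.+1 ^ m i * (m i)`!))%N.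
Definition classize n (m : 'X_{1..n}) : K := (n`!)%:R / (zee m)%:R.

Definition parts n (m : 'X_{1..n}) : seq nat :=
  flatten [seq nseq (m i) i.+1 | i <- rev (enum 'I_n)].
Definition part n (m : 'X_{1..n}) (j : nat) : nat := nth 0%N (parts m) j.
Definition cpart n (m : 'X_{1..n}) (j : nat) : nat := count (fun x => j < x)%N (parts m).

Definition dominated n (mu la : 'X_{1..n}) : Prop :=
  forall k : nat, (\sum_(j < k) part mu j <= \sum_(j < k) part la j)%N.

(* the power sum p_k as an element of Sym n (0 if k = 0 or k > n) *)
Definition pvar n (k : nat) : Sym n :=
  if k is k'.+1 then oapp (fun i : 'I_n => 'X_i) 0 (insub k') else 0.
(* partial derivative d/dp_k (0 if k = 0 or k > n) *)
Definition dvar n (k : nat) (F : Sym n) : Sym n :=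
  if k is k'.+1 then oapp (fun i : 'I_n => mderiv i F) 0 (insub k') else 0.

Definition jip n (F G : Sym n) : K :=
  \sum_(m <- msupp F) F@_m * G@_m * alpha ^+ plen m * (zee m)%:R.

(* evaluation at n variables x_1..x_n : p_k |-> sum_j x_j^k *)
Definition xpow n : n.-tuple (Sym n) :=
  [tuple \sum_(j < n) 'X_j ^+ i.+1 | i < n].
Definition ev n (F : Sym n) : Sym n := F \mPo (xpow n).
Definition xexp n (m : 'X_{1..n}) : 'X_{1..n} := [multinom part m i | i < n].
(* [m_mu] F : coefficient of the monomial symmetric function m_mu in F
   (= coefficient of x^mu in F(x_1, ..., x_n); n variables suffice in
   degree n). *)
Definition mcoef n (F : Sym n) (mu : 'X_{1..n}) : K := (ev F)@_(xexp mu).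

(* prod_{s in lambda} (alpha a(s) + l(s) + 1) *)
Definition hookprod n (la : 'X_{1..n}) : K :=
  \prod_(i < size (parts la)) \prod_(j < part la i)
     (alpha * (part la i - j - 1)%N%:R + (cpart la j - i)%N%:R).

Definition JackFamily n (J : 'X_{1..n} -> Sym n) : Prop :=
  [/\ forall g, wt g = n -> forall m, m \in msupp (J g) -> wt m = n,
      forall g, wt g = n -> forall mu, wt mu = n ->
          mcoef (J g) mu != 0 -> dominated mu g,
      forall g, wt g = n -> mcoef (J g) g = hookprod g
    & forall g h, wt g = n -> wt h = n -> g != h -> jip (J g) (J h) = 0].

(* Generalized Jack connection coefficients a^{la1}_{las}(alpha), obtained
   by extracting the coefficient of prod_i p_{la^i}(x^i) in the defining
   identity:  alpha^{-ell(la1)} z_{la1}^{-1} a = sum_gamma prod_i [p_{la^i}]J_gamma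
   / <J_gamma, J_gamma>. *)
Definition conn n (J : 'X_{1..n} -> Sym n) (la1 : 'X_{1..n}) (las : seq 'X_{1..n}) : K :=
  alpha ^+ plen la1 * (zee la1)%:R *
  \sum_(g : 'X_{1..n < n.+1} | wt g == n)
     ((J g)@_la1 * \prod_(mu <- las) (J g)@_mu) / jip (J g) (J g).

Definition prow n : 'X_{1..n} := [multinom (if i.+1 == n then 1 else 0)%N | i < n].
Definition ptrans n : 'X_{1..n} :=
  [multinom (if i == 0 :> nat then n - 2 else if i == 1 :> nat then 1 else 0)%N | i < n].

Definition alr n (J : 'X_{1..n} -> Sym n) (l r : nat) (la : 'X_{1..n}) : K :=
  conn J la (nseq l (prow n) ++ nseq r (ptrans n)).

(* Laplace-Beltrami operator in power sums (restricted to Lambda_{<=n};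
   terms p_{i+j} with i+j > n vanish on degree <= n inputs). *)
Definition LB n (F : Sym n) : Sym n :=
  ((alpha - 1) / 2%:R) *: \sum_(i < n) ((i.+1 * i)%N%:R *: (pvar n i.+1 * dvar i.+1 F))
  + (alpha / 2%:R) *: \sum_(i < n) \sum_(j < n)
        ((i.+1 * j.+1)%N%:R *: (pvar n (i.+1 + j.+1) * dvar i.+1 (dvar j.+1 F)))
  + (1 / 2%:R) *: \sum_(i < n) \sum_(j < n)
        ((i.+1 + j.+1)%N%:R *: (pvar n i.+1 * pvar n j.+1 * dvar (i.+1 + j.+1) F)).

Fixpoint Delta n (k : nat) : Sym n -> Sym n :=
  match k with
  | 0 => fun F => (alpha^-1 *: pvar n 1) * F
  | k'.+1 => fun F => LB (Delta k' F) - Delta k' (LB F)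
  end.

(* Main.v *)
(** The Lax operator [L] of Nazarov and Sklyanin acts on [Sym[w]]: between the
    powers of [w] it is multiplication by power sums, the adjoint derivations,
    and a multiple of the degree.  It is self-adjoint and commutes with an
    extension of the Laplace-Beltrami operator [D].  The Jack function of [ga] is
    an eigenvector of the vacuum moments [<0|L^a|0>], the eigenvalues having
    generating function [num ga / den ga].  Positivity of the scalar product and
    Lagrange interpolation in [L] split [p_1 f], for such an eigenvector [f], into
    eigenvectors attached to the diagrams with one more box.  As [D] acts by the
    sum of the contents, which is the coefficient of [p_1^(n-2) p_2], [Delta_l]
    multiplies the summand that gains a box of content [c] by [c ^ l].  Hence
    [Delta_l^(n-1) (p_1 / alpha)] is [(p_1 / alpha)^n] with each Jack component
    multiplied by the [l]-th power of the product of the contents other than that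
    of the corner, which is the coefficient of [p_n].
    In finitely many variables the moments become power sums of the Heckman
    operators [xi]; their action on the coefficients with maximal sum of squared
    exponents gives triangularity, and stripping a column gives the
    normalisation, so these eigenvectors are the given Jack family.
    In the variables [p_i / alpha] the operators [Delta_k], [k > 0], and [D] have
    coefficients in [Z[alpha]] with a palindromic symmetry. *)

From mathcomp Require Import all_fingroup.
Require Import Defs.
From HB Require Import structures.
From mathcomp Require Import all_boot all_order all_algebra.
From mathcomp Require Import fraction mpoly.
From mathcomp Require Import ring zify.
Set Implicit Arguments.
Unset Strict Implicit.
Unset Printing Implicit Defensive.
Import Order.TTheory GRing.Theory Num.Theory.
Local Open Scope ring_scope.

(** * Polynomials in an endomorphism *)

(** Two diagrams can have the same sum of contents, as (4,1,1) and (3,3) do, so [D] alone cannot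
    identify a Jack function; the vacuum moments of [L] can. Within one Pieri step the roles change:
    the rows of one diagram end at distinct contents, so there the eigenvalues of [D] separate the
    summands, and this is what shows that each summand again has scalar vacuum moments. The
    coefficients of [p_1^n], [p_1^(n-2) p_2] and [p_n] come from one specialisation, all power sums
    equal to [X]. It remembers only the length of a partition, and the lengths [n], [n - 1] and [1]
    each belong to one partition of [n]. On a Jack function it gives the product of [X + c] over the
    boxes, because adding a box of content [c] multiplies it by [X + c], up to a scalar. At [X = k]
    it is also the value at [k] variables equal to 1, which fixes the normalisation when a column is
    stripped. The ring stops at [p_n], so identities such as the commutation of [L] with [D] are
    available only while the degree allows it; hence the bounds [d < n] and [d <= n] throughout. *)

Section PolyAction.
Variables (F : fieldType) (V : lmodType F) (L : {linear V -> V}).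
Implicit Types (p q : {poly F}) (v : V).

Definition pact q v : V := \sum_(i < size q) q`_i *: iter i L v.

Lemma pactE n q v : (size q <= n)%N ->
  pact q v = \sum_(i < n) q`_i *: iter i L v.
Proof.
move=> le_q; rewrite /pact (big_ord_widen n (fun i => q`_i *: iter i L v)) //.
rewrite big_mkcond /=; apply: eq_bigr => i _; case: ltnP => // h.
by rewrite nth_default // scale0r.
Qed.

Lemma pactDl p q v : pact (p + q) v = pact p v + pact q v.
Proof.
rewrite (@pactE (maxn (size p) (size q))) ?size_polyD //.
rewrite (@pactE (maxn (size p) (size q)) p) ?leq_maxl //.
rewrite (@pactE (maxn (size p) (size q)) q) ?leq_maxr //.
by rewrite -big_split; apply: eq_bigr => i _; rewrite coefD scalerDl.
Qed.

Lemma pactZl c q v : pact (c *: q) v = c *: pact q v.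
Proof.
rewrite (@pactE (size q)) ?size_scale_leq // scaler_sumr.
by apply: eq_bigr => i _; rewrite coefZ scalerA.
Qed.

Lemma iter_linear i : linear (iter i L).
Proof. by elim: i => [|i IH] c u v //=; rewrite IH linearP. Qed.

Lemma iterLD i u v : iter i L (u + v) = iter i L u + iter i L v.
Proof. by rewrite -[u]scale1r iter_linear !scale1r. Qed.

Lemma iterL0 i : iter i L 0 = 0.
Proof. by elim: i => //= i ->; rewrite linear0. Qed.

Lemma iterLZ i c u : iter i L (c *: u) = c *: iter i L u.
Proof. by rewrite -[c *: u]addr0 iter_linear iterL0 addr0. Qed.

Lemma iterL_sum i (I : Type) (r : seq I) (P : pred I) (G : I -> V) :
  iter i L (\sum_(j <- r | P j) G j) = \sum_(j <- r | P j) iter i L (G j).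
Proof.
elim: r => [|j r IH]; first by rewrite !big_nil iterL0.
by rewrite !big_cons; case: (P j); rewrite ?iterLD IH.
Qed.

Lemma pact_is_linear q : linear (pact q).
Proof.
move=> c u v; rewrite /pact scaler_sumr -big_split; apply: eq_bigr => i _ /=.
by rewrite iter_linear scalerDr !scalerA mulrC.
Qed.
HB.instance Definition _ q := GRing.isLinear.Build F V V _ (pact q) (pact_is_linear q).

Lemma pact0l v : pact 0 v = 0.
Proof. by rewrite /pact size_poly0 big_ord0. Qed.

Lemma pact_suml (I : Type) (r : seq I) (P : pred I) (G : I -> {poly F}) v :
  pact (\sum_(i <- r | P i) G i) v = \sum_(i <- r | P i) pact (G i) v.
Proof.
elim: r => [|i r IH]; first by rewrite !big_nil pact0l.
by rewrite !big_cons; case: (P i); rewrite ?pactDl IH.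
Qed.

Lemma pactC c v : pact c%:P v = c *: v.
Proof.
by rewrite (@pactE 1%N) ?size_polyC_leq1 // big_ord1 coefC.
Qed.

Lemma pact1 v : pact 1 v = v.
Proof. by rewrite -(polyC1 F) pactC scale1r. Qed.

Lemma pactXM q v : pact ('X * q) v = L (pact q v).
Proof.
rewrite (@pactE (size q).+1); last first.
  case: (eqVneq q 0) => [->|q0]; first by rewrite mulr0 size_poly0.
  by rewrite mulrC size_mulX.
rewrite big_ord_recl coefXM /= scale0r add0r linear_sum /=; apply: eq_bigr => i _.
by rewrite coefXM /= linearZ.
Qed.

Lemma pactM p q v : pact (p * q) v = pact p (pact q v).
Proof.
elim/poly_ind: p => [|p c IH]; first by rewrite mul0r !pact0l.
rewrite mulrDl pactDl [p * 'X]mulrC -mulrA pactXM IH mul_polyC pactZl.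
by rewrite [RHS]pactDl pactXM pactC.
Qed.

Lemma pactX v : pact 'X v = L v.
Proof. by rewrite -['X]mulr1 pactXM pact1. Qed.

Lemma pactXn m v : pact ('X^m) v = iter m L v.
Proof. by elim: m => [|m IH]; rewrite ?pact1 // exprS pactXM IH. Qed.

Lemma pact_eigen c q v : L v = c *: v -> pact q v = q.[c] *: v.
Proof.
move=> Lv; rewrite horner_coef scaler_suml; apply: eq_bigr => i _.
suff -> : iter i L v = c ^+ i *: v by rewrite scalerA.
elim: (nat_of_ord i) => [|k IH]; first by rewrite scale1r.
by rewrite /= IH linearZ /= Lv scalerA exprSr.
Qed.

Lemma pact_mem (S : V -> Prop) q v :
  S 0 -> (forall x y, S x -> S y -> S (x + y)) -> (forall c x, S x -> S (c *: x)) ->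
  (forall x, S x -> S (L x)) -> S v -> S (pact q v).
Proof.
move=> S0 SD SZ SL Sv; rewrite /pact; apply: big_ind => // i _; apply: (SZ).
by elim: (nat_of_ord i) => //= k; apply: SL.
Qed.

End PolyAction.

(** * Lagrange interpolation in an endomorphism *)

Section Lagrange.
Variables (F : fieldType) (m : nat) (c : 'I_m -> F).
Hypothesis c_inj : injective c.

Definition lagr_num i : {poly F} := \prod_(j < m | j != i) ('X - (c j)%:P).
Definition lagr i : {poly F} := (lagr_num i).[c i]^-1 *: lagr_num i.

Lemma lagr_num_neq0 i : (lagr_num i).[c i] != 0.
Proof.
rewrite /lagr_num horner_prod; apply/prodf_neq0 => j ji.
by rewrite hornerXsubC subr_eq0; apply: contra ji => /eqP/c_inj ->.
Qed.

Lemma lagr_eq i j : (lagr i).[c j] = (i == j)%:R.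
Proof.
rewrite /lagr hornerZ; case: eqVneq => [<-|ij].
  by rewrite mulVf // lagr_num_neq0.
rewrite {2}/lagr_num (bigD1 j) /= 1?eq_sym // hornerM hornerXsubC subrr mul0r mulr0 //.
Qed.

Lemma size_lagr_num i : (size (lagr_num i) <= m)%N.
Proof.
rewrite /lagr_num -big_filter size_prod_XsubC -cardE cardC1 card_ord.
by case: (m) i => [[]|].
Qed.

(** The difference of the two sides has size at most [m] and vanishes at the [m] distinct nodes. *)
Lemma sum_lagr : (0 < m)%N -> \sum_i lagr i = 1.
Proof.
move=> m0; apply/eqP; rewrite -subr_eq0; apply/eqP.
apply: (@roots_geq_poly_eq0 F _ [seq c j | j <- enum 'I_m]).
- apply/allP => x /mapP [j _ ->]; rewrite rootE hornerD hornerN hornerC.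
  rewrite horner_sum (bigD1 j) //= lagr_eq eqxx big1 ?addr0 ?subrr //.
  by move=> i ij; rewrite lagr_eq (negbTE ij).
- by rewrite map_inj_uniq // enum_uniq.
- rewrite size_map size_enum_ord.
  apply: (leq_trans (size_polyD _ _)); rewrite geq_max; apply/andP; split.
    apply: (leq_trans (size_sum _ _ _)); apply/bigmax_leqP => i _.
    exact: leq_trans (size_scale_leq _ _) (size_lagr_num i).
  by rewrite size_polyN size_poly1.
Qed.

Lemma lagr_numE i : ('X - (c i)%:P) * lagr_num i = \prod_j ('X - (c j)%:P).
Proof. by rewrite [RHS](bigD1 i). Qed.

Variables (V : lmodType F) (L : {linear V -> V}).

Lemma lagr_eigen i v : pact L (\prod_j ('X - (c j)%:P)) v = 0 ->
  L (pact L (lagr i) v) = c i *: pact L (lagr i) v.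
Proof.
rewrite -(lagr_numE i) pactM pactDl pactX -polyCN pactC scaleNr => /eqP.
by rewrite subr_eq0 /lagr pactZl linearZ /= => /eqP ->; rewrite !scalerA mulrC.
Qed.

(** Applying the polynomial [lagr i] in [L] to the sum keeps [z i] and kills every other summand. *)
Lemma eigen_sep (z : 'I_m -> V) : \sum_i z i = 0 ->
  (forall i, L (z i) = c i *: z i) -> forall i, z i = 0.
Proof.
move=> sz Lz i; have : pact L (lagr i) (\sum_i z i) = 0 by rewrite sz linear0.
rewrite linear_sum (bigD1 i) //= (pact_eigen _ (Lz i)) lagr_eq eqxx scale1r.
rewrite big1 ?addr0 // => j ji.
by rewrite (pact_eigen _ (Lz j)) lagr_eq eq_sym (negbTE ji) scale0r.
Qed.

End Lagrange.

(** * Power series that are quotients of polynomials *)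

Section Conv.
Variable F : fieldType.
Implicit Types (p q D N : {poly F}) (k : nat -> F).

(** The coefficients of [p] times the power series with coefficients [k]. Truncating the series
    after order [n] leaves coefficient [n] unchanged, so the whole calculus stays inside
    polynomials. *)
Definition conv p k (n : nat) : F := (p * \poly_(i < n.+1) k i)`_n.

Lemma convE p k n : conv p k n = \sum_(j < n.+1) p`_j * k (n - j)%N.
Proof.
rewrite /conv coefM; apply: eq_bigr => j _.
by rewrite coef_poly ltnS leq_subr.
Qed.

Lemma conv_poly p q n : conv p (fun i => q`_i) n = (p * q)`_n.
Proof. by rewrite convE coefM. Qed.

Lemma eq_conv p k k' : k =1 k' -> conv p k =1 conv p k'.
Proof. by move=> h n; rewrite !convE; apply: eq_bigr => i _; rewrite h. Qed.

Lemma convM p q k : conv (p * q) k =1 conv p (conv q k).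
Proof.
move=> n; rewrite /conv -mulrA [in LHS]coefM [in RHS]coefM; apply: eq_bigr => j _.
congr (_ * _); rewrite coef_poly ltnS leq_subr coefM [RHS]convE; apply: eq_bigr => i _.
rewrite coef_poly; case: ltnP => //.
by rewrite ltnNge -subnDA leq_subr.
Qed.

Lemma convDl p q k n : conv (p + q) k n = conv p k n + conv q k n.
Proof. by rewrite /conv mulrDl coefD. Qed.
Lemma convDr p k k' n : conv p (fun i => k i + k' i) n = conv p k n + conv p k' n.
Proof. by rewrite !convE -big_split; apply: eq_bigr => i _; rewrite /= mulrDr. Qed.
Lemma convZr p c k n : conv p (fun i => c * k i) n = c * conv p k n.
Proof. by rewrite !convE mulr_sumr; apply: eq_bigr => i _; rewrite mulrCA. Qed.
Lemma convC c k n : conv c%:P k n = c * k n.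
Proof. by rewrite /conv mul_polyC coefZ coef_poly leqnn. Qed.
Lemma conv_XM p k n : conv ('X * p) k n = if n is n'.+1 then conv p k n' else 0.
Proof.
case: n => [|n]; first by rewrite /conv -mulrA coefXM.
rewrite !convE big_ord_recl coefXM mul0r add0r; apply: eq_bigr => i _.
by rewrite coefXM /=.
Qed.

(** A polynomial with nonzero constant term is invertible as a power series. *)
Lemma conv_inj p k k' : p`_0 != 0 -> conv p k =1 conv p k' -> k =1 k'.
Proof.
move=> p0 h n; elim/ltn_ind: n => n IH; have := h n; rewrite !convE.
rewrite !big_ord_recl subn0 (eq_bigr (fun i : 'I_n => p`_(bump 0 i) * k' (n - bump 0 i)%N)).
  by move/addIr/(mulfI p0).
by move=> i _; rewrite IH // ltn_subrL (leq_ltn_trans (leq0n i) (ltn_ord i)).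
Qed.

(* The power series with coefficients [k] is [N / D]. *)
Definition gen D N k := forall n, conv D k n = N`_n.

Lemma gen_mul p D N k : gen D N k -> gen (p * D) (p * N) k.
Proof. by move=> h n; rewrite convM (eq_conv p h) conv_poly. Qed.

Lemma gen_cancel p D N k : p`_0 != 0 -> gen (p * D) (p * N) k -> gen D N k.
Proof.
move=> p0 h; apply: (conv_inj p0) => n.
by rewrite -convM h conv_poly.
Qed.

Lemma gen_inj D N k k' : D`_0 != 0 -> gen D N k -> gen D N k' -> k =1 k'.
Proof. by move=> D0 h h'; apply: (conv_inj D0) => n; rewrite h h'. Qed.

Lemma gen_unique D D' N N' k : gen D N k -> gen D' N' k -> D * N' = D' * N.
Proof.
move=> h h'; apply/polyP => n; rewrite -!conv_poly -(eq_conv _ h) -(eq_conv _ h').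
by rewrite -!convM mulrC.
Qed.

End Conv.

(* The only properties of [Q(alpha)] that the argument uses; [jf_aniso] stands for
   an ordering in which [alpha] is positive. *)
Record jackField := JackField {
  jf_sort :> fieldType;
  jf_alpha : jf_sort;
  jf_indep : forall i j i' j' : nat,
    jf_alpha * i%:R + j%:R = jf_alpha * i'%:R + j'%:R -> i = i' /\ j = j';
  jf_aniso : forall (I : eqType) (r : seq I) (e w : I -> nat) (x : I -> jf_sort),
    (forall i, i \in r -> (0 < w i)%N) ->
    \sum_(i <- r) jf_alpha ^+ e i * (w i)%:R * (x i * x i) = 0 ->
    forall i, i \in r -> x i = 0
}.

Section JackField.
Variable F : jackField.
Local Notation alpha := (jf_alpha F).

Lemma alpha_neq0 : alpha != 0.
Proof.
apply/eqP => a0.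
have [] := @jf_indep F 1 0 0 0; last by [].
by rewrite a0 !mul0r.
Qed.

Lemma natF_eq0 m : (m%:R == 0 :> F) = (m == 0%N).
Proof.
apply/eqP/eqP => [h|->//].
by have [] := @jf_indep F 0 m 0 0; rewrite // h mulr0.
Qed.

Lemma two_neq0 : 2%:R != 0 :> F. Proof. by rewrite natF_eq0. Qed.

Lemma two_alpha_neq0 : 2%:R * alpha != 0 :> F.
Proof. by rewrite mulf_neq0 ?alpha_neq0 // two_neq0. Qed.

End JackField.

(** * The field Q(alpha): independence of 1 and alpha, and positivity *)

Notation fr := (@FracField.tofrac {poly rat}).

Lemma alpha_indep (a b : int) : a%:~R * alpha + b%:~R = 0 :> K -> a = 0 /\ b = 0.
Proof.
have E : a%:~R * alpha + b%:~R = fr (a%:~R * 'X + b%:~R).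
  by rewrite tofracD tofracM !rmorph_int.
rewrite E => /eqP; rewrite tofrac_eq0 => /eqP /polyP h.
split; apply/eqP; rewrite -(intr_eq0 rat); apply/eqP.
  have := h 1%N; rewrite coefD coefMX /= coef0 -!(rmorph_int (polyC : {rmorphism rat -> {poly rat}})).
  by rewrite !coefC /= addr0.
have := h 0%N; rewrite coefD coefMX /= coef0 -!(rmorph_int (polyC : {rmorphism rat -> {poly rat}})).
by rewrite !coefC /= add0r.
Qed.

(** The positive cone of the order on Q(alpha) in which [alpha] exceeds every rational number. *)
Definition kpos (x : K) : Prop :=
  exists p q : {poly rat}, [/\ 0 < lead_coef p, 0 < lead_coef q & x * fr q = fr p].

Lemma kpos_neq0 x : kpos x -> x != 0.
Proof.
case=> p [q [hp hq e]]; apply/eqP => x0; move: e; rewrite x0 mul0r => /eqP.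
by rewrite eq_sym tofrac_eq0 => /eqP p0; rewrite p0 lead_coef0 ltxx in hp.
Qed.

Lemma kpos_mul x y : kpos x -> kpos y -> kpos (x * y).
Proof.
case=> p [q [hp hq e]] [p' [q' [hp' hq' e']]]; exists (p * p'), (q * q').
by split; rewrite ?lead_coefM ?mulr_gt0 // !tofracM -e -e'; ring.
Qed.

Lemma lead_coefD_gt0 (p q : {poly rat}) :
  0 < lead_coef p -> 0 < lead_coef q -> 0 < lead_coef (p + q).
Proof.
move=> hp hq; case: (ltngtP (size p) (size q)) => h.
- by rewrite lead_coefDr.
- by rewrite lead_coefDl.
have E : (p + q)`_(size p).-1 = lead_coef p + lead_coef q.
  by rewrite coefD !lead_coefE h.
have s : size (p + q) = size p.
  apply/eqP; rewrite eqn_leq; apply/andP; split.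
    by rewrite (leq_trans (size_polyD _ _)) // h maxnn.
  rewrite -(prednK (n := size p)); last first.
    by rewrite size_poly_gt0; apply: contraTneq hp => ->; rewrite lead_coef0 ltxx.
  rewrite ltnNge; apply/negP => /leq_sizeP/(_ _ (leqnn _))/eqP.
  by rewrite E gt_eqF // addr_gt0.
by rewrite lead_coefE s E addr_gt0.
Qed.

Lemma kpos_add x y : kpos x -> kpos y -> kpos (x + y).
Proof.
case=> p [q [hp hq e]] [p' [q' [hp' hq' e']]]; exists (p * q' + p' * q), (q * q').
split; first by rewrite lead_coefD_gt0 // lead_coefM mulr_gt0.
  by rewrite lead_coefM mulr_gt0.
by rewrite tofracD !tofracM -e -e'; ring.
Qed.

Lemma kpos_sqr x : x != 0 -> kpos (x * x).
Proof.
have [p [q [q0 ->]]] : exists p q : {poly rat}, q != 0 /\ x = fr p / fr q.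
  elim/quotW: x => x; exists (frac x).1, (frac x).2; split; first exact: denom_ratioP.
  have h : fr (frac x).2 != 0 by rewrite tofrac_eq0 denom_ratioP.
  apply: (mulIf h); rewrite divfK //; unlock FracField.tofrac.
  rewrite -[LHS]FracField.pi_mul.
  apply/eqmodP; rewrite /= FracField.equivfE /FracField.mulf !numden_Ratio ?mulr1 ?oner_neq0 ?denom_ratioP //.
  by rewrite mulrC.
move=> pq; have p0 : p != 0 by apply: contraNneq pq => ->; rewrite tofrac0 mul0r.
have sq (r : {poly rat}) : r != 0 -> 0 < lead_coef (r * r).
  by move=> r0; rewrite lead_coefM -expr2 exprn_even_gt0 //= lead_coef_eq0.
exists (p * p), (q * q); split; [exact: sq | exact: sq | rewrite !tofracM].
have fq : fr q != 0 by rewrite tofrac_eq0.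
by rewrite mulrACA !divfK.
Qed.

Lemma kpos_alpha : kpos alpha.
Proof. by exists 'X, 1; rewrite lead_coefX lead_coef1; split => //; rewrite tofrac1 mulr1. Qed.

Lemma kpos_nat m : (0 < m)%N -> kpos m%:R.
Proof.
move=> m0; exists (m%:R)%:P, 1; rewrite lead_coefC lead_coef1 ltr0n; split=> //.
by rewrite tofrac1 mulr1 !rmorph_nat.
Qed.

Lemma kpos_X x m : kpos x -> kpos (x ^+ m).
Proof.
move=> hx; elim: m => [|m IH]; first by rewrite expr0; apply: (@kpos_nat 1).
by rewrite exprS; apply: kpos_mul.
Qed.

(** By induction on the list, either every [x i] vanishes or the sum lies in the cone, and elements
    of the cone are nonzero. *)
Lemma kpos_sum_eq0 (I : eqType) (r : seq I) (w x : I -> K) :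
  (forall i, i \in r -> kpos (w i)) -> \sum_(i <- r) w i * (x i * x i) = 0 ->
  forall i, i \in r -> x i = 0.
Proof.
move=> hw.
have [h|h] : (forall i, i \in r -> x i = 0) \/ kpos (\sum_(i <- r) w i * (x i * x i)).
- elim: r hw => [|i r IH] hw; first by left.
  have [|h|h] := IH _; first by move=> j jr; apply: hw; rewrite inE jr orbT.
    case: (eqVneq (x i) 0) => xi; last first.
      right; rewrite big_cons big1_seq ?addr0.
        by apply: kpos_mul; [apply: hw; rewrite inE eqxx | apply: kpos_sqr].
      by move=> j /andP [_ jr]; rewrite h // !mulr0.
    by left=> j; rewrite inE => /orP [/eqP ->|/h].
  case: (eqVneq (x i) 0) => xi; right; rewrite big_cons.
    by rewrite xi !mulr0 add0r.
  apply: kpos_add => //.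
  by apply: kpos_mul; [apply: hw; rewrite inE eqxx | apply: kpos_sqr].
- by move=> _.
- by move=> e; move: (kpos_neq0 h); rewrite e eqxx.
Qed.

#[local] Opaque K alpha.

Lemma alphaK_inj (i j i' j' : nat) :
  alpha * i%:R + j%:R = alpha * i'%:R + j'%:R -> i = i' /\ j = j'.
Proof.
move=> h; have [] := @alpha_indep (i%:Z - i'%:Z) (j%:Z - j'%:Z).
  rewrite !intrB -!pmulrn; apply/eqP.
  have -> : (i%:R - i'%:R) * alpha + (j%:R - j'%:R) = (alpha * i%:R + j%:R) - (alpha * i'%:R + j'%:R) by ring.
  by rewrite h subrr.
by split; lia.
Qed.

Lemma alphaK_aniso (I : eqType) (r : seq I) (e w : I -> nat) (x : I -> K) :
  (forall i, i \in r -> (0 < w i)%N) ->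
  \sum_(i <- r) alpha ^+ e i * (w i)%:R * (x i * x i) = 0 ->
  forall i, i \in r -> x i = 0.
Proof.
move=> hw; apply: kpos_sum_eq0 => i ir; apply: kpos_mul; last exact: kpos_nat (hw _ ir).
exact: kpos_X kpos_alpha.
Qed.

Definition Kjack : jackField := JackField alphaK_inj alphaK_aniso.

(** * The Laplace-Beltrami operator *)

(** [pv], [dv] and [lapbel] are the operators of the statement over an abstract [jackField]. They
    are locked; for [F := Kjack] unlocking them gives back [pvar], [dvar] and [LB]. *)
HB.lock Definition pv (F : jackField) (n k : nat) : {mpoly F[n]} :=
  if k is k'.+1 then oapp (fun i : 'I_n => 'X_i) 0 (insub k') else 0.
HB.lock Definition dv (F : jackField) (n k : nat) (f : {mpoly F[n]}) : {mpoly F[n]} :=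
  if k is k'.+1 then oapp (fun i : 'I_n => mderiv i f) 0 (insub k') else 0.

HB.lock Definition lapbel (F : jackField) (n : nat) (f : {mpoly F[n]}) : {mpoly F[n]} :=
  ((jf_alpha F - 1) / 2%:R) *: \sum_(i < n) ((i.+1 * i)%N%:R *: (pv F n i.+1 * dv i.+1 f))
  + (jf_alpha F / 2%:R) *: \sum_(i < n) \sum_(j < n)
        ((i.+1 * j.+1)%N%:R *: (pv F n (i.+1 + j.+1) * dv i.+1 (dv j.+1 f)))
  + (1 / 2%:R) *: \sum_(i < n) \sum_(j < n)
        ((i.+1 + j.+1)%N%:R *: (pv F n i.+1 * pv F n j.+1 * dv (i.+1 + j.+1) f)).

HB.lock Definition Pm (F : jackField) (n i : nat) (f : {mpoly F[n]}) := pv F n i * f.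
(** The factor [alpha * i] makes this the adjoint of [Pm i] for the deformed scalar product
    ([ip_Qm]). *)
HB.lock Definition Qm (F : jackField) (n i : nat) (f : {mpoly F[n]}) :=
  (jf_alpha F * i%:R) *: dv i f.
(* The entry of the Lax operator from [w ^ j] to [w ^ k]. *)
HB.lock Definition Lop (F : jackField) (n k j : nat) (f : {mpoly F[n]}) :=
  if (j < k)%N then Qm (k - j) f else if (k < j)%N then Pm (j - k) f
  else ((jf_alpha F - 1) * k%:R) *: f.

Section Operators.
Variables (F : jackField) (n : nat).
Local Notation alpha := (jf_alpha F).
Local Notation A := {mpoly F[n]}.
Implicit Types (f h : A) (i j k m : nat).

Lemma pvE (i : 'I_n) : pv F n i.+1 = 'X_i.
Proof. by rewrite pv.unlock /= insubT //= => lt; congr 'X_(_); apply: val_inj. Qed.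

Lemma pv_out i : (n <= i)%N -> pv F n i.+1 = 0.
Proof. by move=> h; rewrite pv.unlock insubF // ltnNge h. Qed.

Lemma dvE (i : 'I_n) f : dv i.+1 f = mderiv i f.
Proof.
rewrite dv.unlock (insubT (fun i => (i < n)%N) (ltn_ord i)) /oapp.
by congr (mderiv _ _); apply: val_inj.
Qed.

Lemma dv0 f : dv 0 f = 0. Proof. by rewrite dv.unlock. Qed.
Lemma pv0 : pv F n 0 = 0. Proof. by rewrite pv.unlock. Qed.

Lemma dv_out i f : (n <= i)%N -> dv i.+1 f = 0.
Proof. by move=> h; rewrite dv.unlock insubF // ltnNge h. Qed.

Lemma dv_linear i : linear (@dv F n i).
Proof.
move=> c f h; case: i => [|i]; first by rewrite !dv0 scaler0 addr0.
case: (ltnP i n) => hi; last by rewrite !dv_out // scaler0 addr0.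
by rewrite !(dvE (Ordinal hi)) linearP.
Qed.
HB.instance Definition _ i := GRing.isLinear.Build F A A _ (@dv F n i) (dv_linear i).

Lemma dvZ i c f : dv i (c *: f) = c *: dv i f. Proof. exact: linearZ. Qed.

Lemma dv_comm i j f : dv i (dv j f) = dv j (dv i f).
Proof.
case: i => [|i]; first by rewrite !dv0 linear0.
case: j => [|j]; first by rewrite !dv0 linear0.
case: (ltnP i n) => hi; last by rewrite !(dv_out _ hi) linear0.
case: (ltnP j n) => hj; last by rewrite !(dv_out _ hj) linear0.
by rewrite !(dvE (Ordinal hi)) !(dvE (Ordinal hj)) mderiv_comm.
Qed.

Definition okp i := (0 < i <= n)%N.

Lemma dvM i j f :
  dv i (pv F n j * f) = pv F n j * dv i f + ((i == j) && okp i)%:R *: f.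
Proof.
case: i => [|i]; first by rewrite !dv0 mulr0 /okp andbF scale0r addr0.
case: (ltnP i n) => hi; last first.
  by rewrite !dv_out // /okp [(i < n)%N]ltnNge hi !andbF mulr0 scale0r addr0.
rewrite !(dvE (Ordinal hi)) mderivM addrC; congr (_ + _).
case: j => [|j]; first by rewrite pv0 mderiv0 mul0r scale0r.
case: (ltnP j n) => hj; last first.
  rewrite pv_out // mderiv0 mul0r; case: eqP => [[e]|_]; last by rewrite scale0r.
  by rewrite e ltnNge hj in hi.
rewrite (pvE (Ordinal hj)) mderivX /okp hi andbT eqSS -[j]/(nat_of_ord (Ordinal hj)).
rewrite mnm1E -!val_eqE /= eq_sym; case: eqP => [e|_]; last by rewrite !scale0r mul0r.
rewrite !scale1r (_ : (U_(Ordinal hj) - U_(Ordinal hi) = 0)%MM) ?mpolyX0 ?mul1r //.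
by apply/mnmP => l; rewrite mnmBE !mnm1E -!val_eqE /= e subnn mnm0E.
Qed.

Lemma Pm_linear i : linear (@Pm F n i).
Proof. by move=> c f h; rewrite Pm.unlock mulrDr scalerAr. Qed.
HB.instance Definition _ i := GRing.isLinear.Build F A A _ (@Pm F n i) (Pm_linear i).
Lemma Qm_linear i : linear (@Qm F n i).
Proof. by move=> c f h; rewrite Qm.unlock linearP scalerDr !scalerA [c * _]mulrC. Qed.
HB.instance Definition _ i := GRing.isLinear.Build F A A _ (@Qm F n i) (Qm_linear i).

Lemma PmZ i c f : Pm i (c *: f) = c *: Pm i f. Proof. exact: linearZ. Qed.
Lemma QmZ i c f : Qm i (c *: f) = c *: Qm i f. Proof. exact: linearZ. Qed.

Lemma Pm_out i f : (n < i)%N -> Pm i f = 0.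
Proof. by case: i => // i h; rewrite Pm.unlock pv_out // mul0r. Qed.
Lemma Qm_out i f : (n < i)%N -> Qm i f = 0.
Proof. by case: i => // i h; rewrite Qm.unlock dv_out // scaler0. Qed.

Lemma PmC i j f : Pm i (Pm j f) = Pm j (Pm i f).
Proof. by rewrite Pm.unlock mulrCA. Qed.
Lemma QmC i j f : Qm i (Qm j f) = Qm j (Qm i f).
Proof. by rewrite Qm.unlock !linearZ /= dv_comm !scalerA mulrC. Qed.
(** The Heisenberg relation; [okp] records that the variables stop at [p_n]. *)
Lemma QmPm i j f :
  Qm i (Pm j f) = Pm j (Qm i f) + (((i == j) && okp i)%:R * (alpha * i%:R)) *: f.
Proof.
by rewrite Qm.unlock Pm.unlock dvM scalerDr -scalerAr scalerA [_%:R * (_ * _)]mulrC.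
Qed.

Lemma Lop_linear k j : linear (@Lop F n k j).
Proof.
move=> c f h; rewrite Lop.unlock; case: ifP => _; first exact: linearP.
case: ifP => _; first exact: linearP.
by rewrite scalerDr !scalerA [c * _]mulrC.
Qed.
HB.instance Definition _ k j := GRing.isLinear.Build F A A _ (@Lop F n k j) (Lop_linear k j).

Lemma Lop_Q k j f : (j < k)%N -> Lop k j f = Qm (k - j) f.
Proof. by move=> h; rewrite Lop.unlock h. Qed.
Lemma Lop_P k j f : (k < j)%N -> Lop k j f = Pm (j - k) f.
Proof. by move=> h; rewrite Lop.unlock ltnNge (ltnW h) h. Qed.
Lemma Lop_d k f : Lop k k f = ((alpha - 1) * k%:R) *: f.
Proof. by rewrite Lop.unlock ltnn. Qed.

(** Off the diagonal the Lax operator is a Toeplitz matrix, and on the diagonal it grows by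
    [alpha - 1] at each step. This governs its commutator with multiplication by [w]. *)
Lemma LopS k j f : Lop k.+1 j.+1 f = Lop k j f + ((k == j)%:R * (alpha - 1)) *: f.
Proof.
rewrite Lop.unlock !ltnS !subSS; case: (ltngtP k j) => [h|h|->].
- by rewrite mul0r scale0r addr0.
- by rewrite mul0r scale0r addr0.
by rewrite mul1r -scalerDl -natr1; congr (_ *: _); ring.
Qed.

Lemma Lop_Pm k j m f : okp m ->
  Lop k j (Pm m f) = Pm m (Lop k j f) + ((k == j + m)%N%:R * (alpha * m%:R)) *: f.
Proof.
move=> /[dup] hm /andP [m0 _]; have [h|h|->] := ltngtP j k.
- rewrite !Lop_Q // QmPm; congr (_ + _ *: _).
  have -> : (k == j + m)%N = (k - j == m)%N by lia.
  by case: eqP => [->|_]; rewrite ?hm ?mul0r.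
- by rewrite !Lop_P // PmC ltn_eqF ?mul0r ?scale0r ?addr0 // ltn_addr.
have E a : (a == a + m)%N = false by lia.
by rewrite !Lop_d linearZ /= E mul0r scale0r addr0.
Qed.

Lemma Qm_Lop k j m f : okp m ->
  Qm m (Lop k j f) = Lop k j (Qm m f) + ((j == k + m)%N%:R * (alpha * m%:R)) *: f.
Proof.
move=> /[dup] hm /andP [m0 _]; have [h|h|->] := ltngtP k j.
- rewrite !Lop_P // QmPm; congr (_ + _ *: _).
  have -> : (j == k + m)%N = (m == j - k)%N by lia.
  by rewrite hm andbT.
- by rewrite !Lop_Q // QmC ltn_eqF ?mul0r ?scale0r ?addr0 // ltn_addr.
have E a : (a == a + m)%N = false by lia.
by rewrite !Lop_d linearZ /= E mul0r scale0r addr0.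
Qed.

Lemma shift_sum (G : nat -> A) j : (forall k, (n <= k)%N -> G k = 0) ->
  \sum_(i < n) G (j + i).+1 = \sum_(k < n | (j < k)%N) G k.
Proof.
move=> G0; rewrite -(big_mkord xpredT (fun i => G (j + i).+1)).
have -> : \sum_(0 <= i < n) G (j + i).+1 = \sum_(j.+1 <= k < n + j.+1) G k.
  rewrite -{1}[j.+1]add0n big_addn addnK; apply: eq_bigr => i _.
  by rewrite addnS addnC.
have [h|h] := leqP j.+1 n.
  have E : \sum_(n <= k < n + j.+1) G k = 0.
    by rewrite big_nat big1 // => i /andP [hi _]; apply: G0.
  by rewrite (big_cat_nat h (leq_addr _ _)) /= E addr0 big_geq_mkord.
rewrite big_nat big1; first by rewrite big1 // => k hk; have := ltn_ord k; lia.
by move=> i /andP [hi _]; apply: G0; apply: leq_trans hi; apply: ltnW.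
Qed.

(** The three sums of [lapbel] are the diagonal part, the part below and the part above the diagonal
    of one quadratic form whose matrix is the Lax operator. The commutators and the self-adjointness
    of [lapbel] are all read off from this form. *)
Lemma lapbel_Lop f : (2%:R * alpha) *: lapbel f =
  \sum_(j < n) \sum_(k < n) Pm j.+1 (Lop j k (Qm k.+1 f)).
Proof.
have two : (2%:R : F) != 0 := two_neq0 F.
pose T1 := \sum_(j < n) Pm j.+1 (Lop j j (Qm j.+1 f)).
pose T2 := \sum_(k < n) \sum_(j < n | (k < j)%N) Pm j.+1 (Lop j k (Qm k.+1 f)).
pose T3 := \sum_(j < n) \sum_(k < n | (j < k)%N) Pm j.+1 (Lop j k (Qm k.+1 f)).
have -> : \sum_(j < n) \sum_(k < n) Pm j.+1 (Lop j k (Qm k.+1 f)) = T1 + T2 + T3.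
  rewrite [T2](exchange_big_dep xpredT) //= -!big_split; apply: eq_bigr => j _ /=.
  rewrite (bigD1 j) //= -addrA; congr (_ + _).
  rewrite (bigID (fun k : 'I_n => (k < j)%N)) /=; congr (_ + _); apply: eq_bigl => k.
    by rewrite -val_eqE /=; case: ltngtP.
  by rewrite -val_eqE /=; case: ltngtP.
rewrite lapbel.unlock !scalerDr; congr (_ + _ + _).
- rewrite !scalerA scaler_sumr; apply: eq_bigr => j _.
  rewrite Lop_d linearZ /= Qm.unlock Pm.unlock -!scalerAr !scalerA; congr (_ *: _).
  by rewrite !natrM; field.
- rewrite scalerA scaler_sumr; apply: eq_bigr => i _.
  rewrite -(@shift_sum (fun j => Pm j.+1 (Lop j i (Qm i.+1 f)))); last first.
    by move=> k hk; rewrite Pm_out.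
  rewrite scaler_sumr; apply: eq_bigr => j _.
  rewrite Lop_Q ?ltnS ?leq_addr // -addnS addKn Qm.unlock Pm.unlock.
  rewrite dvZ dv_comm -!scalerAr !scalerA addSn addnS; congr (_ *: _).
  by rewrite !natrM; field.
rewrite scalerA scaler_sumr; apply: eq_bigr => i _.
rewrite -(@shift_sum (fun k => Pm i.+1 (Lop i k (Qm k.+1 f)))); last first.
  by move=> k hk; rewrite Qm_out // !linear0.
rewrite scaler_sumr; apply: eq_bigr => j _.
rewrite Lop_P ?ltnS ?leq_addr // -addnS addKn Qm.unlock Pm.unlock.
rewrite -!scalerAr !scalerA addSn addnS mulrA; congr (_ *: _).
by field.
Qed.

Lemma lapbel_linear : linear (@lapbel F n).
Proof.
move=> c f h; apply: (scalerI (two_alpha_neq0 F)).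
have E (u v : A) : (2%:R * alpha) *: (c *: u + v) = c *: ((2%:R * alpha) *: u) + (2%:R * alpha) *: v.
  by rewrite scalerDr !scalerA [c * _]mulrC.
rewrite E !lapbel_Lop scaler_sumr -big_split.
apply: eq_bigr => j _; rewrite scaler_sumr -big_split; apply: eq_bigr => k _ /=.
by rewrite !linearP.
Qed.
HB.instance Definition _ := GRing.isLinear.Build F A A _ (@lapbel F n) lapbel_linear.
Lemma lapbelZ c f : lapbel (c *: f) = c *: lapbel f. Proof. exact: linearZ. Qed.

End Operators.

(** * Commutators of the Laplace-Beltrami operator with power sums and their adjoints *)

Section Lax.
Variables (F : jackField) (n : nat).
Local Notation alpha := (jf_alpha F).
Local Notation A := {mpoly F[n]}.
Implicit Types (f h : A) (i j k m : nat).

Lemma okpS m : (m < n)%N -> okp n m.+1.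
Proof. by rewrite /okp. Qed.

Lemma sum_delta (G : nat -> A) m : \sum_(k < n | (k == m :> nat)) G k = if (m < n)%N then G m else 0.
Proof.
case: ltnP => h; first by rewrite (big_pred1 (Ordinal h)).
by rewrite big1 // => k /eqP e; have := ltn_ord k; rewrite e ltnNge h.
Qed.

(** Pushed through the quadratic form of [lapbel_Lop], [Pm m.+1] is contracted either with the inner
    [Qm], which leaves column [m] of the Lax operator, or with the Lax entry itself, which leaves
    the second sum. *)
Lemma lapbel_Pm m f : (m < n)%N ->
  lapbel (Pm m.+1 f) = Pm m.+1 (lapbel f) + (m.+1%:R / 2%:R) *:
    (\sum_(j < n) Pm j.+1 (Lop j m f) + \sum_(k < n) Pm (k + m).+2 (Qm k.+1 f)).
Proof.
move=> hm; apply: (scalerI (two_alpha_neq0 F)).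
rewrite scalerDr. rewrite -PmZ !lapbel_Lop scalerA linear_sum /=.
have -> : 2%:R * alpha * (m.+1%:R / 2%:R) = alpha * m.+1%:R :> F.
  by field; exact: (two_neq0 F).
have -> : \sum_(k < n) Pm (k + m).+2 (Qm k.+1 f)
        = \sum_(j < n) \sum_(k < n | j == (k + m.+1)%N :> nat) Pm j.+1 (Qm k.+1 f).
  rewrite (exchange_big_dep xpredT) //=; apply: eq_bigr => k _.
  rewrite (sum_delta (fun j => Pm j.+1 (Qm k.+1 f))); case: ltnP => h.
    by rewrite addnS.
  by rewrite Pm_out // -addnS.
rewrite -big_split scaler_sumr -big_split; apply: eq_bigr => j _ /=.
rewrite linear_sum /= scalerDr scaler_sumr.
transitivity (\sum_(k < n) (Pm m.+1 (Pm j.+1 (Lop j k (Qm k.+1 f)))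
  + (if k == m :> nat then (alpha * m.+1%:R) *: Pm j.+1 (Lop j k f) else 0)
  + (if j == (k + m.+1)%N :> nat then (alpha * m.+1%:R) *: Pm j.+1 (Qm k.+1 f) else 0))).
  apply: eq_bigr => k _; rewrite QmPm linearD /= Lop_Pm ?okpS // !linearD !linearZ /=.
  rewrite [Pm j.+1 (Pm _ _)]PmC -!addrA; congr (_ + _).
  rewrite addrC andbT eqSS; congr (_ + _).
    by case: eqP => [->|_]; rewrite ?mul1r ?mul0r ?scale0r.
  by case: eqP => _; rewrite ?mul1r ?mul0r ?scale0r.
rewrite !big_split /= -addrA -!big_mkcond /=; congr (_ + (_ + _)).
by rewrite (sum_delta (fun k => (alpha * m.+1%:R) *: Pm j.+1 (Lop j k f))) hm.
Qed.

Lemma Qm_lapbel m f : (m < n)%N ->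
  Qm m.+1 (lapbel f) = lapbel (Qm m.+1 f) + (m.+1%:R / 2%:R) *:
    (\sum_(k < n) Lop m k (Qm k.+1 f) + \sum_(j < n) Pm j.+1 (Qm (j + m).+2 f)).
Proof.
move=> hm; apply: (scalerI (two_alpha_neq0 F)).
rewrite scalerDr -QmZ !lapbel_Lop scalerA linear_sum /=.
have -> : 2%:R * alpha * (m.+1%:R / 2%:R) = alpha * m.+1%:R :> F.
  by field; exact: (two_neq0 F).
have -> : \sum_(j < n) Pm j.+1 (Qm (j + m).+2 f)
        = \sum_(j < n) \sum_(k < n | k == (j + m.+1)%N :> nat) Pm j.+1 (Qm k.+1 f).
  apply: eq_bigr => j _.
  rewrite (sum_delta (fun k => Pm j.+1 (Qm k.+1 f))); case: ltnP => h.
    by rewrite addnS.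
  by rewrite Qm_out ?linear0 // -addnS.
rewrite scalerDr addrCA.
transitivity (\sum_(j < n) \sum_(k < n) (Pm j.+1 (Lop j k (Qm k.+1 (Qm m.+1 f)))
  + (if j == m :> nat then (alpha * m.+1%:R) *: Lop j k (Qm k.+1 f) else 0)
  + (if k == (j + m.+1)%N :> nat then (alpha * m.+1%:R) *: Pm j.+1 (Qm k.+1 f) else 0))).
  apply: eq_bigr => j _; rewrite linear_sum /=; apply: eq_bigr => k _.
  rewrite QmPm Qm_Lop ?okpS // [Qm m.+1 (Qm _ _)]QmC !linearD !linearZ /=.
  rewrite andbT eqSS -!addrA; congr (_ + _); rewrite addrC; congr (_ + _).
    rewrite eq_sym; by case: eqP => [->|_]; rewrite ?mul1r ?mul0r ?scale0r.
  by case: eqP => _; rewrite ?mul1r ?mul0r ?scale0r.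
pose X (j k : 'I_n) : A := Pm j.+1 (Lop j k (Qm k.+1 (Qm m.+1 f))).
pose Y (j k : 'I_n) : A := if j == m :> nat then (alpha * m.+1%:R) *: Lop j k (Qm k.+1 f) else 0.
pose Z (j k : 'I_n) : A :=
  if k == (j + m.+1)%N :> nat then (alpha * m.+1%:R) *: Pm j.+1 (Qm k.+1 f) else 0.
rewrite (eq_bigr (fun j : 'I_n => \sum_k X j k + \sum_k Y j k + \sum_k Z j k)); last first.
  by move=> j _; rewrite -!big_split.
rewrite /X /Y /Z.
rewrite !big_split /= -!addrA [RHS]addrCA; congr (_ + (_ + _)).
  rewrite (bigD1 (Ordinal hm)) //= [X in _ + X]big1 ?addr0.
    by rewrite eqxx scaler_sumr.
  by move=> j; rewrite -val_eqE /= => /negbTE ->; rewrite big1.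
rewrite scaler_sumr; apply: eq_bigr => j _.
by rewrite scaler_sumr [RHS]big_mkcond.
Qed.

(** The weights [k.+1] for [k < j] come from the minima in [Mop]. As [S] is invariant under
    reversal, pairing [k] with [j - k.+1] replaces each weight by the mean [j.+1 / 2]; the terms
    above the diagonal occur twice on the right, and the diagonal uses
    ['C(j.+1, 2) = j.+1 * j / 2]. *)
Lemma min_weight_sum (j : nat) (S U : nat -> A) (d : A) : (j < n)%N ->
  (forall k, (k < j)%N -> S (j - k.+1)%N = S k) ->
  \sum_(k < n) (if k == j :> nat then 'C(j.+1, 2)%:R *: d
                else if (k < j)%N then k.+1%:R *: S k else j.+1%:R *: U k)
  = (j.+1%:R / 2%:R) *: (\sum_(k < n) (if k == j :> nat then j%:R *: d
                else if (k < j)%N then S k else U k)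
       + \sum_(k < n | (j < k)%N) U k).
Proof.
move=> hj sS.
have split3 (a : A) (s u : nat -> A) :
    \sum_(k < n) (if k == j :> nat then a else if (k < j)%N then s k else u k)
    = a + \sum_(k < j) s k + \sum_(k < n | (j < k)%N) u k.
  rewrite (bigD1 (Ordinal hj)) //= eqxx -addrA; congr (_ + _).
  rewrite (bigID (fun k : 'I_n => (k < j)%N)) /=; congr (_ + _).
    rewrite [RHS](big_ord_widen n) ?(ltnW hj) //; apply: eq_big => k; rewrite -?val_eqE /=.
      by case: ltngtP.
    by case: ltngtP.
  by apply: eq_big => k; rewrite -?val_eqE /=; case: ltngtP.
rewrite (split3 _ (fun k => k.+1%:R *: S k) (fun k => j.+1%:R *: U k)) (split3 _ S U).
rewrite !scalerDr -[\sum_(k < n | _) j.+1%:R *: _]scaler_sumr.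
set su := \sum_(k < n | _) _; set ss := \sum_(k < j) S k.
have E : 2%:R *: (\sum_(k < j) k.+1%:R *: S k) = j.+1%:R *: ss.
  rewrite -[2%:R]/(1 + 1) scalerDl scale1r [X in X + _](reindex_inj rev_ord_inj) /=.
  rewrite -big_split scaler_sumr; apply: eq_bigr => k _ /=.
  rewrite sS // -scalerDl -natrD; congr (_%:R *: _); have := ltn_ord k; lia.
have -> : \sum_(k < j) k.+1%:R *: S k = (j.+1%:R / 2%:R) *: ss.
  by rewrite [_ / _]mulrC -scalerA -E scalerA mulVf ?scale1r // (two_neq0 F).
rewrite -!addrA; congr (_ + (_ + _)).
  rewrite scalerA; congr (_ *: _); apply: (mulIf (two_neq0 F)).
  by rewrite mulrAC divfK ?(two_neq0 F) // -!natrM mulnC -mul_bin_diag bin1.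
rewrite -scalerDl; congr (_ *: _); by field; exact: (two_neq0 F).
Qed.

End Lax.

(** * Weights of monomials and homogeneity *)

Section Weight.
Variables (F : jackField) (n : nat).
Local Notation alpha := (jf_alpha F).
Local Notation A := {mpoly F[n]}.
Implicit Types (f h : A) (i j k d e : nat) (m : 'X_{1..n}).

Lemma wtD m m' : wt (m + m')%MM = (wt m + wt m')%N.
Proof. by rewrite /wt -big_split; apply: eq_bigr => i _ /=; rewrite mnmDE mulnDr. Qed.

Lemma wtU (i : 'I_n) : wt U_(i)%MM = i.+1.
Proof.
rewrite /wt (bigD1 i) //= mnm1E eqxx muln1 big1 ?addn0 // => j ji.
by rewrite mnm1E eq_sym (negbTE ji) muln0.
Qed.

Lemma wt0 : wt (0%MM : 'X_{1..n}) = 0%N.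
Proof. by rewrite /wt big1 // => i _; rewrite mnm0E muln0. Qed.

Lemma mcoeffXM (i : 'I_n) f m :
  ('X_i * f)@_m = if m i == 0%N then 0 else f@_(m - U_(i)).
Proof.
rewrite mulrC; case: eqP => [m0|/eqP m0]; last first.
  have le : (U_(i) <= m)%MM by rewrite lep1mP.
  by rewrite -{1}(submK le) addmC mcoeffMX.
apply/eqP; rewrite mcoeff_eq0; apply/negP => /msuppM_le/allpairsP [[m1 m2] /= [_]].
by rewrite msuppX inE => /eqP -> e; move: m0; rewrite e mnmDE mnm1E eqxx addn1.
Qed.

Lemma mcoeff_euler (i : 'I_n) f m : ('X_i * mderiv i f)@_m = (m i)%:R * f@_m.
Proof.
rewrite mcoeffXM mcoeff_mderiv; case: eqP => [->|/eqP m0]; first by rewrite mul0r.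
have le : (U_(i) <= m)%MM by rewrite lep1mP.
by rewrite submK // mnmBE mnm1E eqxx subn1 prednK ?lt0n // mulr_natl.
Qed.

Lemma mcoeff_Pm i f m : (Pm i f)@_m != 0 ->
  exists2 m', f@_m' != 0 & wt m = (wt m' + i)%N.
Proof.
rewrite Pm.unlock; case: i => [|i]; first by rewrite pv0 mul0r mcoeff0 eqxx.
case: (ltnP i n) => hi; last by rewrite pv_out // mul0r mcoeff0 eqxx.
rewrite (pvE F (Ordinal hi)) mcoeffXM; case: (m _ =P 0%N) => [_|/eqP m0]; first by rewrite eqxx.
move=> h; exists (m - U_(Ordinal hi))%MM => //.
have le : (U_(Ordinal hi) <= m)%MM by rewrite lep1mP.
by rewrite -{1}(submK le) wtD wtU.
Qed.

Lemma mcoeff_Qm i f m : (Qm i f)@_m != 0 ->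
  exists2 m', f@_m' != 0 & wt m' = (wt m + i)%N.
Proof.
rewrite Qm.unlock mcoeffZ mulf_eq0 negb_or => /andP [_].
case: i => [|i]; first by rewrite dv0 mcoeff0 eqxx.
case: (ltnP i n) => hi; last by rewrite dv_out // mcoeff0 eqxx.
rewrite (dvE (Ordinal hi)) mcoeff_mderiv => h.
exists (m + U_(Ordinal hi))%MM; last by rewrite wtD wtU.
by apply: contraNneq h => ->; rewrite mul0rn.
Qed.

(* Homogeneity of degree [d - k], without the truncation. *)
Definition homo_at d k f := forall m, f@_m != 0 -> (wt m + k = d)%N.

Lemma homo0 d k : homo_at d k 0.
Proof. by move=> m; rewrite mcoeff0 eqxx. Qed.
Lemma homoD d k f h : homo_at d k f -> homo_at d k h -> homo_at d k (f + h).
Proof.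
move=> hf hh m; rewrite mcoeffD; case: (eqVneq f@_m 0) => [->|/hf //].
by rewrite add0r => /hh.
Qed.
Lemma homoZ d k c f : homo_at d k f -> homo_at d k (c *: f).
Proof. by move=> hf m; rewrite mcoeffZ mulf_eq0 negb_or => /andP [_ /hf]. Qed.
Lemma homo_sum d k (I : Type) (r : seq I) (P : pred I) (G : I -> A) :
  (forall t, P t -> homo_at d k (G t)) -> homo_at d k (\sum_(t <- r | P t) G t).
Proof. by move=> h; apply: big_ind => //; [exact: homo0 | move=> *; exact: homoD]. Qed.
Lemma homo_Pm d k i f : homo_at d (k + i) f -> homo_at d k (Pm i f).
Proof. by move=> hf m /mcoeff_Pm [m' /hf <- ->]; lia. Qed.
Lemma homo_Qm d k i f : homo_at d k f -> homo_at d (k + i) (Qm i f).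
Proof. by move=> hf m /mcoeff_Qm [m' /hf <- ->]; lia. Qed.
Lemma homo_Lop d e k j f : homo_at d (e + j) f -> homo_at d (e + k) (Lop k j f).
Proof.
move=> hf; case: (ltngtP j k) hf => [h|h|->] hf.
- rewrite Lop_Q //; have -> : (e + k = (e + j) + (k - j))%N by lia.
  exact: homo_Qm.
- rewrite Lop_P //; apply: homo_Pm; by rewrite -addnA subnKC // ltnW.
by rewrite Lop_d; apply: homoZ.
Qed.
Lemma homo_lapbel d k f : homo_at d k f -> homo_at d k (lapbel f).
Proof.
move=> hf; suff : homo_at d k ((2%:R * alpha) *: lapbel f).
  by move/(homoZ (c := (2%:R * alpha)^-1)); rewrite scalerA mulVf ?two_alpha_neq0 // scale1r.
rewrite lapbel_Lop; apply: homo_sum => j _; apply: homo_sum => i _.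
apply: homo_Pm; rewrite -addSnnS; apply: homo_Lop; rewrite addSnnS; exact: homo_Qm.
Qed.

End Weight.

(** * The Lax operator *)

(* [V] stands for the part of degree at most [n] of [Sym[w]]: [g k] is the
   coefficient of [w ^ k], [wx] is multiplication by [w], truncated at the top, and
   [Dx] extends [lapbel] so that it commutes with [Lx]. *)
Section LaxOperator.
Variables (F : jackField) (n : nat).
Local Notation alpha := (jf_alpha F).
Local Notation A := {mpoly F[n]}.
Local Notation V := {ffun 'I_n.+1 -> A}.
Implicit Types (f : A) (g : V) (i j k m d : nat).

Definition wid (i : 'I_n) : 'I_n.+1 := widen_ord (leqnSn n) i.
(** The matrix is determined by having row and column 0 equal to zero and by the recursion [MopS];
    that recursion says that the commutator of [Dx] with [w] is [w] times [Lx]. *)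
Definition Mop k j f : A :=
  if k == j then ((alpha - 1) * 'C(k, 2)%:R) *: f else (minn k j)%:R *: Lop k j f.
Definition Lx g : V := [ffun k : 'I_n.+1 => \sum_(j < n.+1) Lop k j (g j)].
Definition Dx g : V :=
  [ffun k : 'I_n.+1 => lapbel (g k) + \sum_(j < n.+1) Mop k j (g j)].
Definition wx g : V := [ffun k => if unlift ord0 k is Some i then g (wid i) else 0].
Definition vac f : V := [ffun k => if k == ord0 then f else 0].
(** The coefficient of [w ^ 0] in [Lx (wx g)]. On eigenvectors of [Lx] it produces the summands of
    the Pieri rule. *)
Definition pix g : A := \sum_(k < n) Pm k.+1 (g (wid k)).
Definition P1x g : V := [ffun k => Pm 1 (g k)].

Lemma Mop_linear k j : linear (Mop k j).
Proof.
move=> c f h; rewrite /Mop; case: eqP => _.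
  by rewrite scalerDr !scalerA [c * _]mulrC.
by rewrite [Lop _ _ _]linearP scalerDr !scalerA [c * _]mulrC.
Qed.
HB.instance Definition _ k j := GRing.isLinear.Build F A A _ (Mop k j) (Mop_linear k j).

Lemma Lx_linear : linear Lx.
Proof.
move=> c g h; apply/ffunP => k; rewrite !ffunE scaler_sumr -big_split.
by apply: eq_bigr => j _; rewrite !ffunE linearP.
Qed.
HB.instance Definition _ := GRing.isLinear.Build F V V _ Lx Lx_linear.
Lemma Dx_linear : linear Dx.
Proof.
move=> c g h; apply/ffunP => k; rewrite !ffunE linearP scalerDr addrACA; congr (_ + _).
rewrite scaler_sumr -big_split.
by apply: eq_bigr => j _; rewrite !ffunE linearP.
Qed.
HB.instance Definition _ := GRing.isLinear.Build F V V _ Dx Dx_linear.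
Lemma wx_linear : linear wx.
Proof.
move=> c g h; apply/ffunP => k; rewrite !ffunE; case: unlift => [i|]; rewrite ?ffunE //.
by rewrite scaler0 addr0.
Qed.
HB.instance Definition _ := GRing.isLinear.Build F V V _ wx wx_linear.
Lemma vac_linear : linear vac.
Proof.
move=> c g h; apply/ffunP => k; rewrite !ffunE; case: eqP => // _.
by rewrite scaler0 addr0.
Qed.
HB.instance Definition _ := GRing.isLinear.Build F A V _ vac vac_linear.
Lemma pix_linear : linear pix.
Proof.
move=> c g h; rewrite /pix scaler_sumr -big_split; apply: eq_bigr => k _.
by rewrite !ffunE linearP.
Qed.
HB.instance Definition _ := GRing.isLinear.Build F V A _ pix pix_linear.
Lemma P1x_linear : linear P1x.
Proof. by move=> c g h; apply/ffunP => k; rewrite !ffunE linearP. Qed.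
HB.instance Definition _ := GRing.isLinear.Build F V V _ P1x P1x_linear.

Lemma VD g g' (k : 'I_n.+1) : (g + g') k = g k + g' k. Proof. by rewrite ffunE. Qed.
Lemma VZ c g (k : 'I_n.+1) : (c *: g) k = c *: g k. Proof. by rewrite ffunE. Qed.
Lemma wx0 g : wx g ord0 = 0. Proof. by rewrite ffunE unlift_none. Qed.
Lemma wxS g (i : 'I_n) : wx g (lift ord0 i) = g (wid i).
Proof. by rewrite ffunE liftK. Qed.
Lemma vac0 f : vac f ord0 = f. Proof. by rewrite ffunE eqxx. Qed.
Lemma vacS f (i : 'I_n) : vac f (lift ord0 i) = 0.
Proof. by rewrite ffunE -val_eqE. Qed.

Lemma V_eqP g g' : g ord0 = g' ord0 -> (forall i : 'I_n, g (lift ord0 i) = g' (lift ord0 i)) ->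
  g = g'.
Proof. by move=> h0 hS; apply/ffunP => k; case: (unliftP ord0 k) => [i|] ->. Qed.

Lemma MopS k j f : Mop k.+1 j.+1 f = Mop k j f + Lop k j f.
Proof.
rewrite /Mop eqSS; case: (k =P j) => [->|kj].
  by rewrite Lop_d -scalerDl binS bin1 natrD; congr (_ *: _); ring.
by rewrite LopS (introF eqP kj) mul0r scale0r addr0 minnSS -natr1 scalerDl scale1r.
Qed.
Lemma Mop0 j f : Mop 0 j f = 0.
Proof. by rewrite /Mop; case: ifP => _; rewrite ?min0n ?bin0n ?mulr0 scale0r. Qed.
Lemma Mopn0 j f : Mop j 0 f = 0.
Proof. by rewrite /Mop; case: eqP => [->|_]; rewrite ?minn0 ?bin0n ?mulr0 scale0r. Qed.

(** Among the entries of the Lax operator only [Qm 1] fails to commute with [p_1]; these entries sit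
    just below the diagonal and contribute [alpha] times the shift by [w]. *)
Lemma Lx_P1x g : (0 < n)%N -> Lx (P1x g) = P1x (Lx g) + alpha *: wx g.
Proof.
move=> n0.
have E (k : 'I_n.+1) : Lx (P1x g) k = P1x (Lx g) k
    + \sum_(j < n.+1) ((k == j.+1 :> nat)%:R * alpha) *: g j.
  rewrite !ffunE linear_sum -big_split; apply: eq_bigr => j _ /=.
  by rewrite ffunE Lop_Pm ?addn1 ?mulr1 // /okp.
apply: V_eqP => [|i]; rewrite E [in RHS]ffunE; congr (_ + _); rewrite [in RHS]ffunE.
  by rewrite wx0 scaler0 big1 // => j _; rewrite mul0r scale0r.
rewrite wxS (bigD1 (wid i)) //= big1 ?addr0 ?eqxx ?mul1r //.
move=> j; rewrite -val_eqE /= /bump /= add1n eqSS eq_sym => /negbTE ->.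
by rewrite mul0r scale0r.
Qed.

Lemma Lx_wx g : g ord_max = 0 ->
  Lx (wx g) = wx (Lx g) + (alpha - 1) *: wx g + vac (pix g).
Proof.
move=> gn; apply: V_eqP => [|i].
  rewrite !VD VZ !wx0 vac0 scaler0 !add0r ffunE big_ord_recl wx0 linear0 add0r.
  by apply: eq_bigr => i _; rewrite wxS Lop_P.
rewrite !VD VZ vacS addr0 !wxS.
rewrite ffunE [Lx g _]ffunE big_ord_recl wx0 linear0 add0r [in RHS]big_ord_recr /= gn linear0 addr0.
rewrite (eq_bigr (fun j : 'I_n => Lop i j (g (wid j)) +
    ((j == i)%:R * (alpha - 1)) *: g (wid j))); last first.
  by move=> j _; rewrite wxS /bump !add1n LopS eq_sym.
rewrite big_split /=; congr (_ + _).
rewrite (bigD1 i) //= eqxx mul1r big1 ?addr0 // => j /negbTE ->.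
by rewrite mul0r scale0r.
Qed.

Lemma Dx_wx g : g ord_max = 0 -> Dx (wx g) = wx (Dx g + Lx g).
Proof.
move=> gn; apply: V_eqP => [|i].
  rewrite wx0 ffunE wx0 linear0 add0r big1 // => j _; exact: Mop0.
rewrite wxS VD [Dx (wx g) _]ffunE [Dx g _]ffunE [Lx g _]ffunE wxS -addrA; congr (_ + _).
rewrite big_ord_recl wx0 linear0 add0r -big_split /= [RHS]big_ord_recr /= gn !linear0 !addr0.
by apply: eq_bigr => j _; rewrite wxS /bump !add1n MopS.
Qed.

Lemma Dx_vac f : Dx (vac f) = vac (lapbel f).
Proof.
apply: V_eqP => [|i]; rewrite ffunE ?vac0 ?vacS ?linear0 big_ord_recl vac0 Mopn0 add0r.
  by rewrite big1 ?addr0 // => j _; rewrite vacS linear0.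
by rewrite big1 ?addr0 // => j _; rewrite vacS linear0.
Qed.

Lemma Dx_ord0 g : Dx g ord0 = lapbel (g ord0).
Proof. by rewrite ffunE big1 ?addr0 // => j _; apply: Mop0. Qed.

(** If [Dx g = th *: g] and [Lx g = c *: g], then [pix g] is an eigenvector of [lapbel] for
    [th + c]: this is how the content of a new box enters the eigenvalue. The proof compares the two
    sums of [lapbel_Pm] with the entries of [Mop] through [min_weight_sum]. *)
Lemma lapbel_pix g : g ord_max = 0 -> lapbel (pix g) = pix (Dx g + Lx g).
Proof.
move=> gn; rewrite /pix linear_sum /=.
pose T (j k : nat) f := Pm k.+1 (Mop k.+1 j.+1 f).
have -> : \sum_(k < n) Pm k.+1 ((Dx g + Lx g) (wid k))
   = \sum_(j < n) (Pm j.+1 (lapbel (g (wid j))) + \sum_(k < n) T j k (g (wid j))).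
  rewrite [RHS]big_split /= exchange_big -big_split /=; apply: eq_bigr => k _.
  rewrite !ffunE -addrA linearD; congr (_ + _).
  rewrite -big_split big_ord_recr /= gn !linear0 !addr0 linear_sum; apply: eq_bigr => j _.
  by rewrite /T MopS.
apply: eq_bigr => j _; rewrite lapbel_Pm //; congr (_ + _).
move: (g (wid j)) => f.
pose S k := Pm k.+1 (Pm (j - k) f); pose U k := Pm k.+1 (Qm (k - j) f).
have -> : \sum_(k < n) Pm (k + j).+2 (Qm k.+1 f) = \sum_(k < n | (j < k)%N) U k.
  rewrite -(@shift_sum _ _ U) => [|k hk]; last by rewrite /U Pm_out.
  by apply: eq_bigr => k _; rewrite /U subSn ?leq_addr // addKn [(k + j)%N]addnC.
have -> : \sum_(j0 < n) Pm j0.+1 (Lop j0 j f) = \sum_(k < n)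
    (if k == j :> nat then j%:R *: ((alpha - 1) *: Pm j.+1 f)
     else if (k < j)%N then S k else U k).
  apply: eq_bigr => k _; case: (ltngtP k j) => [h|h|->].
  - by rewrite Lop_P.
  - by rewrite Lop_Q.
  - by rewrite Lop_d PmZ scalerA mulrC.
rewrite -(min_weight_sum (S := S)) //; last first.
  move=> k hk; rewrite /S PmC; congr (Pm _ (Pm _ _)); lia.
apply: eq_bigr => k _; rewrite /T /Mop eqSS; case: (ltngtP k j) => [h|h|->].
- by rewrite Lop_P // subSS PmZ minnSS (minn_idPl (ltnW h)).
- by rewrite Lop_Q // subSS PmZ minnSS (minn_idPr (ltnW h)).
- by rewrite PmZ scalerA mulrC.
Qed.

Lemma Dx_Lx_vac f : Dx (Lx (vac f)) = Lx (vac (lapbel f)).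
Proof.
have LV h (k : 'I_n.+1) : Lx (vac h) k = Lop k 0 h.
  rewrite ffunE big_ord_recl vac0 big1 ?addr0 // => j _.
  by rewrite vacS linear0.
apply: V_eqP => [|i].
  by rewrite Dx_ord0 !LV !Lop_d mulr0 !scale0r linear0.
rewrite ffunE !LV !lift0 !Lop_Q // !subn0 Qm_lapbel //; congr (_ + _).
rewrite big_ord_recl Mopn0 add0r.
pose S k := Qm k.+1 (Qm (i - k) f); pose U k := Pm (k - i) (Qm k.+1 f).
have -> : \sum_(j < n) Pm j.+1 (Qm (j + i).+2 f) = \sum_(k < n | (i < k)%N) U k.
  rewrite -(@shift_sum _ _ U) => [|k hk]; last by rewrite /U Qm_out ?linear0.
  by apply: eq_bigr => k _; rewrite /U subSn ?leq_addr // addKn [(k + i)%N]addnC.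
have -> : \sum_(k < n) Lop i k (Qm k.+1 f) = \sum_(k < n)
    (if k == i :> nat then i%:R *: ((alpha - 1) *: Qm i.+1 f)
     else if (k < i)%N then S k else U k).
  apply: eq_bigr => k _; case: (ltngtP k i) => [h|h|->].
  - by rewrite Lop_Q // QmC.
  - by rewrite Lop_P.
  - by rewrite Lop_d scalerA mulrC.
rewrite -(min_weight_sum (S := S)) //; last first.
  move=> k hk; rewrite /S QmC; congr (Qm _ (Qm _ _)); lia.
apply: eq_bigr => k _; rewrite LV !lift0 Lop_Q // subn0 /Mop eqSS.
case: (ltngtP k i) => [h|h|e].
- by rewrite Lop_Q // subSS minnSS (minn_idPr (ltnW h)) QmC.
- by rewrite Lop_P // subSS minnSS (minn_idPl (ltnW h)).
- by rewrite e scalerA mulrC.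
Qed.

Definition homoV d g := forall k : 'I_n.+1, homo_at d k (g k).

End LaxOperator.

(** * Commutation of the Lax operator with the extended Laplace-Beltrami operator *)

Section LaxCommute.
Variables (F : jackField) (n : nat).
Local Notation A := {mpoly F[n]}.
Local Notation V := {ffun 'I_n.+1 -> A}.
Implicit Types (f : A) (g : V) (i j k m d : nat).

Lemma homoV0 d : homoV d (0 : V).
Proof. by move=> k; rewrite ffunE; apply: homo0. Qed.
Lemma homoVD d g g' : homoV d g -> homoV d g' -> homoV d (g + g').
Proof. by move=> hg hg' k; rewrite ffunE; apply: homoD. Qed.
Lemma homoVZ d c g : homoV d g -> homoV d (c *: g).
Proof. by move=> hg k; rewrite ffunE; apply: homoZ. Qed.
Lemma homoV_Lx d g : homoV d g -> homoV d (Lx g).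
Proof.
move=> hg k; rewrite ffunE; apply: homo_sum => j _.
by rewrite -[nat_of_ord k]add0n; apply: homo_Lop; rewrite add0n.
Qed.
Lemma homoV_Dx d g : homoV d g -> homoV d (Dx g).
Proof.
move=> hg k; rewrite ffunE; apply: homoD; first exact: homo_lapbel.
apply: homo_sum => j _; rewrite /Mop; case: eqP => [e|_].
  by apply: homoZ; rewrite e; apply: hg.
by apply: homoZ; rewrite -[nat_of_ord k]add0n; apply: homo_Lop; rewrite add0n.
Qed.
Lemma homoV_vac d f : homo_at d 0 f -> homoV d (vac f).
Proof. by move=> hf k; rewrite ffunE; case: eqP => [->//|_]; apply: homo0. Qed.
Lemma homoV_wx d g : homoV d g -> homoV d.+1 (wx g).
Proof.
move=> hg k; case: (unliftP ord0 k) => [i|] ->; last by rewrite wx0; apply: homo0.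
by rewrite wxS lift0 => m /hg /=; lia.
Qed.
Lemma homo_pix d g : homoV d g -> homo_at d.+1 0 (pix g).
Proof.
move=> hg; apply: homo_sum => k _; apply: homo_Pm => m /hg /=; lia.
Qed.
Lemma homo_large d k f : homo_at d k f -> (d < k)%N -> f = 0.
Proof.
move=> hf h; apply/mpolyP => m; rewrite mcoeff0; apply/eqP; apply: contraTT h.
by move=> /hf <-; rewrite -leqNgt leq_addl.
Qed.
Lemma homoV_top d g : homoV d g -> (d < n)%N -> g ord_max = 0.
Proof. by move=> hg h; apply: (homo_large (hg _)). Qed.

Lemma homoV_pact d q g : homoV d g -> homoV d (pact (@Lx F n) q g).
Proof.
move=> hg; apply: (pact_mem (S := homoV d)) => //.
- exact: homoV0.
- by move=> x y; apply: homoVD.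
- by move=> c x; apply: homoVZ.
- by move=> x; apply: homoV_Lx.
Qed.

(** Moving [wx] to the left of both operators leaves the same multiples of [wx] on the two sides,
    and the vacuum terms agree by [lapbel_pix]. The bound [d < n] makes the top coefficients vanish,
    so that the truncation in [wx] loses nothing. *)
Lemma Dx_Lx_wx d g : (d < n)%N -> homoV d g -> Dx (Lx g) = Lx (Dx g) ->
  Dx (Lx (wx g)) = Lx (Dx (wx g)).
Proof.
move=> hd hg C.
have g0 := homoV_top hg hd; have Lg0 := homoV_top (homoV_Lx hg) hd.
have s0 : (Dx g + Lx g) ord_max = 0.
  by rewrite ffunE (homoV_top (homoV_Dx hg) hd) Lg0 addr0.
have LD u v : Lx (u + v) = Lx u + Lx v by apply: linearD.
have DD u v : Dx (u + v) = Dx u + Dx v by apply: linearD.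
have DZ c u : Dx (c *: u) = c *: Dx u by apply: linearZ.
rewrite (Lx_wx g0) (Dx_wx g0) (Lx_wx s0) DD DD DZ (Dx_wx Lg0) (Dx_wx g0) Dx_vac.
by rewrite (lapbel_pix g0) LD C.
Qed.

Lemma iter_wx_vac f k (j : 'I_n.+1) : (k <= n)%N ->
  iter k (@wx F n) (vac f) j = if j == k :> nat then f else 0.
Proof.
elim: k j => [|k IH] j hk /=; first by rewrite ffunE -val_eqE.
case: (unliftP ord0 j) => [i|] ->; last by rewrite wx0.
by rewrite wxS IH ?(ltnW hk) // lift0.
Qed.

Lemma homoV_iter_wx d k f : homo_at d 0 f -> homoV (d + k) (iter k (@wx F n) (vac f)).
Proof.
move=> hf; elim: k => [|k IH] /=; first by rewrite addn0; apply: homoV_vac.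
by rewrite addnS; apply: homoV_wx.
Qed.

(** Every vector is a sum of powers of [w] applied to vacuum vectors; commutation holds on the
    latter and passes from [g] to [wx g] as long as the degree stays at most [n]. *)
Lemma Dx_Lx d g : (d <= n)%N -> homoV d g -> Dx (Lx g) = Lx (Dx g).
Proof.
move=> hd hg.
have -> : g = \sum_(k < n.+1) iter k (@wx F n) (vac (g k)).
  apply/ffunP => j; rewrite sum_ffunE (bigD1 j) //= iter_wx_vac ?leq_ord // eqxx.
  rewrite big1 ?addr0 // => k kj; rewrite iter_wx_vac ?leq_ord //.
  by rewrite val_eqE eq_sym (negbTE kj).
have LS (h : 'I_n.+1 -> V) : Lx (\sum_k h k) = \sum_k Lx (h k) by apply: linear_sum.
have DS (h : 'I_n.+1 -> V) : Dx (\sum_k h k) = \sum_k Dx (h k) by apply: linear_sum.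
rewrite LS !DS LS; apply: eq_bigr => k _.
have [h|h] := ltnP d k.
  have -> : g k = 0 by apply: (homo_large (hg k)).
  suff -> : iter k (@wx F n) (vac (0 : A)) = 0 by rewrite !linear0.
  by elim: (nat_of_ord k) => [|i IH] /=; rewrite ?IH linear0.
have hk : homo_at (d - k) 0 (g k) by move=> m /hg; lia.
have : (d - k + k <= n)%N by rewrite subnK.
move: (d - k)%N (g k) hk => e f hk.
elim: (nat_of_ord k) => [|i IH] /=; first by rewrite Dx_Lx_vac Dx_vac.
rewrite addnS => hi; apply: (Dx_Lx_wx hi); last by apply: IH; apply: ltnW.
exact: homoV_iter_wx.
Qed.

Lemma Dx_iter_Lx d a g : (d <= n)%N -> homoV d g -> Dx (iter a (@Lx F n) g) = iter a (@Lx F n) (Dx g).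
Proof.
move=> hd hg; elim: a => //= a IH; rewrite (Dx_Lx hd) ?IH //.
by elim: (a) => //= b; apply: homoV_Lx.
Qed.

Lemma Dx_pact d q g : (d <= n)%N -> homoV d g -> Dx (pact (@Lx F n) q g) = pact (@Lx F n) q (Dx g).
Proof.
move=> hd hg; rewrite /pact linear_sum; apply: eq_bigr => i _.
by rewrite linearZ /= (Dx_iter_Lx _ hd hg).
Qed.

End LaxCommute.

(** * The deformed scalar product *)

HB.lock Definition ip (F : jackField) (n : nat) (f h : {mpoly F[n]}) : F :=
  \sum_(m <- msupp f) f@_m * h@_m * jf_alpha F ^+ plen m * (zee m)%:R.

Section InnerProduct.
Variables (F : jackField) (n : nat).
Local Notation alpha := (jf_alpha F).
Local Notation A := {mpoly F[n]}.
Local Notation V := {ffun 'I_n.+1 -> A}.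
Implicit Types (f h : A) (g : V) (i j k d : nat) (m : 'X_{1..n}).

Lemma ip_subset (s : seq 'X_{1..n}) f h : uniq s -> {subset msupp f <= s} ->
  ip f h = \sum_(m <- s) f@_m * h@_m * alpha ^+ plen m * (zee m)%:R.
Proof.
move=> us sub; rewrite ip.unlock [RHS](bigID (mem (msupp f))) /= [X in _ + X]big1 ?addr0.
  rewrite -[RHS]big_filter; apply: perm_big; apply: uniq_perm; rewrite ?msupp_uniq ?filter_uniq //.
  by move=> m; rewrite mem_filter; case: (boolP (m \in msupp f)) => // /sub ->.
by move=> m /memN_msupp_eq0 ->; rewrite !mul0r.
Qed.

Lemma ipC f h : ip f h = ip h f.
Proof.
pose s := undup (msupp f ++ msupp h).
have us : uniq s := undup_uniq _.
rewrite (ip_subset (s := s)) //; last by move=> m hm; rewrite mem_undup mem_cat hm.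
rewrite (ip_subset (s := s)) //; last by move=> m hm; rewrite mem_undup mem_cat hm orbT.
by apply: eq_bigr => m _; rewrite [_ * h@_m]mulrC.
Qed.

Lemma ip_linear f : scalar (ip f).
Proof.
move=> c h h'; rewrite ip.unlock mulr_sumr -big_split; apply: eq_bigr => m _ /=.
by rewrite mcoeffD mcoeffZ; ring.
Qed.
HB.instance Definition _ f := GRing.isLinear.Build F A F _ (ip f) (ip_linear f).

Lemma ipDr f h h' : ip f (h + h') = ip f h + ip f h'. Proof. exact: linearD. Qed.
Lemma ipZr c f h : ip f (c *: h) = c * ip f h. Proof. exact: linearZ. Qed.
Lemma ip0r f : ip f 0 = 0. Proof. exact: linear0. Qed.
Lemma ip_sumr f (I : Type) (r : seq I) (P : pred I) (G : I -> A) :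
  ip f (\sum_(t <- r | P t) G t) = \sum_(t <- r | P t) ip f (G t).
Proof. exact: linear_sum. Qed.
Lemma ipDl f h h' : ip (h + h') f = ip h f + ip h' f.
Proof. by rewrite ipC ipDr ![ip f _]ipC. Qed.
Lemma ipZl c f h : ip (c *: h) f = c * ip h f.
Proof. by rewrite ipC ipZr [ip f _]ipC. Qed.
Lemma ip0l f : ip 0 f = 0. Proof. by rewrite ipC ip0r. Qed.
Lemma ip_suml f (I : Type) (r : seq I) (P : pred I) (G : I -> A) :
  ip (\sum_(t <- r | P t) G t) f = \sum_(t <- r | P t) ip (G t) f.
Proof. by rewrite ipC ip_sumr; apply: eq_bigr => t _; rewrite ipC. Qed.

Lemma ipX m h : ip 'X_[m] h = h@_m * alpha ^+ plen m * (zee m)%:R.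
Proof. by rewrite ip.unlock msuppX big_seq1 mcoeffX eqxx mul1r. Qed.

Lemma zeeU m (i : 'I_n) : zee (m + U_(i))%MM = (zee m * (i.+1 * (m i).+1))%N.
Proof.
rewrite /zee (bigD1 i) // [in RHS](bigD1 i) //= [RHS]mulnAC; congr (_ * _)%N.
  rewrite mnmDE mnm1E eqxx addn1 expnS factS; lia.
by apply: eq_bigr => j ji; rewrite mnmDE mnm1E eq_sym (negbTE ji) addn0.
Qed.

Lemma zee_gt0 m : (0 < zee m)%N.
Proof. by rewrite /zee prodn_gt0 // => i; rewrite muln_gt0 expn_gt0 fact_gt0. Qed.

(** On monomials this is the recursion [zeeU] for the numbers [zee], together with one factor
    [alpha] for the extra part. *)
Lemma ip_Qm i f h : ip (Qm i f) h = ip f (Pm i h).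
Proof.
elim/mpolyind: f => [|c m f _ _ IH]; first by rewrite linear0 !ip0l.
rewrite linearD ipDl IH ipDl; congr (_ + _); rewrite linearZ /= !ipZl; congr (_ * _).
case: i {IH} => [|i].
  by rewrite Qm.unlock Pm.unlock dv0 pv0 scaler0 mul0r ip0l ip0r.
case: (ltnP i n) => hi; last by rewrite Qm_out // Pm_out // ip0l ip0r.
rewrite Qm.unlock Pm.unlock (dvE (Ordinal hi)) (pvE _ (Ordinal hi)) mderivX ipZl ipZl !ipX mcoeffXM.
case: eqP => [->|/eqP m0]; first by rewrite !mul0r mulr0.
have le : (U_(Ordinal hi) <= m)%MM by rewrite lep1mP.
set m' := (m - _)%MM.
have mE : m = (m' + U_(Ordinal hi))%MM by rewrite submK.
have m'i : (m' (Ordinal hi)).+1 = m (Ordinal hi).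
  by rewrite mnmBE mnm1E eqxx subn1 prednK // lt0n.
have -> : zee m = (zee m' * (i.+1 * m (Ordinal hi)))%N by rewrite {1}mE zeeU m'i.
have -> : plen m = (plen m').+1 by rewrite {1}mE /plen mdegD mdeg1 addn1.
by rewrite exprS !natrM /=; ring.
Qed.

Lemma ip_Pm i f h : ip (Pm i f) h = ip f (Qm i h).
Proof. by rewrite ipC -ip_Qm ipC. Qed.

Lemma ip_Lop k j f h : ip (Lop k j f) h = ip f (Lop j k h).
Proof.
case: (ltngtP k j) => [lt|lt|->].
- by rewrite Lop_P // Lop_Q // ip_Pm.
- by rewrite Lop_Q // Lop_P // ip_Qm.
- by rewrite !Lop_d ipZl ipZr.
Qed.

Lemma ip_lapbel f h : ip (lapbel f) h = ip f (lapbel h).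
Proof.
apply: (mulfI (two_alpha_neq0 F)); rewrite -ipZl -ipZr !lapbel_Lop.
rewrite ip_suml ip_sumr.
under eq_bigr => j _ do rewrite ip_suml.
under [RHS]eq_bigr => j _ do rewrite ip_sumr.
rewrite exchange_big /=; apply: eq_bigr => k _; apply: eq_bigr => j _.
by rewrite ip_Pm ip_Lop ip_Qm.
Qed.

Lemma ip_eq0 f : ip f f = 0 -> f = 0.
Proof.
rewrite ip.unlock => h; apply/mpolyP => m; rewrite mcoeff0.
case: (boolP (m \in msupp f)) => [hm|/memN_msupp_eq0 //].
apply: (@jf_aniso F _ (msupp f) (fun m => plen m) (fun m => zee m) (fun m => f@_m)) => //.
  by move=> m' _; apply: zee_gt0.
by rewrite -[RHS]h; apply: eq_bigr => m' _; ring.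
Qed.

Definition ipV (g g' : V) : F := \sum_(k < n.+1) ip (g k) (g' k).

Lemma ipV_linear g : scalar (ipV g).
Proof.
move=> c u v; rewrite /ipV mulr_sumr -big_split; apply: eq_bigr => k _ /=.
by rewrite !ffunE ipDr ipZr.
Qed.
HB.instance Definition _ g := GRing.isLinear.Build F V F _ (ipV g) (ipV_linear g).

Lemma ipVC (g g' : V) : ipV g g' = ipV g' g.
Proof. by apply: eq_bigr => k _; rewrite ipC. Qed.

Lemma ipV_Lx (g g' : V) : ipV (Lx g) g' = ipV g (Lx g').
Proof.
rewrite /ipV; under eq_bigr => k _ do rewrite ffunE ip_suml.
under [RHS]eq_bigr => k _ do rewrite ffunE ip_sumr.
rewrite exchange_big /=; apply: eq_bigr => k _; apply: eq_bigr => j _.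
exact: ip_Lop.
Qed.

Lemma ipV_pact q (g g' : V) : ipV (pact (@Lx F n) q g) g' = ipV g (pact (@Lx F n) q g').
Proof.
have It i : ipV (iter i (@Lx F n) g) g' = ipV g (iter i (@Lx F n) g').
  by elim: i g' => //= i IH g'; rewrite ipV_Lx IH -iterSr.
rewrite ipVC /pact [in LHS]linear_sum [in RHS]linear_sum /=; apply: eq_bigr => i _.
by rewrite !linearZ /= ipVC It.
Qed.

Lemma ipV_vac f (g : V) : ipV (vac f) g = ip f (g ord0).
Proof.
rewrite /ipV big_ord_recl vac0 big1 ?addr0 // => i _.
by rewrite vacS ip0l.
Qed.

Lemma ipV_eq0 (g : V) : ipV g g = 0 -> g = 0.
Proof.
move=> h; apply/ffunP => k; rewrite ffunE; apply/mpolyP => m; rewrite mcoeff0.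
case: (boolP (m \in msupp (g k))) => [hm|/memN_msupp_eq0 //].
pose r := [seq (l, m') | l <- enum 'I_n.+1, m' <- msupp (g l)].
apply: (@jf_aniso F _ r (fun t => plen t.2) (fun t => zee t.2) (fun t => (g t.1)@_t.2) _ _ (k, m)).
- by move=> t _; apply: zee_gt0.
- rewrite -[RHS]h /r big_allpairs_dep /= /ipV big_enum /=; apply: eq_bigr => i _.
  by rewrite ip.unlock; apply: eq_bigr => m' _ /=; ring.
- by apply/allpairsPdep; exists k, m; rewrite mem_enum.
Qed.

End InnerProduct.

(** * Moment functionals and their generating functions *)

Section Moments.
Variable F : fieldType.
Implicit Types (p q : {poly F}) (k : nat -> F) (c : F).

(** The linear functional with value [k i] at ['X^i]. When [k] is the sequence of vacuum moments of
    [L], it gives the vacuum component of any polynomial in [L] ([pact_mom]). *)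
Definition mom k q : F := \sum_(i < size q) q`_i * k i.

Lemma momE n k q : (size q <= n)%N -> mom k q = \sum_(i < n) q`_i * k i.
Proof.
move=> le_q; rewrite /mom (big_ord_widen n (fun i => q`_i * k i)) //.
rewrite big_mkcond /=; apply: eq_bigr => i _; case: ltnP => // h.
by rewrite nth_default // mul0r.
Qed.

Lemma mom_is_scalar k : scalar (mom k).
Proof.
move=> c p q /=; pose m := maxn (size p) (size q).
have sp : (size p <= m)%N by rewrite leq_maxl.
have sq : (size q <= m)%N by rewrite leq_maxr.
have sc : (size (c *: p + q)%R <= m)%N.
  by rewrite (leq_trans (size_polyD _ _)) // geq_max sq (leq_trans (size_scale_leq _ _)).
rewrite (momE _ sc) (momE _ sp) (momE _ sq) mulr_sumr -big_split.
by apply: eq_bigr => i _ /=; rewrite coefD coefZ mulrDl mulrA.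
Qed.
HB.instance Definition _ k :=
  GRing.isLinear.Build F {poly F} F _ (mom k) (mom_is_scalar k).

Lemma momB k p q : mom k (p - q) = mom k p - mom k q. Proof. exact: linearB. Qed.
Lemma momZ k c q : mom k (c *: q) = c * mom k q. Proof. exact: linearZ. Qed.

Lemma momXn k m : mom k 'X^m = k m.
Proof.
rewrite /mom size_polyXn big_ord_recr /= coefXn eqxx mul1r big1 ?add0r // => i _.
by rewrite coefXn ltn_eqF ?mul0r.
Qed.

Lemma mom_geo c q : mom (fun i => c ^+ i) q = q.[c].
Proof. by rewrite horner_coef. Qed.

Definition lin c : {poly F} := 1 - c *: 'X.

Lemma lin_coef0 c : (lin c)`_0 = 1.
Proof. by rewrite /lin coefB coef1 coefZ coefX mulr0 subr0. Qed.

Lemma prod_lin_coef0 (I : Type) (r : seq I) (P : pred I) (c : I -> F) :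
  (\prod_(i <- r | P i) lin (c i))`_0 = 1.
Proof.
elim: r => [|i r IH]; first by rewrite big_nil coef1.
by rewrite big_cons; case: (P i); rewrite // coef0M IH lin_coef0 mulr1.
Qed.

Lemma conv_lin c p k m : conv (lin c * p) k m.+1 = conv p k m.+1 - c * conv p k m.
Proof.
rewrite /lin mulrBl mul1r convDl; congr (_ + _).
by rewrite -scalerAl -scaleNr -mul_polyC convM convC conv_XM mulNr.
Qed.

(* [\prod ('X - c)] is the reversal of [\prod (1 - c X)] *)
Lemma mom_prod_conv (s : seq F) k m :
  mom k ((\prod_(c <- s) ('X - c%:P)) * 'X^m) = conv (\prod_(c <- s) lin c) k (size s + m).
Proof.
elim: s m => [|c s IH] m; first by rewrite !big_nil mul1r momXn -(polyC1 F) convC mul1r.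
rewrite !big_cons /= addSn conv_lin -addnS -!IH -momZ -momB; congr (mom _ _).
by rewrite exprS -mul_polyC; ring.
Qed.

(** The moment of ['X^m] times the product over [s] is the coefficient of [N] of index [size s + m],
    and this lies beyond the size of [N]. *)
Lemma mom_prod_eq0 (s : seq F) N k q : gen (\prod_(c <- s) lin c) N k ->
  (size N <= size s)%N -> mom k ((\prod_(c <- s) ('X - c%:P)) * q) = 0.
Proof.
move=> gk sN; rewrite -[q]coefK poly_def mulr_sumr linear_sum big1 //= => i _.
rewrite -scalerAr momZ mom_prod_conv gk [N`_ _]nth_default ?mulr0 //.
exact: leq_trans sN (leq_addr _ _).
Qed.

Lemma conv_lin_geo c m : conv (lin c) (fun i => c ^+ i) m = (1 : {poly F})`_m.
Proof.
rewrite -[lin c]mulr1; case: m => [|m]; last first.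
  by rewrite conv_lin -(polyC1 F) !convC !mul1r exprS subrr coefC.
by rewrite convE big_ord1 mulr1 lin_coef0 mul1r coef1.
Qed.

(** Multiplying the series by the factors from [s] leaves the product over [t] divided by [1 - c X].
    The coefficient of index [size t] in this quotient is the product of the [c - b]. Up to the
    Lagrange denominator this is a residue, the weight that the moments put at [c]. *)
Lemma mom_residue c (s t : seq F) k :
  gen (lin c * \prod_(b <- s) lin b) (\prod_(b <- t) lin b) k -> size s = size t ->
  mom k (\prod_(b <- s) ('X - b%:P)) = \prod_(b <- t) (c - b).
Proof.
move=> gk st; rewrite -[\prod_(b <- s) _]mulr1 -(expr0 'X) mom_prod_conv addn0 st.
have E : conv (\prod_(b <- s) lin b) k =1 conv (\prod_(b <- t) lin b) (fun i => c ^+ i).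
  apply: (@conv_inj _ (lin c)); first by rewrite lin_coef0 oner_neq0.
  move=> m; rewrite -convM gk -convM mulrC convM.
  by rewrite (eq_conv _ (conv_lin_geo c)) conv_poly mulr1.
rewrite E -[size t]addn0 -mom_prod_conv expr0 mulr1 mom_geo horner_prod.
by apply: eq_bigr => b _; rewrite hornerXsubC.
Qed.

Lemma size_prod_lin (s : seq F) : (size (\prod_(b <- s) lin b)%R <= (size s).+1)%N.
Proof.
elim: s => [|c s IH]; first by rewrite big_nil size_poly1.
rewrite big_cons; apply: (leq_trans (size_polyMleq _ _)) => /=.
have : (size (lin c) <= 2)%N.
  apply: (leq_trans (size_polyD _ _)); rewrite geq_max size_poly1 size_polyN.
  by apply: (leq_trans (size_scale_leq _ _)); rewrite size_polyX.
by move=> h; rewrite -subn1 leq_subLR; apply: leq_add h IH.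
Qed.

End Moments.

Section MomentPact.
Variables (F : fieldType) (V : lmodType F) (L : {linear V -> V}).
Lemma pact_mom (W : lmodType F) (ev : {linear V -> W}) v u (k : nat -> F) :
  (forall a, ev (iter a L v) = k a *: u) -> forall q, ev (pact L q v) = mom k q *: u.
Proof.
move=> h q; rewrite /pact linear_sum /mom scaler_suml; apply: eq_bigr => i _.
by rewrite linearZ /= h scalerA.
Qed.
End MomentPact.

(* The moments of the transition measure of a Young diagram when a box of
   content [c] is added: k' = k + alpha * eta. *)
Section AddBoxMoments.
Variables (F : fieldType) (alpha c : F) (k : nat -> F).

Fixpoint addbox_rec a : F * F :=
  if a is a'.+1 then
    let: (xi, eta) := addbox_rec a' in
    ((c + alpha - 1) * xi + (k a' + alpha * eta), c * eta + xi)
  else (0, 0).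
Definition addbox_xi a := (addbox_rec a).1.
Definition addbox_eta a := (addbox_rec a).2.
Definition addbox_mom a := k a + alpha * addbox_eta a.

Lemma addbox_xiS a :
  addbox_xi a.+1 = (c + alpha - 1) * addbox_xi a + addbox_mom a.
Proof. by rewrite /addbox_xi /addbox_mom /addbox_eta /=; case: addbox_rec. Qed.
Lemma addbox_etaS a : addbox_eta a.+1 = c * addbox_eta a + addbox_xi a.
Proof. by rewrite /addbox_xi /addbox_eta /=; case: addbox_rec. Qed.

(** As power series, [(1 - c X) eta = X xi] and [(1 - (c + alpha - 1) X) xi = X k'], where [k'] is
    [addbox_mom]. Eliminating [eta] and [xi] from [k' = k + alpha eta] leaves a factor on [k'] that
    differs from [(1 - c X)(1 - (c + alpha - 1) X)] by [- alpha X^2], and this factor splits as on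
    the left. *)
Lemma addbox_momP m :
  conv (lin (c + alpha) * lin (c - 1)) addbox_mom m = conv (lin c * lin (c + alpha - 1)) k m.
Proof.
have eta_xi : conv (lin c) addbox_eta =1 conv 'X addbox_xi.
  case=> [|a]; rewrite -['X]mulr1 conv_XM -[lin c]mulr1.
    by rewrite convE big_ord1 mulr0.
  by rewrite conv_lin -(polyC1 F) !convC !mul1r addbox_etaS addrC addKr.
have xi_mom : conv (lin (c + alpha - 1)) addbox_xi =1 conv 'X addbox_mom.
  case=> [|a]; rewrite -['X]mulr1 conv_XM -[lin _]mulr1.
    by rewrite convE big_ord1 mulr0.
  by rewrite conv_lin -(polyC1 F) !convC !mul1r addbox_xiS addrC addKr.
have -> : lin (c + alpha) * lin (c - 1) =
    lin c * lin (c + alpha - 1) + (- alpha)%:P * ('X * 'X).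
  rewrite /lin -!mul_polyC !(polyCD, polyCB, polyCN); ring.
rewrite convDl convM [in X in _ + X]convM convC.
have -> : conv (lin c) (conv (lin (c + alpha - 1)) addbox_mom) m
  = conv (lin c * lin (c + alpha - 1)) k m + alpha * conv ('X * 'X) addbox_mom m.
  rewrite -convM convDr convZr; congr (_ + alpha * _).
  rewrite [lin c * _]mulrC [LHS]convM (eq_conv _ eta_xi) -convM [_ * 'X]mulrC.
  by rewrite !convM (eq_conv _ xi_mom).
by rewrite mulNr addrK.
Qed.

Lemma addbox_gen D N : gen (lin c * D) (lin (c - 1) * N) k ->
  gen (lin (c + alpha) * D) (lin (c + alpha - 1) * N) addbox_mom.
Proof.
move=> gk; apply: (@gen_cancel _ (lin (c - 1))); first by rewrite lin_coef0 oner_neq0.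
move=> m; have -> : lin (c - 1) * (lin (c + alpha) * D) = D * (lin (c + alpha) * lin (c - 1)) by ring.
rewrite convM (eq_conv _ addbox_momP) -convM.
have -> : D * (lin c * lin (c + alpha - 1)) = lin (c + alpha - 1) * (lin c * D) by ring.
by rewrite (gen_mul (lin (c + alpha - 1)) gk) mulrCA.
Qed.

End AddBoxMoments.

(** * Jack eigenspaces and the Pieri rule *)

Definition addbox (ga : nat -> nat) (i : nat) : nat -> nat := fun j => (ga j + (j == i))%N.
Definition addable (ga : nat -> nat) (i : nat) := (i == 0%N) || (ga i < ga i.-1)%N.
Definition diagram (n d : nat) (ga : nat -> nat) :=
  [/\ forall i, (ga i.+1 <= ga i)%N, forall i, (n <= i)%N -> ga i = 0%N
    & (\sum_(i < n) ga i)%N = d].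

(** The content of the first free box of row [i]. *)
Definition cont (F : jackField) (ga : nat -> nat) (i : nat) : F :=
  jf_alpha F * (ga i)%:R - i%:R.
(** If row [i.+1] is as long as row [i], then its factor in [den] cancels the factor of row [i] in
    [num]. The poles that remain belong to the rows where a box may be added. *)
Definition den (F : jackField) N ga : {poly F} := \prod_(i < N) lin (cont F ga i).
Definition num (F : jackField) N ga : {poly F} := \prod_(i < N) lin (cont F ga i - 1).

Lemma diagram_le n d ga i j : diagram n d ga -> (i <= j)%N -> (ga j <= ga i)%N.
Proof.
case=> mono _ _ /subnK <-; elim: (j - i)%N => // m IH.
exact: leq_trans (mono _) IH.
Qed.

(** A box in row [n] needs [n] nonempty rows above it, hence at least [n] boxes. *)
Lemma addable_lt n d ga i : diagram n d ga -> (d < n)%N -> (i <= n)%N -> addable ga i -> (i < n)%N.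
Proof.
move=> hga hd; rewrite leq_eqVlt => /orP [/eqP ->|//]; case/orP => [/eqP n0|].
  by rewrite n0 in hd.
case: (hga) => _ out sum; rewrite out // => pos; exfalso.
move: hd; rewrite ltnNge -sum => /negP []; rewrite -{1}[n]card_ord -sum1_card.
apply: leq_sum => i' _; apply: leq_trans pos _; apply: (diagram_le hga).
by rewrite -ltnS prednK // (leq_ltn_trans _ (ltn_ord i')).
Qed.

Lemma diagram_addbox n d ga i : diagram n d ga -> (i < n)%N -> addable ga i ->
  diagram n d.+1 (addbox ga i).
Proof.
move=> hga hi ad; have [mono out sum] := hga; split.
- move=> j; rewrite /addbox; case: (eqVneq j.+1 i) => [e|ne]; last first.
    by rewrite addn0 (leq_trans (mono j)) // leq_addr.
  move: ad; rewrite -e /addable /= => lt.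
  by rewrite addn1 (leq_trans lt) // leq_addr.
- move=> j hj; rewrite /addbox out // gtn_eqF //; exact: leq_trans hi hj.
rewrite /addbox big_split /= sum (bigD1 (Ordinal hi)) //= eqxx big1 ?addn0 ?addn1 //.
by move=> j; rewrite -val_eqE /= => /negbTE ->.
Qed.

Section Pieri.
Variables (F : jackField) (n : nat).
Local Notation alpha := (jf_alpha F).
Local Notation A := {mpoly F[n]}.
Local Notation V := {ffun 'I_n.+1 -> A}.
Local Notation L := (@Lx F n).
Local Notation cont := (cont F).

(* The extra factor of [den] belongs to the empty row [n], where a box may be added. *)
Definition jackspace (ga : nat -> nat) (f : A) :=
  exists2 k, gen (den F n.+1 ga) (num F n ga) k
           & forall a, (iter a L (vac f)) ord0 = k a *: f.

Definition vacp (g : V) : A := g ord0.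
Lemma vacp_linear : linear vacp.
Proof. by move=> c g h; rewrite /vacp !ffunE. Qed.
HB.instance Definition _ := GRing.isLinear.Build F V A _ vacp vacp_linear.

Lemma vacpD g g' : vacp (g + g') = vacp g + vacp g'. Proof. exact: VD. Qed.
Lemma vacpZ c g : vacp (c *: g) = c *: vacp g. Proof. exact: VZ. Qed.

(* The specialisation of every power sum to ['X]. *)
Definition psX (f : A) : {poly F} := mmap (@polyC F) (fun=> 'X) f.

Lemma psX_Pm i f : (0 < i <= n)%N -> psX (Pm i f) = 'X * psX f.
Proof.
case: i => // i /= hi; rewrite Pm.unlock (pvE F (Ordinal hi)) /psX rmorphM /= mmapX.
by rewrite mmap1U.
Qed.

Lemma psXZ c f : psX (c *: f) = c *: psX f.
Proof. by rewrite /psX mmapZ mul_polyC. Qed.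

Lemma psX_sum (I : Type) (r : seq I) (P : pred I) (G : I -> A) :
  psX (\sum_(t <- r | P t) G t) = \sum_(t <- r | P t) psX (G t).
Proof. exact: raddf_sum. Qed.

(** After specialisation, row 0 of the eigenvector equation says that ['X] times the sum of the
    [g j] with [j > 0] is [c] times [g 0], whereas [pix g] becomes ['X] times the sum of all the
    [g j]. *)
Lemma psX_pix c (g : V) : g ord_max = 0 -> L g = c *: g ->
  psX (pix g) = ('X + c%:P) * psX (g ord0).
Proof.
move=> gn Lg.
have E : 'X * \sum_(j < n) psX (g (lift ord0 j)) = c *: psX (g ord0).
  rewrite -psXZ -VZ -Lg ffunE big_ord_recl Lop_d mulr0 scale0r add0r psX_sum mulr_sumr.
  by apply: eq_bigr => j _; rewrite Lop_P // subn0 psX_Pm // lift0 /=.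
rewrite /pix psX_sum mulrDl mul_polyC -E -mulrDr.
have -> : psX (g ord0) + \sum_(j < n) psX (g (lift ord0 j)) = \sum_(j < n) psX (g (wid j)).
  rewrite -(big_ord_recl _ (fun j => psX (g j))) big_ord_recr /= gn.
  by rewrite /psX raddf0 addr0.
by rewrite mulr_sumr; apply: eq_bigr => j _; rewrite psX_Pm /=.
Qed.

Section Step.
Variables (d : nat) (ga : nat -> nat) (f : A) (th : F) (k : nat -> F).
Hypotheses (hd : (d < n)%N) (hga : diagram n d ga) (hf : homo_at d 0 f).
Hypothesis lf : lapbel f = th *: f.
Hypothesis gk : gen (den F n.+1 ga) (num F n ga) k.
Hypothesis hk : forall a, (iter a L (vac f)) ord0 = k a *: f.

Let c (i : 'I_n.+1) : F := cont ga i.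
Let v : V := vac f.

Lemma c_inj : injective c.
Proof.
move=> i j e; apply: val_inj.
have [] := @jf_indep F (ga i) j (ga j) i => //.
apply: (addrI (- (i%:R + j%:R))); move: e; rewrite /c /cont => e.
have -> : - (i%:R + j%:R) + (alpha * (ga i)%:R + j%:R) = alpha * (ga i)%:R - i%:R by ring.
by rewrite e; ring.
Qed.

Let roots (P : pred 'I_n.+1) := [seq c j | j <- [seq j <- enum 'I_n.+1 | P j]].
Let lowroots := [seq cont ga j - 1 | j : 'I_n].

Lemma prod_roots (P : pred 'I_n.+1) (G : F -> {poly F}) :
  \prod_(b <- roots P) G b = \prod_(j | P j) G (c j).
Proof. by rewrite big_map big_filter big_enum_cond. Qed.

Lemma prod_lowroots (R : comPzRingType) (G : F -> R) :
  \prod_(b <- lowroots) G b = \prod_(j < n) G (cont ga j - 1).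
Proof. by rewrite big_map big_enum. Qed.

Lemma size_roots (P : pred 'I_n.+1) : size (roots P) = #|P|.
Proof. by rewrite size_map -sum1_size big_filter big_enum_cond /= sum1_card. Qed.

Lemma size_roots_neq i : size (roots (fun j => j != i)) = n.
Proof. by rewrite size_roots (eq_card (B := predC1 i)) // cardC1 card_ord. Qed.

Lemma pact0 q : (pact L q v) ord0 = mom k q *: f.
Proof. exact: (pact_mom (ev := vacp) hk). Qed.

Lemma mom_annih q : mom k ((\prod_j ('X - (c j)%:P)) * q) = 0.
Proof.
rewrite -(prod_roots xpredT (fun b => 'X - b%:P)) (mom_prod_eq0 (N := num F n ga)) //.
  by move=> m; rewrite prod_roots -gk.
rewrite /num -(prod_lowroots (fun b => lin b)) (leq_trans (size_prod_lin _)) //.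
by rewrite size_roots card_ord size_map size_enum_ord.
Qed.

(* The squared norm of the left-hand side is a moment of a multiple of [den], hence 0. *)
Lemma vac_annih : pact L (\prod_j ('X - (c j)%:P)) v = 0.
Proof.
apply: ipV_eq0; rewrite ipV_pact -pactM ipV_vac pact0 mom_annih scale0r.
exact: ip0r.
Qed.

(** [h i] is the component of the vacuum vector in the eigenspace of [L] for [c i], [w i] is its
    weight in the transition measure of the diagram, and [g i] is the summand of [p_1 f] in which
    row [i] gains a box. *)
Let h i := pact L (lagr c i) v.
Let w i := mom k (lagr c i).
Let g i := pix (h i).

Lemma Lh i : L (h i) = c i *: h i.
Proof. exact: (lagr_eigen _ vac_annih). Qed.

Lemma h_ord0 i : h i ord0 = w i *: f.
Proof. exact: pact0. Qed.

Lemma sum_h : \sum_i h i = v.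
Proof. by rewrite /h -pact_suml (sum_lagr c_inj) // pact1. Qed.

(** The squared norm of [h i] is [w i] times that of [f], and the scalar product is anisotropic. *)
Lemma h_eq0 i : w i = 0 -> h i = 0.
Proof.
move=> w0; apply: ipV_eq0; rewrite {1}/h ipV_pact ipV_vac (pact_eigen _ (Lh i)).
by rewrite VZ h_ord0 w0 scale0r scaler0 ip0r.
Qed.

Lemma wE i : w i = (lagr_num c i).[c i]^-1 * \prod_(j < n) (c i - (cont ga j - 1)).
Proof.
rewrite /w /lagr linearZ /=; congr (_ * _).
rewrite /lagr_num -(prod_roots _ (fun b => 'X - b%:P)).
rewrite (mom_residue (c := c i) (t := lowroots)); first by rewrite prod_lowroots.
  move=> m; rewrite prod_lowroots prod_roots -gk /den.
  by rewrite [in RHS](bigD1 i).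
by rewrite size_roots_neq size_map size_enum_ord.
Qed.

(** A row as long as the one above it makes a factor in the numerator of [wE] vanish. *)
Lemma w_eq0 (i : 'I_n.+1) : ~~ addable ga i -> w i = 0.
Proof.
rewrite /addable negb_or -leqNgt => /andP [i0 le].
have lt : (i.-1 < n)%N by rewrite -ltnS prednK ?lt0n // ltn_ord.
have e : ga i = ga i.-1.
  by apply/eqP; rewrite eqn_leq le (diagram_le hga) // leq_pred.
have ei : i%:R = i.-1%:R + 1 :> F by rewrite natr1 prednK // lt0n.
rewrite wE (bigD1 (Ordinal lt)) //= (_ : c i - (cont ga i.-1 - 1) = 0) ?mul0r ?mulr0 //.
by rewrite /c /cont -e ei; ring.
Qed.

Lemma w_neq0 (i : 'I_n.+1) : addable ga i -> w i != 0.
Proof.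
move=> ad; rewrite wE mulf_neq0 ?invr_eq0 ?(lagr_num_neq0 c_inj) //.
apply/prodf_neq0 => j _; apply/eqP; rewrite /c /cont => e.
have [] := @jf_indep F (ga i) j.+1 (ga j) i.
  apply/eqP; rewrite -subr_eq0 -natr1; apply/eqP; rewrite -[RHS]e; ring.
by move=> e1 e2; move: ad; rewrite /addable -e2 /= e2 e1 ltnn.
Qed.

Lemma homo_h i : homoV d (h i).
Proof. by apply: homoV_pact; apply: homoV_vac. Qed.

Lemma h_top i : h i ord_max = 0.
Proof. exact: (homoV_top (@homo_h i) hd). Qed.

Lemma homo_g i : homo_at d.+1 0 (g i).
Proof. by apply: homo_pix; apply: homo_h. Qed.

Lemma Dx_h i : Dx (h i) = th *: h i.
Proof.
rewrite /h (Dx_pact _ (d := d)) ?(ltnW hd) //; last exact: homoV_vac.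
by rewrite Dx_vac lf !linearZ.
Qed.

Lemma lapbel_g i : lapbel (g i) = (th + c i) *: g i.
Proof. by rewrite /g lapbel_pix ?h_top // Dx_h Lh -scalerDl linearZ. Qed.

Lemma sum_g : \sum_i g i = Pm 1 f.
Proof.
rewrite /g -linear_sum /= sum_h /pix.
have n0 : (0 < n)%N by apply: leq_ltn_trans hd.
rewrite (bigD1 (Ordinal n0)) //= big1 ?addr0; first by rewrite ffunE.
move=> j; rewrite -val_eqE /= => j0; rewrite ffunE -val_eqE /= (negbTE j0).
exact: linear0.
Qed.

(** Vacuum moments of [w h_i], and vacuum moments of the commutator of [L ^ a] with [p_1] on [h_i].
    The commutation relations [Lx_wx] and [Lx_P1x] turn into recursions for them, which are those of
    [addbox_xi] and [alpha * addbox_eta]. *)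
Let x i a : A := vacp (iter a L (wx (h i))).
Let y i a : A := vacp (iter a L (P1x (h i))) - c i ^+ a *: vacp (P1x (h i)).

Lemma x0 i : x i 0 = 0. Proof. exact: wx0. Qed.

Lemma xS i a : x i a.+1 = (c i + alpha - 1) *: x i a + vacp (iter a L (vac (g i))).
Proof.
rewrite /x iterSr Lx_wx ?h_top // Lh linearZ -scalerDl.
by rewrite iterLD iterLZ vacpD vacpZ addrA.
Qed.

Lemma y0 i : y i 0 = 0. Proof. by rewrite /y expr0 scale1r subrr. Qed.

Lemma yS i a : y i a.+1 = c i *: y i a + alpha *: x i a.
Proof.
have n0 : (0 < n)%N by apply: leq_ltn_trans hd.
have PZ : P1x (c i *: h i) = c i *: P1x (h i) by apply: linearZ.
rewrite /y /x iterSr (Lx_P1x _ n0) Lh PZ iterLD !iterLZ vacpD !vacpZ.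
by rewrite scalerBr scalerA -exprS addrAC.
Qed.

Lemma lapbel_vacp (u : V) : lapbel (vacp u) = vacp (Dx u).
Proof. by rewrite /vacp Dx_ord0. Qed.

Lemma lapbel_x i a : lapbel (x i a) = (th + c i) *: x i a.
Proof.
rewrite /x lapbel_vacp (Dx_iter_Lx _ (d := d.+1) hd); last exact: homoV_wx (@homo_h i).
by rewrite Dx_wx ?h_top // Dx_h Lh -scalerDl linearZ /= iterLZ vacpZ.
Qed.

Lemma lapbel_y i a : lapbel (y i a) = (th + c i) *: y i a.
Proof.
elim: a => [|a IH]; first by rewrite y0 linear0 scaler0.
rewrite yS [lapbel _]linearD /= !lapbelZ IH lapbel_x [RHS]scalerDr !scalerA.
by congr (_ *: _ + _ *: _); rewrite mulrC.
Qed.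

Let z i a : A := vacp (iter a L (vac (g i))).

Lemma lapbel_z i a : lapbel (z i a) = (th + c i) *: z i a.
Proof.
rewrite /z lapbel_vacp (Dx_iter_Lx _ (d := d.+1) hd); last exact: homoV_vac (@homo_g i).
by rewrite Dx_vac lapbel_g linearZ /= iterLZ vacpZ.
Qed.

(** Both sides are the vacuum component of the commutator of [L ^ a] with multiplication by [p_1],
    applied to the vacuum vector; it is split along the [h i] on the left and along the [g i] on the
    right. *)
Lemma sum_y a : \sum_i y i a = \sum_i (z i a - k a *: g i).
Proof.
have vs (G : 'I_n.+1 -> V) : \sum_i vacp (G i) = vacp (\sum_i G i).
  by rewrite [RHS]linear_sum.
have Ps : \sum_i P1x (h i) = P1x v by rewrite -sum_h [RHS]linear_sum.
have gs : \sum_i vac (g i) = P1x v.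
  rewrite -[LHS]linear_sum /= sum_g; apply/ffunP => j; rewrite !ffunE.
  by case: eqP => // _; rewrite linear0.
rewrite /y /z !sumrB -scaler_sumr sum_g !vs -!iterL_sum Ps gs; congr (_ - _).
have E i : c i ^+ a *: vacp (P1x (h i)) = Pm 1 (vacp (iter a L (h i))).
  have -> : iter a L (h i) = c i ^+ a *: h i.
    elim: (a) => [|b IH]; first by rewrite scale1r.
    by rewrite iterSr Lh iterLZ IH scalerA -exprS.
  by rewrite vacpZ PmZ /vacp ffunE.
rewrite (eq_bigr _ (fun i _ => E i)) -[LHS]linear_sum vs -iterL_sum sum_h /=.
by rewrite -PmZ; congr (Pm 1 _); apply: hk.
Qed.

(** All terms of [sum_y] with index [i] are eigenvectors of [lapbel] for [th + c i]. These
    eigenvalues are distinct, so the identity holds for each [i] separately. It closes the recursion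
    for [x] and [y], and every term becomes a multiple of [g i]. *)
Lemma z_eq i a : z i a = y i a + k a *: g i.
Proof.
pose u j := (z j a - k a *: g j) - y j a.
have thc_inj : injective (fun j => th + c j) by move=> j j' /addrI /c_inj.
suff /eqP : u i = 0 by rewrite subr_eq0 subr_eq => /eqP.
apply: (eigen_sep thc_inj (L := @lapbel F n) (z := u)).
  by rewrite /u sumrB -sum_y subrr.
have lB (a1 a2 : A) : lapbel (a1 - a2) = lapbel a1 - lapbel a2 by exact: linearB.
move=> j /=; rewrite /u lB lB lapbelZ.
by rewrite lapbel_z lapbel_y lapbel_g !scalerBr !scalerA [k a * _]mulrC.
Qed.

Lemma xy_addbox i a : x i a = addbox_xi alpha (c i) k a *: g i
  /\ y i a = (alpha * addbox_eta alpha (c i) k a) *: g i.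
Proof.
elim: a => [|a [IHx IHy]]; first by rewrite x0 y0 mulr0 !scale0r.
rewrite xS yS -/(z i a) z_eq IHx IHy addbox_xiS addbox_etaS /addbox_mom.
by split; rewrite !scalerA -!scalerDl; congr (_ *: _); ring.
Qed.

Lemma z_addbox i a : z i a = addbox_mom alpha (c i) k a *: g i.
Proof. by rewrite z_eq; have [_ ->] := xy_addbox i a; rewrite -scalerDl addrC. Qed.

Lemma jackspace_g (i : 'I_n.+1) : addable ga i -> jackspace (addbox ga i) (g i).
Proof.
move=> ad; exists (addbox_mom alpha (c i) k); last exact: z_addbox.
have hi : (i < n)%N by apply: (addable_lt hga hd) => //; rewrite -ltnS.
have cD : cont (addbox ga i) i = c i + alpha.
  by rewrite /c /cont /addbox eqxx natrD mulrDr mulr1; ring.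
have cN j : j != i :> nat -> cont (addbox ga i) j = cont ga j.
  by rewrite /cont /addbox => /negbTE ->; rewrite addn0.
have -> : den F n.+1 (addbox ga i) =
    lin (c i + alpha) * \prod_(j < n.+1 | j != i) lin (c j).
  rewrite /den (bigD1 i) //= cD; congr (_ * _); apply: eq_bigr => j ji.
  by rewrite cN.
have -> : num F n (addbox ga i) =
    lin (c i + alpha - 1) * \prod_(j < n | j != Ordinal hi) lin (cont ga j - 1).
  rewrite /num (bigD1 (Ordinal hi)) //= cD; congr (_ * _); apply: eq_bigr => j ji.
  by rewrite cN.
apply: addbox_gen; move: gk; rewrite /den (bigD1 i) //= /num (bigD1 (Ordinal hi)) //=.
Qed.

End Step.

Lemma pieri d ga f th : (d < n)%N -> diagram n d ga -> homo_at d 0 f ->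
  lapbel f = th *: f -> jackspace ga f ->
  exists (g : 'I_n.+1 -> A) (w : 'I_n.+1 -> F), Pm 1 f = \sum_i g i /\
    forall i : 'I_n.+1,
    [/\ homo_at d.+1 0 (g i), lapbel (g i) = (th + cont ga i) *: g i,
        psX (g i) = w i *: (('X + (cont ga i)%:P) * psX f),
        ~~ addable ga i -> g i = 0
      & addable ga i -> w i != 0 /\ jackspace (addbox ga i) (g i)].
Proof.
move=> hd hga hf lf [k gk hk].
pose c (i : 'I_n.+1) := cont ga i.
exists (fun i => pix (pact L (lagr c i) (vac f))), (fun i => mom k (lagr c i)).
split; first by rewrite (sum_g ga f hd).
move=> i; split.
- exact: homo_g.
- exact: (lapbel_g hd hf lf gk hk).
- rewrite (psX_pix (c := c i)) ?(h_top ga hd hf) ?(Lh gk hk) //.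
  by rewrite -/(vacp _) /vacp (h_ord0 ga hk) psXZ scalerAr.
- move=> ad; rewrite (_ : pact L _ _ = 0) ?linear0 //.
  by apply: (h_eq0 gk hk); apply: (w_eq0 hga gk).
- move=> ad; split; first exact: (w_neq0 gk).
  exact: (jackspace_g hd hga hf lf gk hk).
Qed.

End Pieri.

(** * A diagram is determined by the generating function of its moments *)

Section RowsUnique.
Variable F : jackField.
Local Notation alpha := (jf_alpha F).
Implicit Types (ga mu : nat -> nat).

Lemma eq_cont ga mu i : ga i = mu i -> cont F ga i = cont F mu i.
Proof. by rewrite /cont => ->. Qed.

Lemma eq_den N ga mu : (forall i, (i < N)%N -> ga i = mu i) -> den F N ga = den F N mu.
Proof. by move=> e; apply: eq_bigr => i _; rewrite (eq_cont (e i (ltn_ord i))). Qed.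

Lemma eq_num N ga mu : (forall i, (i < N)%N -> ga i = mu i) -> num F N ga = num F N mu.
Proof. by move=> e; apply: eq_bigr => i _; rewrite (eq_cont (e i (ltn_ord i))). Qed.

Lemma cont_eq ga mu i j (e : nat) : cont F ga i = cont F mu j - e%:R ->
  ga i = mu j /\ (j + e)%N = i.
Proof.
rewrite /cont => h; apply: (@jf_indep F); apply: (addIr (- (i%:R + (j + e)%N%:R))).
have -> : alpha * (ga i)%:R + (j + e)%N%:R - (i%:R + (j + e)%N%:R) = alpha * (ga i)%:R - i%:R by ring.
by rewrite h natrD; ring.
Qed.

Lemma lin_neq0 (c : F) : lin c != 0.
Proof. by apply: contra_neq (oner_neq0 F) => e; rewrite -(lin_coef0 c) e coef0. Qed.

Lemma horner_lin (c x : F) : x != 0 -> (lin c).[x^-1] = (x - c) / x.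
Proof.
by move=> x0; rewrite /lin hornerD hornerN hornerZ hornerX hornerC mulrBl divff.
Qed.

(** At the first row [i0] where the diagrams differ, cancel the earlier factors of [num] and
    evaluate at the inverse of the content that ends the longer row. One side vanishes. A vanishing
    factor on the other side would give a row of [mu] with the index and length of row [i0] of [ga],
    or a row of [ga] just above [i0], whose factor has been cancelled. *)
Lemma rows_unique N ga mu :
  (forall i, (ga i.+1 <= ga i)%N) -> (forall i, (mu i.+1 <= mu i)%N) ->
  den F N ga * num F N mu = den F N mu * num F N ga ->
  forall i, (i < N)%N -> ga i = mu i.
Proof.
move=> mga mmu e.
have [//|[i0 [hi0 ne min]]] : (forall i, (i < N)%N -> ga i = mu i) \/
    exists i0, [/\ (i0 < N)%N, ga i0 != mu i0 & forall i, (i < i0)%N -> ga i = mu i].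
  case: (boolP [forall i : 'I_N, ga i == mu i]) => [/forallP h|].
    by left=> i hi; apply/eqP; apply: (h (Ordinal hi)).
  rewrite negb_forall => /existsP [i hi]; right.
  have ex : exists i, (i < N)%N && (ga i != mu i) by exists i; rewrite ltn_ord.
  case: (ex_minnP ex) => i0 /andP [h1 h2] h3; exists i0; split => // j hj.
  apply/eqP; apply: contraT => nej; have := h3 j.
  by rewrite nej (ltn_trans hj h1) leqNgt hj => /(_ isT).
exfalso.
(* This makes row [i0] of [ga] nonempty, so that its content [c] is nonzero and can be inverted. *)
wlog lt : ga mu mga mmu e ne min / (mu i0 < ga i0)%N.
  move=> W; case: (ltngtP (mu i0) (ga i0)) => h; first exact: (W ga mu).
    by apply: (W mu ga) => //; rewrite 1?eq_sym // => i /min.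
  by rewrite h eqxx in ne.
pose pre : {poly F} := \prod_(i < N | (i < i0)%N) lin (cont F mu i - 1).
pose rest ga : {poly F} := \prod_(i < N | ~~ (i < i0)%N) lin (cont F ga i - 1).
have nE ga' : (forall i, (i < i0)%N -> ga' i = mu i) -> num F N ga' = pre * rest ga'.
  move=> h; rewrite /num (bigID (fun i : 'I_N => (i < i0)%N)) /=; congr (_ * _).
  by apply: eq_bigr => i /h /eq_cont ->.
have pre0 : pre != 0 by apply/prodf_neq0 => i _; apply: lin_neq0.
have {}e : den F N ga * rest mu = den F N mu * rest ga.
  apply: (mulfI pre0); move: e; rewrite (nE ga) // (nE mu) // => e.
  by rewrite mulrCA e mulrCA.
pose c := cont F ga i0.
have c0 : c != 0.
  apply/eqP; rewrite /c /cont => h.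
  have [] := @jf_indep F (ga i0) 0 0 i0; last by move=> h0; rewrite h0 in lt.
  by apply/eqP; rewrite mulr0 addr0 add0r -subr_eq0; apply/eqP.
have /eqP := congr1 (fun p : {poly F} => p.[c^-1]) e.
rewrite !hornerM !horner_prod (bigD1 (Ordinal hi0)) //= horner_lin // subrr !mul0r eq_sym.
rewrite mulf_eq0 => /orP [] /eqP /eqP.
  move/prodf_eq0 => [j _]; rewrite horner_lin // mulf_eq0 invr_eq0 (negbTE c0) orbF subr_eq0.
  move=> /eqP h; have [] := @cont_eq ga mu i0 j 0; first by rewrite -/c h subr0.
  by rewrite addn0 => h1 h2; rewrite h1 h2 ltnn in lt.
move/prodf_eq0 => [j jge]; rewrite horner_lin // mulf_eq0 invr_eq0 (negbTE c0) orbF subr_eq0.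
move=> /eqP h; have [] := @cont_eq ga ga i0 j 1; first by rewrite -/c h.
by move=> _ h2; move: jge; rewrite -h2 addn1 ltnSn.
Qed.

End RowsUnique.

(* Boxes are indexed from (0, 0); the content of the box (i, j) is alpha * j - i. *)
Section Boxes.
Variables (R : Type) (idx : R) (op : Monoid.com_law idx).
Implicit Types (ga : nat -> nat) (G : nat -> nat -> R).

Definition boxes n ga G : R := \big[op/idx]_(i < n) \big[op/idx]_(j < ga i) G i j.

Lemma eq_boxes n ga mu G : (forall i, (i < n)%N -> ga i = mu i) -> boxes n ga G = boxes n mu G.
Proof. by move=> e; apply: eq_bigr => i _; rewrite e. Qed.

Lemma boxes_addbox n ga i G : (i < n)%N ->
  boxes n (addbox ga i) G = op (boxes n ga G) (G i (ga i)).
Proof.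
move=> hi; rewrite /boxes (bigD1 (Ordinal hi)) // [in RHS](bigD1 (Ordinal hi)) //=.
have -> : addbox ga i i = (ga i).+1 by rewrite /addbox eqxx addn1.
rewrite big_ord_recr /= Monoid.mulmAC; congr (op (op _ _) _).
apply: eq_bigr => j; rewrite -val_eqE /= => ji.
by have -> : addbox ga i j = ga j by rewrite /addbox (negbTE ji) addn0.
Qed.

Lemma boxes0 n ga G : (forall i, (i < n)%N -> ga i = 0%N) -> boxes n ga G = idx.
Proof. by move=> e; apply: big1 => i _; rewrite e // big_ord0. Qed.

End Boxes.

(** * Jack functions attached to diagrams *)

Section JackSpaces.
Variables (F : jackField) (n : nat).
Local Notation alpha := (jf_alpha F).
Local Notation A := {mpoly F[n]}.
Local Notation L := (@Lx F n).
Implicit Types (ga mu : nat -> nat) (f : A).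

Definition content (i j : nat) : F := alpha * j%:R - i%:R.
Definition contsum ga : F := boxes +%R n ga content.
Definition contprod ga : F :=
  boxes *%R n ga (fun i j => if (i == 0%N) && (j == 0%N) then 1 else content i j).
Definition contpoly ga : {poly F} := boxes *%R n ga (fun i j => 'X + (content i j)%:P).

Lemma jackspace_ext ga mu f : (forall i, (i <= n)%N -> ga i = mu i) ->
  jackspace ga f -> jackspace mu f.
Proof.
move=> e [k gk hk]; exists k => //.
rewrite -(eq_den F (N := n.+1) (ga := ga)) => [|i hi]; last exact: e.
by rewrite -(eq_num F (N := n) (ga := ga)) // => i hi; apply/e/ltnW.
Qed.

Lemma jackspaceZ ga c f : jackspace ga f -> jackspace ga (c *: f).
Proof.
case=> k gk hk; exists k => // a.
by rewrite linearZ /= iterLZ VZ hk !scalerA mulrC.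
Qed.

Lemma jackspace_unique ga mu k :
  (forall i, (ga i.+1 <= ga i)%N) -> (forall i, (mu i.+1 <= mu i)%N) -> ga n = mu n ->
  gen (den F n.+1 ga) (num F n ga) k -> gen (den F n.+1 mu) (num F n mu) k ->
  forall i, (i <= n)%N -> ga i = mu i.
Proof.
move=> mga mmu e gk gk' i hi; apply: (@rows_unique F n.+1 ga mu) => //.
have numS nu : num F n.+1 nu = num F n nu * lin (cont F nu n - 1) by rewrite /num big_ord_recr.
by rewrite !numS !mulrA (gen_unique gk gk') (eq_cont F e).
Qed.

(** As [L] is self-adjoint, [k a * ip f h = k' a * ip f h] for all [a]. If the product is nonzero,
    the moments agree, hence so do the diagrams. *)
Lemma jackspace_orth d d' ga mu f h : diagram n d ga -> diagram n d' mu ->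
  jackspace ga f -> jackspace mu h -> ip f h != 0 -> forall i, ga i = mu i.
Proof.
move=> [mga oga _] [mmu omu _] [k gk hk] [k' gk' hk'] ne i.
have [hi|hi] := leqP n i; first by rewrite oga ?omu.
apply: (jackspace_unique mga mmu _ gk _ (ltnW hi)); first by rewrite oga ?omu.
suff e : k =1 k' by move=> m; rewrite (eq_conv _ e).
move=> a; apply: (mulIf ne); rewrite -ipZl -ipZr -hk -hk'.
have It (g g' : {ffun 'I_n.+1 -> A}) : ipV (iter a L g) g' = ipV g (iter a L g').
  by rewrite -!pactXn ipV_pact.
by rewrite ipC -ipV_vac -It ipVC ipV_vac.
Qed.

Lemma vac1_L : L (vac (1 : A)) = 0.
Proof.
apply/ffunP => k; rewrite !ffunE big_ord_recl vac0 big1 ?addr0 => [|j _]; last first.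
  by rewrite vacS linear0.
case: (nat_of_ord k) => [|k']; first by rewrite Lop_d mulr0 scale0r.
rewrite Lop_Q // subn0 Qm.unlock; case: (ltnP k' n) => h; last by rewrite dv_out // scaler0.
by rewrite (dvE (Ordinal h)) -mpolyC1 mderivC scaler0.
Qed.

(** [L] kills the vacuum vector of 1, so the moments are 1, 0, 0, and so on; for empty rows [den]
    and [num] coincide factor by factor after a shift, the factor of row 0 being 1. *)
Lemma jackspace1 ga : (forall i, (i <= n)%N -> ga i = 0%N) -> jackspace ga (1 : A).
Proof.
move=> e; exists (fun a => (1 : {poly F})`_a).
  move=> m; rewrite conv_poly mulr1; congr (nth 0 (polyseq _) m).
  rewrite /den big_ord_recl /= [cont F ga 0]/cont e // mulr0 subrr.
  rewrite /lin scale0r subr0 mul1r; apply: eq_bigr => i _.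
  rewrite /cont !e ?mulr0 ?sub0r ?ltn_ord //; last exact/ltnW/ltn_ord.
  by rewrite /bump add1n -natr1 opprD.
case=> [|a]; first by rewrite /= vac0 coef1 scale1r.
by rewrite iterSr vac1_L iterL0 ffunE coef1 scale0r.
Qed.

Lemma lapbel1 : lapbel (1 : A) = 0.
Proof.
apply: (scalerI (two_alpha_neq0 F)); rewrite scaler0 lapbel_Lop big1 // => j _.
rewrite big1 // => k _; rewrite Qm.unlock (dvE k) -mpolyC1 mderivC scaler0 !linear0 //.
Qed.

Lemma diagram_removable d ga : diagram n d.+1 ga ->
  exists mu i, [/\ (i < n)%N, diagram n d mu, addable mu i & forall j, ga j = addbox mu i j].
Proof.
move=> [mono out sum].
have ex : exists i, ga i == 0%N by exists n; rewrite out.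
case: (ex_minnP ex) => i /eqP gi min.
case: i gi min => [|i] gi min.
  exfalso; have z j : ga j = 0%N.
    by elim: j => // j IH; apply/eqP; rewrite -leqn0 -IH.
  by move: sum; rewrite big1.
have pos : (0 < ga i)%N.
  by rewrite lt0n; apply/negP => /min; rewrite ltnn.
have hi : (i < n)%N by rewrite ltnNge; apply/negP => /out e; rewrite e in pos.
exists (fun j => (ga j - (j == i))%N), i.
have E j : ga j = addbox (fun j => (ga j - (j == i))%N) i j.
  by rewrite /addbox; case: eqP => [->|_]; rewrite ?subn0 ?addn0 // subnK.
split => //.
  split.
  - move=> j; case: (eqVneq j i) => [->|ne].
      by rewrite gi.
    by rewrite subn0 (leq_trans (leq_subr _ _)).
  - by move=> j hj; rewrite out.
  apply: succn_inj; rewrite -sum.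
  transitivity (\sum_(j < n) addbox (fun j => (ga j - (j == i))%N) i j)%N; last first.
    by apply: eq_bigr => j _; rewrite -E.
  rewrite /addbox big_split /= -addn1; congr (_ + _)%N; rewrite (bigD1 (Ordinal hi)) //= eqxx big1 // => j.
  by rewrite -val_eqE /= => /negbTE ->.
rewrite /addable eqxx; case: (posnP i) => //= i0.
have ne : (i.-1 == i) = false by rewrite ltn_eqF // prednK.
by rewrite ne subn0 subn1 prednK //; have := mono i.-1; rewrite prednK.
Qed.

Lemma jack_exists d ga : (d <= n)%N -> diagram n d ga ->
  exists E : A, [/\ homo_at d 0 E, jackspace ga E, lapbel E = contsum ga *: E
                   & psX E = contpoly ga].
Proof.
elim: d ga => [|d IH] ga hd hga.
  have z i : (i <= n)%N -> ga i = 0%N.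
    rewrite leq_eqVlt => /orP [/eqP ->|hi]; first by case: hga => _ out _; apply: out.
    case: hga => _ _ /eqP; rewrite sum_nat_eq0 => /forallP /(_ (Ordinal hi)) /=.
    by move/eqP.
  have z' i : (i < n)%N -> ga i = 0%N by move/ltnW/z.
  exists 1; split.
  - move=> m; rewrite mcoeff1 addn0; case: (m =P 0%MM) => [->|_]; last by rewrite eqxx.
    by rewrite wt0.
  - exact: jackspace1.
  - by rewrite lapbel1 /contsum boxes0 // scale0r.
  - by rewrite /contpoly boxes0 // /psX rmorph1.
have [mu [i [hi hmu ad E]]] := diagram_removable hga.
have [f [hf jf lf pf]] := IH mu (ltnW hd) hmu.
have [g [w [_ H]]] := pieri hd hmu hf lf jf.
have [hg lg pg _ /(_ ad) [w0 jg]] := H (widen_ord (leqnSn n) (Ordinal hi)).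
set g' := g _ in hg lg pg jg; set w' := w _ in pg w0.
(* Dividing by the transition weight turns [psX] into the product over the boxes without any
   scalar. *)
exists (w'^-1 *: g'); split.
- exact: homoZ.
- have /(jackspace_ext (mu := ga)) : jackspace (addbox mu i) g' := jg.
  case=> [j _|k gk hk]; first by rewrite E.
  by apply: jackspaceZ; exists k.
- rewrite lapbelZ lg scalerA mulrC -scalerA; congr (_ *: _).
  by rewrite /contsum (eq_boxes _ _ (ga := ga) (mu := addbox mu i)) // boxes_addbox.
- rewrite psXZ pg scalerA mulVf // scale1r pf mulrC.
  by rewrite /contpoly (eq_boxes _ _ (ga := ga) (mu := addbox mu i)) // boxes_addbox.
Qed.

End JackSpaces.

(** * Expansion over growing diagrams *)

Section Paths.
Variables (F : jackField) (n : nat).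
Local Notation alpha := (jf_alpha F).
Local Notation A := {mpoly F[n]}.
Implicit Types (ga mu : nat -> nat) (f : A).

Fixpoint del (l : nat) (f : A) : A :=
  if l is l'.+1 then lapbel (del l' f) - del l' (lapbel f) else alpha^-1 *: Pm 1 f.

Lemma del_linear l : linear (del l).
Proof.
elim: l => [|l IH] c f h /=; first by rewrite linearP scalerDr !scalerA mulrC.
have lP (u v : A) : lapbel (c *: u + v) = c *: lapbel u + lapbel v by apply: linearP.
rewrite lP !IH lP scalerBr; set a := c *: _; set b := c *: _.
by rewrite opprD addrACA.
Qed.
HB.instance Definition _ l := GRing.isLinear.Build F A A _ (del l) (del_linear l).

Lemma del_eigen (I : finType) (g : I -> A) (c : I -> F) (th : F) f l :
  Pm 1 f = \sum_i g i -> lapbel f = th *: f -> (forall i, lapbel (g i) = (th + c i) *: g i) ->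
  del l f = alpha^-1 *: \sum_i c i ^+ l *: g i.
Proof.
move=> Pf lf lg; elim: l => [|l IH] /=.
  by rewrite Pf; congr (_ *: _); apply: eq_bigr => i _; rewrite scale1r.
rewrite lf linearZ /= IH lapbelZ.
have -> : lapbel (\sum_i c i ^+ l *: g i) = \sum_i (th + c i) *: (c i ^+ l *: g i).
  by rewrite linear_sum; apply: eq_bigr => i _ /=; rewrite lapbelZ lg !scalerA mulrC.
rewrite scalerA [th * _]mulrC -scalerA -scalerBr; congr (_ *: _).
rewrite scaler_sumr -sumrB; apply: eq_bigr => i _.
by rewrite -scalerBl addrAC subrr add0r scalerA exprS.
Qed.

Lemma contprod_ext ga mu : (forall i, (i < n)%N -> ga i = mu i) ->
  contprod F n ga = contprod F n mu.
Proof. exact: eq_boxes. Qed.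

(** The indices are sequences of rows that receive the successive boxes. Each added box contributes
    the [l]-th power of its content, so the factor of a path depends only on its last diagram. The
    vectors [f t] are chosen before [l]: the case [l = 0] later identifies their sum. *)
Lemma del_paths k : (k < n)%N ->
  exists (I : finType) (ga : I -> nat -> nat) (f : I -> A),
  (forall t, f t != 0 -> [/\ diagram n k.+1 (ga t), homo_at k.+1 0 (f t), jackspace (ga t) (f t)
     & lapbel (f t) = contsum F n (ga t) *: f t]) /\
  forall l, iter k (del l) (alpha^-1 *: Pm 1 1) = \sum_t contprod F n (ga t) ^+ l *: f t.
Proof.
elim: k => [|k IH] hk.
  pose ga0 (_ : nat) := 0%N.
  have d0 : diagram n 0 ga0 by split => //; rewrite big1.
  have h1 : homo_at 0 0 (1 : A).
    by move=> m; rewrite mcoeff1; case: (m =P 0%MM) => [->|_]; rewrite ?wt0 ?eqxx.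
  have l1 : lapbel (1 : A) = 0 *: 1 by rewrite lapbel1 scale0r.
  have [g [w [sg H]]] := pieri hk d0 h1 l1 (jackspace1 F (fun i _ => erefl _)).
  have [hg lg _ _ /(_ isT) [_ jg]] := H ord0.
  have sg0 : Pm 1 1 = g ord0.
    rewrite sg (bigD1 ord0) //= big1 ?addr0 // => i i0; have [_ _ _ z _] := H i.
    by apply: z; rewrite /addable /ga0 ltnn orbF.
  exists unit, (fun=> addbox ga0 0), (fun=> alpha^-1 *: g ord0); split => [_ _|l].
    split.
    - exact: diagram_addbox.
    - exact: homoZ.
    - exact: jackspaceZ.
    - rewrite lapbelZ lg scalerA mulrC -scalerA; congr (_ *: (_ *: _)).
      by rewrite /contsum boxes_addbox // boxes0 // /= /cont /content /ga0.
  rewrite /= (big_pred1 tt) => [|[] //].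
  rewrite /contprod boxes_addbox // boxes0 // /ga0 /= mulr1 expr1n scale1r.
  by rewrite sg0.
have [I [ga [f [H E]]]] := IH (ltnW hk).
have step t : exists G : 'I_n.+1 -> A,
    (forall l, del l (f t) = alpha^-1 *: \sum_(i < n.+1) cont F (ga t) i ^+ l *: G i) /\
    forall i : 'I_n.+1, G i != 0 -> [/\ homo_at k.+2 0 (G i),
       (* The conditions are asked only for nonzero vectors: a row that is not addable gives a zero
          summand, whose index need not describe a diagram. *)
       lapbel (G i) = (contsum F n (ga t) + cont F (ga t) i) *: G i,
       diagram n k.+1 (ga t), addable (ga t) i & jackspace (addbox (ga t) i) (G i)].
  case: (eqVneq (f t) 0) => [->|/H [dg hf jf lf]].
    exists (fun=> 0); split => [l|i]; last by rewrite eqxx.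
    by rewrite linear0 big1 ?scaler0 // => i _; rewrite scaler0.
  have [G [w [sG HG]]] := pieri hk dg hf lf jf.
  exists G; split => [l|i Gi].
    by apply: (del_eigen _ sG lf) => i; case: (HG i).
  have [hG lG _ z jG] := HG i.
  case: (boolP (addable (ga t) i)) => ad; last by rewrite z ?eqxx in Gi.
  by have [_ jG'] := jG ad; split.
have [G HG] := fin_all_exists step.
exists (I * 'I_n.+1)%type, (fun t : I * 'I_n.+1 => addbox (ga t.1) t.2), (fun t => alpha^-1 *: G t.1 t.2).
have cadd t (i : 'I_n.+1) : G t i != 0 ->
    [/\ (i < n)%N, contprod F n (addbox (ga t) i) = contprod F n (ga t) * cont F (ga t) i
      & contsum F n (addbox (ga t) i) = contsum F n (ga t) + cont F (ga t) i].
  move=> Gi; have [_ /(_ i Gi) [_ _ dg ad _]] := HG t.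
  have hi : (i < n)%N by apply: (addable_lt dg hk) => //; rewrite -ltnS.
  split; rewrite /contprod /contsum ?boxes_addbox //=.
  (* The new box is not the corner, which [contprod] omits: the diagram already has [k.+1] boxes, so
     its row 0 is nonempty. *)
  case: eqP => //= i0; case: eqP => // gi; exfalso.
  have [_ _ sum] := dg; move: sum; rewrite big1 // => j _.
  by apply/eqP; rewrite -leqn0 -gi i0; apply: (diagram_le dg).
split=> [[t i] /= nz|l].
  have Gi : G t i != 0 by apply: contraNneq nz => ->; rewrite scaler0.
  have [_ /(_ i Gi) [hG lG dg ad jG]] := HG t.
  have [hi _ cs] := cadd t i Gi; split.
  - exact: diagram_addbox.
  - exact: homoZ.
  - exact: jackspaceZ.
  - by rewrite lapbelZ lG cs !scalerA mulrC.
rewrite iterS E linear_sum /= -(pair_bigA _ (fun t (i : 'I_n.+1) =>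
  contprod F n (addbox (ga t) i) ^+ l *: (alpha^-1 *: G t i))) /=.
apply: eq_bigr => t _; rewrite linearZ /=; have [-> _] := HG t.
rewrite !scaler_sumr; apply: eq_bigr => i _.
case: (eqVneq (G t i) 0) => [->|Gi]; first by rewrite !scaler0.
by have [_ -> _] := cadd t i Gi; rewrite !scalerA exprMn; congr (_ *: _); ring.
Qed.

End Paths.

(** * Heckman operators in finitely many variables *)

Section DividedDifference.
Variables (F : fieldType) (N : nat).
Local Notation B := {mpoly F[N]}.
Implicit Types (m b : 'X_{1..N}) (f h : B) (i j l : 'I_N).

Definition mpermute (s : 'S_N) m : 'X_{1..N} := [multinom m (s i) | i < N].
Definition mswap j l := mpermute (tperm j l).

Lemma mswapK j l : involutive (mswap j l).
Proof. by move=> m; apply/mnmP => i; rewrite !mnmE tpermK. Qed.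

Definition mshift j l m r : 'X_{1..N} :=
  [multinom if i == j then m j - r else if i == l then m l + r else m i | i < N]%N.

(* On monomials, [tau j l] is [f |-> x_l (f - s_jl f) / (x_j - x_l)]. *)
Definition tauT j l m : B := \sum_(r < m j - m l) 'X_[mshift j l m r.+1].
Definition tauM j l m : B := if (m j < m l)%N then - tauT j l (mswap j l m) else tauT j l m.
Definition tau j l f : B := \sum_(m <- msupp f) f@_m *: tauM j l m.

Lemma mswap_j j l m : mswap j l m j = m l. Proof. by rewrite mnmE tpermL. Qed.
Lemma mswap_l j l m : mswap j l m l = m j. Proof. by rewrite mnmE tpermR. Qed.

Lemma mshift_step j l m r : j != l -> (r < m j)%N ->
  'X_j * 'X_[mshift j l m r.+1] = 'X_l * 'X_[mshift j l m r] :> B.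
Proof.
move=> jl hr; rewrite -!mpolyXD; congr 'X_[_]; apply/mnmP => i.
rewrite !mnmDE !mnm1E !mnmE (eq_sym j i) (eq_sym l i).
have lj : (j == l) = false by apply: negbTE.
case: (i =P j) => [->|_]; first by rewrite lj add1n subnSK.
by case: eqP => _; rewrite ?add0n ?addnS.
Qed.

Lemma mshift_swap j l m : (m l <= m j)%N -> mswap j l m = mshift j l m (m j - m l).
Proof.
move=> le; apply/mnmP => i; rewrite [RHS]mnmE; case: (eqVneq i j) => [->|ij].
  by rewrite mswap_j subKn.
case: (eqVneq i l) => [->|il]; first by rewrite mswap_l subnKC.
by rewrite mnmE tpermD // eq_sym.
Qed.

Lemma tauT_eq j l m : j != l -> (m l <= m j)%N ->
  ('X_j - 'X_l) * tauT j l m = 'X_l * ('X_[m] - 'X_[mswap j l m]).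
Proof.
move=> jl le; have e0 : m = mshift j l m 0.
  apply/mnmP => i; rewrite mnmE subn0 addn0.
  by case: eqP => [->//|_]; case: eqP => [->|].
have ed := mshift_swap le.
rewrite ed mulrBl /tauT !mulr_sumr -sumrB.
under eq_bigr => r _ do rewrite mshift_step ?(leq_trans (ltn_ord r)) ?leq_subr // -mulrBr.
rewrite -mulr_sumr; congr (_ * _).
pose X r : B := 'X_[mshift j l m r].
transitivity (\sum_(0 <= r < m j - m l) (- X r.+1 - - X r)).
  by rewrite big_mkord; apply: eq_bigr => r _; rewrite opprK addrC.
by rewrite telescope_sumr // opprK addrC /X -e0.
Qed.

Lemma tauM_eq j l m : j != l ->
  ('X_j - 'X_l) * tauM j l m = 'X_l * ('X_[m] - 'X_[mswap j l m]).
Proof.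
move=> jl; rewrite /tauM; case: ltnP => h; last exact: tauT_eq.
rewrite mulrN tauT_eq // ?mswapK; last by rewrite mswap_j mswap_l ltnW.
by rewrite -mulrN opprB.
Qed.

Lemma tauE (s : seq 'X_{1..N}) j l f : uniq s -> {subset msupp f <= s} ->
  tau j l f = \sum_(m <- s) f@_m *: tauM j l m.
Proof.
move=> us sub; rewrite /tau [RHS](bigID (mem (msupp f))) /= [X in _ + X]big1 ?addr0.
  rewrite -[RHS]big_filter; apply: perm_big; apply: uniq_perm; rewrite ?msupp_uniq ?filter_uniq //.
  by move=> m; rewrite mem_filter; case: (boolP (m \in msupp f)) => // /sub ->.
by move=> m /memN_msupp_eq0 ->; rewrite scale0r.
Qed.

Lemma tau_linear j l : linear (tau j l).
Proof.
move=> c f h; pose s := undup (msupp (c *: f + h) ++ msupp f ++ msupp h).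
have us : uniq s := undup_uniq _.
rewrite !(tauE (s := s)) // => [|m hm|m hm|m hm]; rewrite ?mem_undup ?mem_cat ?hm ?orbT //.
rewrite scaler_sumr -big_split; apply: eq_bigr => m _ /=.
by rewrite mcoeffD mcoeffZ scalerDl scalerA.
Qed.
HB.instance Definition _ j l := GRing.isLinear.Build F B B _ (tau j l) (tau_linear j l).

Lemma tau_eq j l f : j != l ->
  ('X_j - 'X_l) * tau j l f = 'X_l * (f - msym (tperm j l) f).
Proof.
move=> jl.
have -> : f - msym (tperm j l) f = \sum_(m <- msupp f) f@_m *: ('X_[m] - 'X_[mswap j l m]).
  have Es : msym (tperm j l) f = \sum_(m <- msupp f) f@_m *: 'X_[mswap j l m].
    rewrite {1}[f]mpolyE linear_sum /=; apply: eq_bigr => m _.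
    rewrite msymZ msymX; congr (_ *: 'X_[_]); apply/mnmP => i; by rewrite !mnmE tpermV.
  rewrite Es {1}[f]mpolyE -sumrB; apply: eq_bigr => m _; by rewrite scalerBr.
rewrite /tau !mulr_sumr; apply: eq_bigr => m _.
by rewrite -!scalerAr tauM_eq.
Qed.

Lemma subX_neq0 j l : j != l -> 'X_j - 'X_l != 0 :> B.
Proof.
move=> jl; apply/eqP => /(congr1 (mcoeff U_(j)%MM)).
rewrite mcoeff0 mcoeffB !mcoeffXU eqxx [l == j]eq_sym (negbTE jl) subr0 => /eqP.
by rewrite oner_eq0.
Qed.

Lemma tau_uniq j l f h : j != l ->
  ('X_j - 'X_l) * h = 'X_l * (f - msym (tperm j l) f) -> tau j l f = h.
Proof. by move=> jl e; apply: (mulfI (subX_neq0 jl)); rewrite tau_eq. Qed.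

Lemma tau_symM j l f h : j != l -> f \is symmetric -> tau j l (f * h) = f * tau j l h.
Proof.
move=> jl /issymP sf; apply: tau_uniq => //.
by rewrite mulrCA tau_eq // msymM sf -mulrBr mulrCA.
Qed.

Lemma tau_Xn j l (m : nat) f : j != l -> f \is symmetric ->
  tau j l ('X_j ^+ m * f) = \sum_(i < m) 'X_l ^+ i.+1 * 'X_j ^+ (m.-1 - i) * f.
Proof.
move=> jl sf; rewrite mulrC tau_symM // [RHS](eq_bigr (fun i : 'I_m =>
  f * ('X_l * ('X_j ^+ (m.-1 - i) * 'X_l ^+ i)))); last first.
  by move=> i _; rewrite exprS; ring.
rewrite -mulr_sumr; congr (_ * _); apply: tau_uniq => //.
rewrite -mulr_sumr mulrCA; congr (_ * _); rewrite rmorphXn /= msymX.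
have -> : [multinom U_(j)%MM ((tperm j l)^-1%g i) | i < N] = U_(l)%MM.
  by apply/mnmP => i; rewrite mnmE !mnm1E tpermV -{1}(tpermR j l) (inj_eq perm_inj).
rewrite subrXX; case: m => [|m]; first by rewrite !big_ord0 mulr0.
by congr (_ * _); apply: eq_bigr => i _; rewrite subSS.
Qed.

(** A numerical substitute for the dominance order on exponents: it is invariant under permutations,
    and it drops when two entries are moved strictly towards each other ([rho_mshift]). *)
Definition rho m : nat := (\sum_i m i * m i)%N.

Lemma rho_permute s m : rho (mpermute s m) = rho m.
Proof.
rewrite /rho [RHS](reindex_inj (@perm_inj _ s)) /=.
by apply: eq_bigr => i _; rewrite mnmE.
Qed.

Lemma rho_mshift j l m r : j != l -> (m l + r < m j)%N -> (0 < r)%N ->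
  (rho (mshift j l m r) < rho m)%N.
Proof.
move=> jl lt r0; rewrite /rho (bigD1 j) // [X in (_ < X)%N](bigD1 j) //=.
rewrite (bigD1 l) 1?eq_sym //= [X in (_ < _ + X)%N](bigD1 l) 1?eq_sym //=.
rewrite !addnA (eq_bigr (fun i => m i * m i)%N) => [|i /andP [ij il]]; last first.
  by rewrite mnmE (negbTE ij) (negbTE il).
rewrite ltn_add2r !mnmE eqxx eq_sym (negbTE jl) eqxx.
nia.
Qed.

Lemma tauT_coef j l m b : j != l -> (rho m <= rho b)%N -> (m l <= m j)%N ->
  (tauT j l m)@_b = ((m l < m j)%N && (b == mswap j l m))%:R.
Proof.
move=> jl le mjl; rewrite /tauT raddf_sum /=; under eq_bigr => r _ do rewrite mcoeffX.
have [lt|ge] := ltnP (m l) (m j); last first.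
  have -> : (m j - m l)%N = 0%N by apply/eqP.
  by rewrite big_ord0.
have E := mshift_swap mjl; have [d dE] : exists d, (m j - m l)%N = d.+1.
  by exists (m j - m l).-1; rewrite prednK // subn_gt0.
rewrite E dE big_ord_recr /= big1 ?add0r; first by rewrite eq_sym.
move=> r _; case: eqP => // e; move: le; rewrite -e leqNgt rho_mshift //.
have := ltn_ord r; lia.
Qed.

(** The divided difference of a monomial is a string of monomials whose inner members have smaller
    [rho]. At an exponent of maximal [rho] only the last member is seen, which comes from the
    swapped exponent or, with opposite sign, from [b] itself. *)
Lemma tau_coef j l f b : j != l -> (forall m, f@_m != 0 -> (rho m <= rho b)%N) ->
  (tau j l f)@_b = if (b j < b l)%N then f@_(mswap j l b) - f@_b else 0.
Proof.
move=> jl top.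
pose s := undup (mswap j l b :: b :: msupp f).
have us : uniq s := undup_uniq _.
rewrite (tauE (s := s)) //; last by move=> m hm; rewrite mem_undup !inE hm !orbT.
rewrite raddf_sum /=.
have E m : m \in s -> (f@_m *: tauM j l m)@_b =
    (if (b j < b l)%N then (m == mswap j l b)%:R * f@_m else 0)
    - (if (b j < b l)%N then (m == b)%:R * f@_m else 0).
  move=> _; rewrite mcoeffZ; case: (eqVneq f@_m 0) => [->|/top le].
    by rewrite mul0r !mulr0; case: ifP; rewrite subrr.
  rewrite /tauM; case: ltnP => h.
    rewrite mcoeffN tauT_coef ?mswap_j ?mswap_l ?mswapK // ?h /=; last 2 first.
    - by rewrite /mswap rho_permute.
    - exact: ltnW.
    case: (eqVneq b m) => [->|bm]; last first.
      rewrite oppr0 mulr0 !mul0r.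
      case: eqP => [e|_]; last by rewrite mul0r; case: ifP; rewrite subrr.
      move: h; rewrite e mswap_j mswap_l => h.
      by rewrite ltnNge (ltnW h) subrr.
    have -> : (m == mswap j l m) = false.
      by apply/eqP => e; move: h; rewrite {1}e mswap_j ltnn.
    by rewrite h mul0r mul1r sub0r mulrN1.
  rewrite tauT_coef //; case: (eqVneq m (mswap j l b)) => [e|ne].
    have e' : mswap j l m = b by rewrite e mswapK.
    rewrite e' eqxx andbT.
    have [hj hl] : m j = b l /\ m l = b j by rewrite e mswap_j mswap_l.
    rewrite hj hl; case: ifP => hb; last by rewrite mulr0 subrr.
    have -> : (m == b) = false by apply/eqP => mb; move: hb; rewrite -hl mb ltnn.
    by rewrite mul0r subr0 mulr1 mul1r.
  have -> : (b == mswap j l m) = false.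
    by apply/eqP => e; move: ne; rewrite e mswapK eqxx.
  rewrite andbF mulr0 mul0r; case: ifP => hb; last by rewrite subrr.
  case: (eqVneq m b) => [e|_]; last by rewrite mul0r subrr.
  by move: h; rewrite e leqNgt hb.
rewrite (eq_big_seq _ E) sumrB.
have pick c : c \in s -> \sum_(m <- s) (m == c)%:R * f@_m = f@_c.
  move=> cs; rewrite (bigD1_seq c) //= eqxx mul1r big1 ?addr0 // => m /negbTE ->.
  by rewrite mul0r.
case: ifP => hb; last by rewrite !big1 ?subrr.
by rewrite !pick // mem_undup !inE eqxx ?orbT.
Qed.

End DividedDifference.

Lemma conv1 (F : fieldType) (k : nat -> F) a : conv 1 k a = k a.
Proof. by rewrite -polyC1 convC mul1r. Qed.

Section Heckman.
Variables (F : jackField) (N : nat).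
Local Notation alpha := (jf_alpha F).
Local Notation B := {mpoly F[N]}.
Implicit Types (m b : 'X_{1..N}) (f h : B) (j l : 'I_N).

Definition xi j f : B := alpha *: ('X_j * mderiv j f) + \sum_(l < N | l != j) tau j l f.

Lemma xi_linear j : linear (xi j).
Proof.
move=> c f h; rewrite /xi mderivD mderivZ mulrDr -scalerAr scalerDr scalerA [alpha * c]mulrC -scalerA.
have -> : \sum_(l < N | l != j) tau j l (c *: f + h) =
   c *: (\sum_(l < N | l != j) tau j l f) + \sum_(l < N | l != j) tau j l h.
  by rewrite scaler_sumr -big_split; apply: eq_bigr => l _; rewrite linearP.
by rewrite scalerDr addrACA.
Qed.
HB.instance Definition _ j := GRing.isLinear.Build F B B _ (xi j) (xi_linear j).

Lemma xi_coef j f b : (forall m, f@_m != 0 -> (rho m <= rho b)%N) ->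
  (xi j f)@_b = alpha * (b j)%:R * f@_b +
    \sum_(l < N | (b j < b l)%N) (f@_(mswap j l b) - f@_b).
Proof.
move=> top; rewrite /xi mcoeffD mcoeffZ mcoeff_euler mulrA raddf_sum /=.
rewrite (eq_bigr (fun l => if (b j < b l)%N then f@_(mswap j l b) - f@_b else 0)); last first.
  by move=> l lj; apply: tau_coef => //; rewrite eq_sym.
rewrite -big_mkcondr; congr (_ + _).
by apply: eq_bigl => l; case: (eqVneq l j) => [->|//]; rewrite ltnn.
Qed.

Definition rho_le R f := forall m, f@_m != 0 -> (rho m <= R)%N.

Lemma rho_le_xi R j f : rho_le R f -> rho_le R (xi j f).
Proof.
move=> hf b; apply: contraNT; rewrite -ltnNge => lt.
have f0 m : (R < rho m)%N -> f@_m = 0.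
  by move=> h; apply/eqP; apply: contraTT h => /hf; rewrite -leqNgt.
rewrite xi_coef; last by move=> m /hf h; apply: leq_trans h (ltnW lt).
rewrite f0 // mulr0 add0r big1 // => l _.
by rewrite f0 ?subr0 // /mswap rho_permute.
Qed.

Section TopCoefficient.
Variable be : nat -> nat.
Local Notation top := [multinom be i | i < N].
Hypothesis be_mono : forall i, (be i.+1 <= be i)%N.

(* The coefficient of [iter a (xi j) f] at a permutation [b] of the top exponent
   depends on [b j] only: it is [topc a (b j)], up to the factor [f@_top]. *)
Fixpoint topc (a v : nat) : F :=
  if a is a'.+1 then alpha * v%:R * topc a' v +
    \sum_(l < N | (v < be l)%N) (topc a' (be l) - topc a' v) else 1.

Lemma be_le (i j : nat) : (i <= j)%N -> (be j <= be i)%N.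
Proof.
move=> /subnK <-; elim: (j - i)%N => // m IH; exact: leq_trans (be_mono _) IH.
Qed.

(** The sum of the top coefficients, moved by one index and preceded by 1, so that its series is a
    product over the rows. *)
Definition leadmom a : F :=
  if a is a'.+1 then \sum_(l < N) topc a' (be l) else 1.

(** Rows as long as row [i] contribute zero; the [i] subtracted copies of [topc a (be i)] turn
    [alpha * be i] into the content of row [i]. *)
Lemma topc_rec a i : (i < N)%N ->
  topc a.+1 (be i) = cont F be i * topc a (be i) + \sum_(l < i) topc a (be l).
Proof.
move=> iN /=; rewrite /cont mulrBl -addrA; congr (_ + _).
transitivity (\sum_(l < N | (l < i)%N) (topc a (be l) - topc a (be i))).
  rewrite [LHS]big_mkcond [RHS]big_mkcond; apply: eq_bigr => l _.
  case: ltnP => h1; case: ltnP => h2 //; first by have := be_le h2; lia.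
  have h3 := be_le (ltnW h2); have e : be l = be i by lia.
  by rewrite e subrr.
rewrite sumrB addrC; congr (_ + _).
  by rewrite (big_ord_narrow (ltnW iN)).
by rewrite (big_ord_narrow (ltnW iN)) sumr_const card_ord mulr_natl.
Qed.

(** Let [S i] be the series over the first [i] rows and [Ph] that of row [i], of content [c]. By
    [topc_rec], [(1 - c X) Ph = S i], and [S i.+1 = S i + X Ph]. So row [i] multiplies the series by
    [(1 - (c - 1) X) / (1 - c X)]. *)
Lemma gen_leadmom : gen (den F N be) (num F N be) leadmom.
Proof.
pose S i a : F := if a is a'.+1 then \sum_(l < i) topc a' (be l) else 1.
suff H i : (i <= N)%N -> gen (den F i be) (num F i be) (S i) by move=> m; rewrite (H N).
elim: i => [|i IH] hi m.
  rewrite /den /num !big_ord0 conv1 coef1.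
  by case: m => //= m; rewrite big_ord0.
have lc c k : conv (lin c) k 0 = k 0%N.
  by rewrite convE big_ord1 lin_coef0 mul1r.
have lS c k a : conv (lin c) k a.+1 = k a.+1 - c * k a.
  by rewrite -[lin c]mulr1 conv_lin !conv1.
pose Ph a := topc a (be i).
have E1 : conv (lin (cont F be i)) Ph =1 S i.
  by case=> [|a]; rewrite ?lc // lS /Ph topc_rec // addrC addKr.
have E2 : S i.+1 =1 (fun a => S i a + conv 'X Ph a).
  move=> a; rewrite -['X]mulr1 conv_XM; case: a => [|a]; first by rewrite addr0.
  by rewrite conv1 /= big_ord_recr.
have E3 : conv (lin (cont F be i)) (S i.+1) =1 conv (lin (cont F be i - 1)) (S i).
  move=> a; rewrite (eq_conv _ E2) convDr -convM [lin _ * _]mulrC convM (eq_conv _ E1) -convDl.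
  by congr (conv _ _ _); rewrite /lin -!mul_polyC [(cont F be i - 1)%:P]polyCB; ring.
rewrite /den big_ord_recr /= convM (eq_conv _ E3) -convM [_ * lin _]mulrC convM.
by rewrite (eq_conv _ (IH (ltnW hi))) conv_poly /num big_ord_recr mulrC.
Qed.

Variable f : B.
Hypotheses (f_sym : f \is symmetric) (f_top : rho_le (rho top) f).

Lemma iter_xi_top a j (s : 'S_N) :
  (iter a (xi j) f)@_(mpermute s top) = topc a (be (s j)) * f@_top.
Proof.
have le a' : rho_le (rho top) (iter a' (xi j) f).
  by elim: a' => //= a' IH; apply: rho_le_xi.
elim: a s => [|a IH] s /=.
  by rewrite mul1r; apply: msym_coeff.
rewrite xi_coef; last by move=> m /le; rewrite rho_permute.
rewrite IH mulrDl mulr_suml !mnmE mulrA; congr (_ + _).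
rewrite [RHS](reindex_inj (@perm_inj _ s)) /=.
under eq_bigl => l do rewrite !mnmE.
apply: eq_bigr => l _; rewrite mulrBl -!IH; congr (_ - _).
have -> : be (s l) = be ((tperm j l * s)%g j) by rewrite permM tpermL.
rewrite -IH; congr (mcoeff _ _); apply/mnmP => i.
by rewrite !mnmE permM.
Qed.

End TopCoefficient.

(** Comparing coefficients at the top exponent expresses the eigenvalues of the power sums of the
    [xi j] by that exponent alone. *)
Lemma lead_moments f be (H : nat -> F) : (forall i, (be i.+1 <= be i)%N) ->
  f \is symmetric -> rho_le (rho [multinom be i | i < N]) f ->
  f@_[multinom be i | i < N] != 0 ->
  (forall a, \sum_(j < N) iter a (xi j) f = H a *: f) ->
  gen (den F N be) (num F N be) (fun a => if a is a'.+1 then H a' else 1).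
Proof.
move=> mono sf top nz eig m.
rewrite -(gen_leadmom mono); apply: eq_conv => -[//|a]; apply: (mulIf nz) => /=.
rewrite -mcoeffZ -eig raddf_sum mulr_suml; apply: eq_bigr => j _ /=.
have := iter_xi_top sf top a j 1%g; rewrite perm1 => <-; congr (mcoeff _ _).
by apply/mnmP => i; rewrite !mnmE perm1.
Qed.

End Heckman.

Lemma mpoly_indX (F : fieldType) n (P : {mpoly F[n]} -> Prop) :
  P 1 -> (forall i f, P f -> P ('X_i * f)) ->
  (forall c f h, P f -> P h -> P (c *: f + h)) -> forall f, P f.
Proof.
move=> P1 PX PL.
have P0 : P 0 by have := PL (-1) 1 1 P1 P1; rewrite scaleN1r addNr.
have PM d m : mdeg m = d -> P 'X_[m].
  elim: d m => [|d IH] m.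
    by move=> /eqP; rewrite mdeg_eq0 => /eqP ->; rewrite mpolyX0.
  move=> md; have [i mi] : exists i, m i != 0%N.
    apply/existsP; apply: contraPT md => /existsPn h.
    have -> : m = 0%MM by apply/mnmP => i; rewrite mnm0E; apply/eqP; rewrite -[_ == _]negbK h.
    by rewrite mdeg0.
  have le : (U_(i) <= m)%MM by rewrite lep1mP.
  rewrite -(submK le) addmC mpolyXD; apply/PX/IH.
  by apply: succn_inj; rewrite -md -{2}(submK le) mdegD mdeg1 addn1.
move=> f; rewrite [f]mpolyE; elim: (msupp f : seq _) => [|m s IH]; first by rewrite big_nil.
by rewrite big_cons; apply: PL => //; apply: PM.
Qed.

Lemma mpZl (F : fieldType) N (c : F) (u v : {mpoly F[N]}) : (c *: u) * v = c *: (u * v).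
Proof. by rewrite scalerAl. Qed.
Lemma mpZr (F : fieldType) N (c : F) (u v : {mpoly F[N]}) : u * (c *: v) = c *: (u * v).
Proof. by rewrite scalerAr. Qed.

(** * Evaluation of power sums in finitely many variables *)

Definition powersum (F : fieldType) N i : {mpoly F[N]} := \sum_(j < N) 'X_j ^+ i.
HB.lock Definition evk (F : fieldType) n N (f : {mpoly F[n]}) : {mpoly F[N]} :=
  f \mPo [tuple powersum F N i.+1 | i < n].

Section PowerSumEval.
Variables (F : jackField) (n N : nat).
Local Notation alpha := (jf_alpha F).
Local Notation A := {mpoly F[n]}.
Local Notation B := {mpoly F[N]}.
Local Notation V := {ffun 'I_n.+1 -> A}.
Implicit Types (f h : A) (g : V) (j l : 'I_N).

Local Notation psum := (powersum F N).
Local Notation evk := (@evk F n N).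

Lemma evk_linear : linear evk.
Proof. by move=> c f h; rewrite evk.unlock comp_mpolyD comp_mpolyZ. Qed.
HB.instance Definition _ := GRing.isLinear.Build F A B _ evk evk_linear.

Lemma evkZ c f : evk (c *: f) = c *: evk f. Proof. by rewrite evk.unlock comp_mpolyZ. Qed.
Lemma evkD f h : evk (f + h) = evk f + evk h. Proof. by rewrite evk.unlock comp_mpolyD. Qed.

Lemma evkX (i : 'I_n) f : evk ('X_i * f) = psum i.+1 * evk f.
Proof. by rewrite evk.unlock rmorphM /= comp_mpolyXU -tnth_nth tnth_mktuple. Qed.

Lemma evk1 : evk 1 = 1. Proof. by rewrite evk.unlock comp_mpoly1. Qed.

Lemma evk_Pm i f : (0 < i <= n)%N -> evk (Pm i f) = psum i * evk f.
Proof.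
by case: i => // i /= hi; rewrite Pm.unlock (pvE F (Ordinal hi)) evkX.
Qed.

Lemma psum_sym i : psum i \is symmetric.
Proof.
apply/issymP => s; rewrite /psum linear_sum /= [RHS](reindex_inj (@perm_inj _ s)) /=.
apply: eq_bigr => j _; rewrite rmorphXn /= msymX; congr ('X_[_] ^+ _).
by apply/mnmP => l; rewrite mnmE !mnm1E -(inj_eq (@perm_inj _ s)) permKV.
Qed.

Lemma evk_sym f : evk f \is symmetric.
Proof.
by rewrite evk.unlock; apply: mcomp_sym => i; rewrite -tnth_nth tnth_mktuple psum_sym.
Qed.

Lemma mderiv_psum j i : mderiv j (psum i.+1) = i.+1%:R *: 'X_j ^+ i.
Proof.
rewrite /psum raddf_sum /= (bigD1 j) //= big1 ?addr0 => [|l lj].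
  rewrite mpolyXn mderivX mulmnE mnm1E eqxx mul1n; congr (_ *: _).
  rewrite mpolyXn; congr 'X_[_]; apply/mnmP => l.
  by rewrite mnmBE !mulmnE mnm1E; case: (_ == _); lia.
by rewrite mpolyXn mderivX mulmnE mnm1E (negbTE lj) mul0n scale0r.
Qed.

Lemma mderiv_evk j f :
  'X_j * mderiv j (evk f) = \sum_(i < n) i.+1%:R *: ('X_j ^+ i.+1 * evk (mderiv i f)).
Proof.
elim/mpoly_indX: f => [|i f IH|c f h IHf IHh].
- rewrite evk1 -mpolyC1 mderivC mulr0 big1 // => i _.
  by rewrite -mpolyC1 mderivC raddf0 mulr0 scaler0.
- rewrite evkX mderivM mderiv_psum mulrDr [X in _ + X]mulrCA IH. rewrite mpZl mulr_sumr mpZr mulrA -exprS.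
  rewrite (bigD1 i) //= [in RHS](bigD1 i) //= addrA.
  have UU : (U_(i) - U_(i))%MM = 0%MM :> 'X_{1..n} by apply/mnmP => k; rewrite mnmBE mnm0E subnn.
  rewrite mderivM mderivX mnm1E eqxx scale1r UU mpolyX0 mul1r evkD evkX mulrDr scalerDr.
  congr (_ + _); first by congr (_ + _); rewrite mpZr mulrCA.
  apply: eq_bigr => k ki; rewrite mderivM mderivX mnm1E eq_sym (negbTE ki) scale0r mul0r add0r evkX.
  by rewrite mpZr mulrCA.
rewrite evkD evkZ mderivD mderivZ mulrDr mpZr IHf IHh scaler_sumr -big_split.
apply: eq_bigr => i _ /=; rewrite mderivD mderivZ evkD evkZ mulrDr scalerDr mpZr !scalerA.
by rewrite mulrC.
Qed.

(* The substitution [w := x_j]; it intertwines [Lx] and [xi j]. *)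
Definition evx j g : B := \sum_(m < n.+1) 'X_j ^+ m * evk (g m).

Lemma evx_vac j f : evx j (vac f) = evk f.
Proof.
rewrite /evx big_ord_recl vac0 mul1r big1 ?addr0 // => i _.
by rewrite vacS raddf0 mulr0.
Qed.

(** Powers of [x_j] below [m] come from the divided differences, powers above [m] from the
    derivative of [evk h]. The diagonal entry is [alpha * m], from the derivative of [x_j ^ m],
    minus [m], from the missing index [l = j] that would complete the power sums. *)
Lemma xi_evk d m j h : (d <= n)%N -> (m <= n)%N -> homo_at d m h ->
  xi j ('X_j ^+ m * evk h) = \sum_(k < n.+1) 'X_j ^+ k * evk (Lop k m h).
Proof.
move=> hd hm hh.
pose G k : B := 'X_j ^+ k * evk (Lop k m h).
have -> : \sum_(k < n.+1) 'X_j ^+ k * evk (Lop k m h) =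
    \sum_(i < m) G (m.-1 - i)%N + G m + \sum_(i < n - m) G (m + i.+1)%N.
  rewrite -(big_mkord xpredT G) (big_cat_nat (n := m.+1)) //= big_nat_recr //=.
  congr (_ + _ + _).
    by rewrite big_mkord (reindex_inj rev_ord_inj) /=; apply: eq_bigr => i _; congr G; lia.
  rewrite -{1}[m.+1]add0n big_addn subSS big_mkord; apply: eq_bigr => i _.
  by congr G; lia.
have Elow : \sum_(i < m) G (m.-1 - i)%N = \sum_(i < m) psum i.+1 * 'X_j ^+ (m.-1 - i) * evk h.
  apply: eq_bigr => i _; rewrite /G Lop_P; last by have := ltn_ord i; lia.
  have -> : (m - (m.-1 - i) = i.+1)%N by have := ltn_ord i; lia.
  rewrite evk_Pm; last by have := ltn_ord i; lia.
  by rewrite mulrA [psum _ * _]mulrC.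
have Ehigh : \sum_(i < n - m) G (m + i.+1)%N =
    'X_j ^+ m * (alpha *: ('X_j * mderiv j (evk h))).
  rewrite mderiv_evk scaler_sumr mulr_sumr.
  pose T i : B := 'X_j ^+ m * (alpha *: ('X_j ^+ i.+1 * evk (i.+1%:R *: dv i.+1 h))).
  transitivity (\sum_(i < n) T i); last first.
    by apply: eq_bigr => i _; rewrite /T (dvE i) evkZ !mpZr.
  rewrite (big_ord_widen n (fun i => G (m + i.+1)%N) (leq_subr m n)) [RHS](bigID (fun i : 'I_n => i < n - m)%N) /=.
  rewrite [X in _ = _ + X]big1 ?addr0 => [|i hi].
    apply: eq_bigr => i hi; rewrite /G /T Lop_Q; last by lia.
    rewrite addKn Qm.unlock evkZ evkZ !mpZr !scalerA exprD mulrA; congr (_ *: _).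
  (* The degree would be negative, so the terms that the truncation at [n] omits are zero. *)
  have Q0 : Qm i.+1 h = 0.
    apply: (homo_large (homo_Qm hh)); move: hi; rewrite -leqNgt; lia.
  suff -> : T i = 'X_j ^+ m * ('X_j ^+ i.+1 * evk (Qm i.+1 h)) by rewrite Q0 raddf0 !mulr0.
  by rewrite /T Qm.unlock !evkZ !mpZr !scalerA.
pose u : B := 'X_j ^+ m * evk h.
have EX : alpha *: ('X_j * (mderiv j ('X_j ^+ m) * evk h)) = (alpha * m%:R) *: u.
  rewrite -scalerA mulrA; congr (_ *: _); rewrite -mpZl; congr (_ * _).
  rewrite mpolyXn mderivX mulmnE mnm1E eqxx mul1n mpZr -mpolyXD.
  case: (m) => [|m']; first by rewrite !scale0r.
  congr (_ *: 'X_[_]); apply/mnmP => l; rewrite mnmDE mnmBE !mulmnE mnm1E.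
  by case: (j == l); lia.
have Etau : \sum_(l < N | l != j) tau j l u =
    \sum_(i < m) psum i.+1 * 'X_j ^+ (m.-1 - i) * evk h - m%:R *: u.
  transitivity (\sum_(l < N | l != j) \sum_(i < m) 'X_l ^+ i.+1 * 'X_j ^+ (m.-1 - i) * evk h).
    by apply: eq_bigr => l lj; rewrite /u tau_Xn ?evk_sym // eq_sym.
  rewrite exchange_big /=.
  have -> : m%:R *: u = \sum_(i < m) 'X_j ^+ i.+1 * 'X_j ^+ (m.-1 - i) * evk h.
    rewrite (eq_bigr (fun=> u)) ?sumr_const ?card_ord ?scaler_nat // => i _.
    by rewrite -exprD /u; congr ('X_j ^+ _ * _); have := ltn_ord i; lia.
  rewrite -sumrB; apply: eq_bigr => i _.
  under eq_bigr => l _ do rewrite -mulrA.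
  by rewrite -mulr_suml /powersum [in RHS](bigD1 j) //= -!mulrA mulrDl addrC addKr.
have Gm : G m = (alpha * m%:R) *: u - m%:R *: u.
  by rewrite /G Lop_d evkZ mpZr -scalerBl mulrBl mul1r.
rewrite Gm Elow Ehigh /xi Etau mderivM mulrDr scalerDr EX.
rewrite [LHS](AC (2*2) ((3*(1*4))*2)) /=; congr (_ + _).
by rewrite mpZr; congr (_ *: _); rewrite mulrCA.
Qed.

Lemma evx_Lx d j g : (d <= n)%N -> homoV d g -> evx j (Lx g) = xi j (evx j g).
Proof.
move=> hd hg; rewrite /evx raddf_sum /=.
under [RHS]eq_bigr => m _ do rewrite (xi_evk j hd (ltn_ord m) (hg m)).
rewrite exchange_big /=; apply: eq_bigr => k _.
by rewrite ffunE raddf_sum mulr_sumr.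
Qed.

Lemma iter_xi_evk d a j f : (d <= n)%N -> homo_at d 0 f ->
  iter a (xi j) (evk f) = evx j (iter a (@Lx F n) (vac f)).
Proof.
move=> hd hf; have hL b : homoV d (iter b (@Lx F n) (vac f)).
  by elim: b => [|b IH]; [exact: homoV_vac | exact: homoV_Lx].
elim: a => [|a IH] /=; first by rewrite evx_vac.
by rewrite IH (evx_Lx _ hd (hL a)).
Qed.

(** Summed over [j], the powers of [x_j] become power sums, which are the entries of row 0 of the
    Lax operator; the constant power gives [N]. *)
Lemma sum_evx g : \sum_(j < N) evx j g = N%:R *: evk (g ord0) + evk (Lx g ord0).
Proof.
rewrite exchange_big big_ord_recl /= (eq_bigr (fun=> evk (g ord0))) => [|j _]; last exact: mul1r.
rewrite sumr_const card_ord -scaler_nat.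
congr (_ + _); rewrite ffunE big_ord_recl Lop_d mulr0 scale0r add0r raddf_sum.
apply: eq_bigr => m _ /=; by rewrite -mulr_suml Lop_P // subn0 evk_Pm //=.
Qed.

(** The content of an empty row [i] is [- i], so the empty rows cancel telescopically between [den]
    and [num] and leave only the factor [1 + N X]. Multiplying the series of [k] by it gives the
    sequence on the right, which is the eigenvalue produced by [sum_evx]. *)
Lemma gen_rows_shift ga k M : (N <= M)%N -> (forall i, (N <= i <= M)%N -> ga i = 0%N) ->
  gen (den F M.+1 ga) (num F M ga) k ->
  gen (den F N ga) (num F N ga) (fun a => if a is a'.+1 then N%:R * k a' + k a else 1).
Proof.
move=> NM ga0 gk.
have E : den F M.+1 ga * num F N ga = den F N ga * (lin (- N%:R) * num F M ga).
  rewrite -(subnK NM) in ga0 *; elim: (M - N)%N ga0 => [|e IH] ga0.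
    rewrite add0n /den big_ord_recr /= /cont ga0 ?leqnn ?leq_addl //.
    by rewrite mulr0 add0r mulrA.
  rewrite addSn /den big_ord_recr /= mulrAC -/(den _ _ _) IH; last first.
    by move=> i /andP [h1 h2]; apply: ga0; rewrite h1 addSn leqW.
  have z1 : ga (e + N)%N = 0%N by apply: ga0; lia.
  have z2 : ga (e + N).+1 = 0%N by apply: ga0; lia.
  rewrite {2}/num big_ord_recr /= -/(num _ _ _) /cont z1 z2.
  by rewrite !mulr0 !add0r -opprD -natr1 -!mulrA.
pose s a : F := if a is a'.+1 then N%:R * k a' + k a else 1; change (gen (den F N ga) (num F N ga) s).
have s_lin : conv (lin (- N%:R)) k =1 s.
  case=> [|a]; last by rewrite -[lin _]mulr1 conv_lin !conv1 mulNr opprK addrC.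
  have := gk 0%N; rewrite !convE !big_ord1 subnn.
  rewrite /den /num !prod_lin_coef0 lin_coef0 !mul1r => ->; exact.
apply: (gen_cancel (p := den F M.+1 ga)); first by rewrite /den prod_lin_coef0 oner_neq0.
move=> m; rewrite E [_ * den F N ga]mulrC -(eq_conv _ s_lin) -conv_poly convM.
apply: eq_conv => {}m; rewrite -convM [_ * lin _]mulrC convM (eq_conv _ gk).
by rewrite conv_poly.
Qed.

Lemma jackspace_moments d ga f : (d <= n)%N -> (N <= n)%N ->
  (forall i, (N <= i <= n)%N -> ga i = 0%N) -> homo_at d 0 f -> jackspace ga f ->
  exists2 H : nat -> F,
    gen (den F N ga) (num F N ga) (fun a => if a is a'.+1 then H a' else 1)
    & forall a, \sum_(j < N) iter a (xi j) (evk f) = H a *: evk f.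
Proof.
move=> hd hN ga0 hf [k gk hk]; exists (fun a => N%:R * k a + k a.+1).
  by move=> m; rewrite -(gen_rows_shift hN ga0 gk); apply: eq_conv => -[|a].
move=> a; under eq_bigr => j _ do rewrite (iter_xi_evk _ _ hd hf).
rewrite sum_evx -iterS !hk !evkZ scalerA -scalerDl.
by [].
Qed.

End PowerSumEval.

Lemma sort_mpermute N (m : 'X_{1..N}) :
  exists (s : 'S_N) (be : nat -> nat), (forall i, (be i.+1 <= be i)%N) /\
    [multinom be i | i < N] = mpermute s m.
Proof.
have sz : size (sort geq m) == N by rewrite size_sort size_tuple.
pose t := Tuple sz; have /tuple_permP [s Es] : perm_eq t m by rewrite /= perm_sort.
exists s, (fun i => nth 0%N t i); split=> [i|].
  have srt : sorted geq t by apply: sort_sorted => x y; rewrite /geq /= leq_total.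
  case: (ltnP i.+1 N) => h; last by rewrite nth_default // size_tuple.
  have /sortedP -/(_ 0%N i) := srt; apply; by rewrite size_tuple.
apply/mnmP => i; rewrite !mnmE -tnth_nth.
have -> : t = [tuple tnth m (s i) | i < N] by apply: val_inj.
by rewrite tnth_mktuple (mnm_nth 0%N) (tnth_nth 0%N).
Qed.

Lemma sym_top (F : fieldType) N (f : {mpoly F[N]}) : f \is symmetric -> f != 0 ->
  exists be : nat -> nat, [/\ forall i, (be i.+1 <= be i)%N,
    forall m, f@_m != 0 -> (rho m <= rho [multinom be i | i < N])%N
    & f@_[multinom be i | i < N] != 0].
Proof.
move=> sf f0.
pose P r := has (fun m => rho m == r) (msupp f).
have exP : exists r, P r.
  have : msupp f != [::] by rewrite msupp_eq0.
  by case E : (msupp f) => [//|m s] _; exists (rho m); rewrite /P E /= eqxx.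
have ubP r : P r -> (r <= \sum_(m <- msupp f) rho m)%N.
  case/hasP => m hm /eqP <-; rewrite (big_rem m) //=; exact: leq_addr.
case: (ex_maxnP exP ubP) => r /hasP [m hm /eqP <-] mx.
have [s [be [mono E]]] := sort_mpermute m; exists be; split=> //; rewrite E.
- move=> m' hm'; rewrite rho_permute; apply: mx; apply/hasP; exists m' => //.
  by rewrite mcoeff_msupp.
- by rewrite /mpermute msym_coeff // -mcoeff_msupp.
Qed.

(** * Leading exponents of joint eigenvectors, and columns *)

Section Leading.
Variables (F : jackField) (N : nat).
Local Notation alpha := (jf_alpha F).
Local Notation B := {mpoly F[N]}.
Implicit Types (f h : B) (ga be : nat -> nat) (H : nat -> F).
Local Notation rows ga := [multinom ga i | i < N].

(** Any exponent of maximal [rho] in [f], sorted, yields the moments of [f] by [lead_moments]; these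
    determine the rows, so the exponent is [ga]. *)
Lemma eigen_lead f ga H : f \is symmetric -> f != 0 -> (forall i, (ga i.+1 <= ga i)%N) ->
  gen (den F N ga) (num F N ga) (fun a => if a is a'.+1 then H a' else 1) ->
  (forall a, \sum_(j < N) iter a (xi j) f = H a *: f) ->
  rho_le (rho (rows ga)) f /\ f@_(rows ga) != 0.
Proof.
move=> sf f0 mono gH eig; have [be [bmono top nz]] := sym_top sf f0.
have gb := lead_moments bmono sf top nz eig.
have E := rows_unique bmono mono (gen_unique gb gH).
have <- : rows be = rows ga by apply/mnmP => i; rewrite !mnmE E.
by [].
Qed.

(** The exponent of [x_1 ... x_N]. Multiplying by this monomial adds a full column; being symmetric
    it passes through [tau], so it only shifts each [xi j] by [alpha]. *)
Definition ones : 'X_{1..N} := [multinom 1%N | i < N].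

Lemma xi_ones j f : xi j ('X_[ones] * f) = 'X_[ones] * (xi j f + alpha *: f).
Proof.
have sy : ('X_[ones] : B) \is symmetric.
  apply/issymP => s; rewrite msymX; congr 'X_[_]; apply/mnmP => i; by rewrite !mnmE.
rewrite /xi (eq_bigr (fun l => 'X_[ones] * tau j l f)) => [|l lj]; last first.
  by rewrite tau_symM // eq_sym.
have e : 'X_j * mderiv j ('X_[ones] : B) = 'X_[ones].
  rewrite mderivX mnmE scale1r -mpolyXD; congr 'X_[_]; apply/mnmP => i.
  by rewrite mnmDE mnmBE mnm1E mnmE; case: eqP.
have -> : 'X_j * mderiv j ('X_[ones] * f) = 'X_[ones] * f + 'X_[ones] * ('X_j * mderiv j f).
  by rewrite mderivM mulrDr [X in X + _]mulrA e [X in _ + X]mulrCA.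
rewrite scalerDr -mulr_sumr !mulrDr !mpZr.
by rewrite -addrA addrC.
Qed.

Lemma iter_xi_ones a j f :
  iter a (xi j) ('X_[ones] * f) = 'X_[ones] * pact (@xi F N j) (('X + alpha%:P) ^+ a) f.
Proof.
elim: a => [|a IH] /=; first by rewrite expr0 pact1.
by rewrite IH xi_ones exprS pactM pactDl pactX pactC.
Qed.

Lemma eigen_ones f H a : (forall a, \sum_(j < N) iter a (xi j) f = H a *: f) ->
  \sum_(j < N) iter a (xi j) ('X_[ones] * f) =
  (\sum_(i < size (('X + alpha%:P) ^+ a)) (('X + alpha%:P) ^+ a)`_i * H i) *: ('X_[ones] * f).
Proof.
move=> eig; under eq_bigr => j _ do rewrite iter_xi_ones.
rewrite -mulr_sumr -mpZr; congr (_ * _); rewrite /pact exchange_big scaler_suml /=.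
by apply: eq_bigr => i _; rewrite -scaler_sumr eig scalerA.
Qed.

Lemma rho_ones m : rho (ones + m)%MM = (rho m + 2 * mdeg m + N)%N.
Proof.
have EN : (\sum_(i < N) 1 = N)%N by rewrite sum1_card card_ord.
rewrite /rho mdegE big_distrr /= -[X in (_ + X)%N]EN -!big_split.
by apply: eq_bigr => i _ /=; rewrite mnmDE mnmE; lia.
Qed.

Lemma mcoeff_ones f m : ('X_[ones] * f)@_(ones + m) = f@_m.
Proof. by rewrite mulrC mcoeffMX. Qed.

Lemma mcoeff_ones_neq0 f m : ('X_[ones] * f)@_m != 0 ->
  exists2 m', m = (ones + m')%MM & f@_m' != 0.
Proof.
rewrite -mcoeff_msupp => /msuppM_le/allpairsP [[m1 m2] /= [h1 h2 ->]].
move: h1; rewrite msuppX inE => /eqP ->; exists m2 => //; by rewrite -mcoeff_msupp.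
Qed.

(* Both sides lie in the same joint eigenspace and have the same coefficient at [ga]. *)
Lemma column_strip f h ga H H' d : (forall i, (ga i.+1 <= ga i)%N) ->
  f \is symmetric -> h \is symmetric -> h != 0 -> (forall m, h@_m != 0 -> mdeg m = d) ->
  gen (den F N (fun i => (ga i).+1)) (num F N (fun i => (ga i).+1))
    (fun a => if a is a'.+1 then H a' else 1) ->
  gen (den F N ga) (num F N ga) (fun a => if a is a'.+1 then H' a' else 1) ->
  (forall a, \sum_(j < N) iter a (xi j) f = H a *: f) ->
  (forall a, \sum_(j < N) iter a (xi j) h = H' a *: h) ->
  h@_(rows ga) *: f = f@_[multinom (ga i).+1 | i < N] *: ('X_[ones] * h).
Proof.
move=> mono sf sh h0 hd gH gH' eig eig'.
have [top nz] := eigen_lead sh h0 mono gH' eig'.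
set ga' := fun i => (ga i).+1 in gH.
have mono' i : (ga' i.+1 <= ga' i)%N by rewrite /ga' ltnS.
have Er : rows ga' = (ones + rows ga)%MM by apply/mnmP => i; rewrite mnmDE !mnmE.
have sy : ('X_[ones] * h : B) \is symmetric.
  apply/issymP => s; rewrite msymM (issymP _ sh) msymX; congr ('X_[_] * _).
  by apply/mnmP => i; rewrite !mnmE.
pose H'' a := \sum_(i < size (('X + alpha%:P) ^+ a)) (('X + alpha%:P) ^+ a)`_i * H' i.
have eige a : \sum_(j < N) iter a (xi j) ('X_[ones] * h) = H'' a *: ('X_[ones] * h).
  exact: eigen_ones.
have geH : gen (den F N ga') (num F N ga') (fun a => if a is a'.+1 then H'' a' else 1).
  apply: (lead_moments mono' sy) eige; rewrite Er ?mcoeff_ones //.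
  move=> _ /mcoeff_ones_neq0 [m -> hm]; rewrite !rho_ones (hd _ hm) (hd _ nz).
  by rewrite !leq_add2r top.
have HH a : H'' a = H a.
  have := gen_inj _ geH gH; move=> /(_ _ a.+1); apply.
  by rewrite /den prod_lin_coef0 oner_neq0.
pose g := h@_(rows ga) *: f - f@_(rows ga') *: ('X_[ones] * h).
suff : g = 0 by move/eqP; rewrite subr_eq0 => /eqP.
apply/eqP; apply: contraT => g0.
have sg : g \is symmetric.
  apply/issymP => s; rewrite /g msymB !msymZ (issymP _ sf) (issymP _ sy) //.
have eigg a : \sum_(j < N) iter a (xi j) g = H a *: g.
  rewrite /g scalerBr ![H a *: (_ *: _)]scalerA ![H a * _]mulrC -!scalerA -eig -HH -eige.
  rewrite !scaler_sumr -sumrB; apply: eq_bigr => j _.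
  by rewrite -!scaleNr iterLD !iterLZ scaleNr.
have [_] := eigen_lead sg g0 mono' gH eigg.
by rewrite /g mcoeffB !mcoeffZ Er mcoeff_ones mulrC subrr eqxx.
Qed.

End Leading.

(** * Normalisation and uniqueness *)

Section Hook.
Variables (F : jackField) (n : nat).
Local Notation alpha := (jf_alpha F).
Local Notation A := {mpoly F[n]}.
Implicit Types (f h : A) (ga : nat -> nat).

(** Setting the variables beyond the first [k] to zero does not change coefficients of monomials in
    the first [k]. *)
Lemma evk_stable k f be : (k <= n)%N -> (forall i, (k <= i)%N -> be i = 0%N) ->
  (evk k f)@_[multinom be i | i < k] = (evk n f)@_[multinom be i | i < n].
Proof.
move=> kn; pose t : n.-tuple {mpoly F[k]} :=
  [tuple if insub (val i) is Some j then 'X_j else 0 | i < n].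
have tE (i : 'I_n) : t`_i = if insub (val i) is Some j then 'X_j else 0.
  by rewrite -tnth_nth tnth_mktuple.
have -> : evk k f = evk n f \mPo t.
  elim/mpoly_indX: f => [|i f IH|c f h IHf IHh].
  - by rewrite !evk1 comp_mpoly1.
  - rewrite !evkX IH rmorphM /=; congr (_ * _); rewrite /powersum raddf_sum /=.
    rewrite (eq_bigr (fun j : 'I_n => (if insub (val j) is Some l then 'X_l else 0) ^+ i.+1)).
      rewrite (bigID (fun j : 'I_n => j < k)%N) /= [X in _ = _ + X]big1 ?addr0.
        rewrite (big_ord_narrow kn); apply: eq_bigr => j _ /=.
        by have E : insub (nat_of_ord j) = Some j := valK j; rewrite E.
      by move=> j jk; rewrite insubF ?expr0n //; apply: negbTE.
    by move=> j _; rewrite rmorphXn /= comp_mpolyXU tE.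
  - by rewrite !evkD !evkZ comp_mpolyD comp_mpolyZ IHf IHh.
move: (evk n f) => g; elim/mpoly_indX: g be => [|i g IH|c g h IHg IHh] be be0.
- rewrite comp_mpoly1 !mcoeff1; congr (nat_of_bool _)%:R; apply/eqP/eqP => /mnmP E; apply/mnmP => j.
    rewrite mnmE mnm0E; case: (ltnP j k) => jk; last exact: be0.
    by have := E (Ordinal jk); rewrite mnmE mnm0E.
  by have := E (widen_ord kn j); rewrite !mnmE.
- rewrite rmorphM /= comp_mpolyXU tE mcoeffXM mnmE.
  case: (ltnP i k) => ik; last by rewrite insubF ?be0 ?mul0r ?mcoeff0 // ltnNge ik.
  rewrite insubT mcoeffXM mnmE /=; case: eqP => // b0.
  pose be' j := (be j - (j == i))%N.
  have E m (j : 'I_m) : j = i :> nat ->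
     ([multinom be l | l < m] - U_(j))%MM = [multinom be' l | l < m].
    move=> ji; apply/mnmP => l; rewrite mnmBE mnm1E !mnmE /be' -ji eq_sym.
    by rewrite -val_eqE.
  rewrite !E //; apply: IH => j jk; by rewrite /be' be0.
by rewrite comp_mpolyD comp_mpolyZ !mcoeffD !mcoeffZ IHg ?IHh.
Qed.

(** At [k] variables equal to 1 every power sum equals [k]. *)
Lemma meval_evk k f : (evk k f).@[fun=> 1] = (psX f).[k%:R].
Proof.
elim/mpoly_indX: f => [|i f IH|c f h IHf IHh].
- by rewrite evk1 meval1 /psX rmorph1 hornerC.
- rewrite evkX mevalM IH /psX rmorphM /= mmapX mmap1U hornerM hornerX; congr (_ * _).
  rewrite /powersum raddf_sum /= (eq_bigr (fun=> 1)) ?sumr_const ?card_ord // => j _.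
  by rewrite rmorphXn /= mevalXU expr1n.
- rewrite evkD evkZ mevalD mevalZ IHf IHh /psX raddfD /= hornerD; congr (_ + _).
  by rewrite -[mmap _ _ (c *: f)]/(psX (c *: f)) psXZ hornerZ.
Qed.

Lemma evk_homo d k f m : homo_at d 0 f -> (evk k f)@_m != 0 -> mdeg m = d.
Proof.
move=> hf nz.
have : \sum_(j < k) 'X_j * mderiv j (evk k f) = d%:R *: evk k f.
  under eq_bigr => j _ do rewrite mderiv_evk.
  rewrite exchange_big /= -evkZ.
  have -> : d%:R *: f = \sum_(i < n) i.+1%:R *: ('X_i * mderiv i f).
    apply/mpolyP => b; rewrite mcoeffZ raddf_sum /=.
    rewrite (eq_bigr (fun i : 'I_n => (i.+1 * b i)%N%:R * f@_b)) => [|i _]; last first.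
      by rewrite mcoeffZ mcoeff_euler natrM mulrA.
    rewrite -mulr_suml -natr_sum -/(wt b); case: (eqVneq f@_b 0) => [->|/hf].
      by rewrite !mulr0.
    by rewrite addn0 => ->.
  rewrite raddf_sum; apply: eq_bigr => i _ /=; rewrite evkZ evkX -scaler_sumr.
  by congr (_ *: _); rewrite -mulr_suml.
move/(congr1 (mcoeff m)); rewrite mcoeffZ raddf_sum /=.
under eq_bigr => j _ do rewrite mcoeff_euler.
rewrite -mulr_suml -natr_sum -mdegE => /(mulIf nz) E.
by have [] := @jf_indep F 0 (mdeg m) 0 d; rewrite // mulr0 !add0r.
Qed.

Definition cols ga j := (\sum_(i < n) (j < ga i))%N.
Definition hookg ga : F :=
  boxes *%R n ga (fun i j => alpha * (ga i - j - 1)%N%:R + (cols ga j - i)%N%:R).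

Section Strip.
Variables (ga : nat -> nat) (k : nat).
Hypothesis ga_k : forall i, (0 < ga i)%N = (i < k)%N.
Local Notation gm := (fun i => (ga i).-1).

Lemma boxes_last (G : nat -> nat -> F) :
  boxes *%R n ga G = boxes *%R n gm G * \prod_(i < n | (i < k)%N) G i (ga i).-1.
Proof.
rewrite /boxes [X in _ * X]big_mkcond -big_split; apply: eq_bigr => i _ /=.
rewrite -ga_k; case: (ga i) => [|g] /=; first by rewrite !big_ord0 mulr1.
by rewrite big_ord_recr.
Qed.

Lemma boxes_first (G : nat -> nat -> F) :
  boxes *%R n ga G = boxes *%R n gm (fun i j => G i j.+1) * \prod_(i < n | (i < k)%N) G i 0%N.
Proof.
rewrite /boxes [X in _ * X]big_mkcond -big_split; apply: eq_bigr => i _ /=.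
rewrite -ga_k; case: (ga i) => [|g] /=; first by rewrite !big_ord0 mulr1.
by rewrite big_ord_recl mulrC.
Qed.

(** This is at once the product of the hook factors over the first column and the product of [k]
    plus the content over the last boxes of the rows. The coincidence lets the induction on columns
    compare [hookg] with [contpoly]. *)
Definition striprod : F := \prod_(i < n | (i < k)%N) (alpha * (ga i).-1%:R + (k - i)%N%:R).

Hypothesis kn : (k <= n)%N.

Lemma cols0 : cols ga 0 = k.
Proof.
rewrite /cols; under eq_bigr => i _ do rewrite ga_k.
by rewrite -big_mkcond /= (big_ord_narrow kn) sum1_card card_ord.
Qed.

Lemma colsS j : cols ga j.+1 = cols gm j.
Proof. by apply: eq_bigr => i _; case: (ga i) => [|g] //; rewrite ltn0. Qed.

Lemma hookg_strip : hookg ga = hookg gm * striprod.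
Proof.
rewrite /hookg boxes_first; congr (_ * _).
  apply: eq_bigr => i _; apply: eq_bigr => j _; rewrite colsS.
  by congr (_ * _%:R + _); lia.
by apply: eq_bigr => i _; rewrite cols0 subn0 subn1.
Qed.

Lemma contpoly_horner g x :
  (contpoly F n g).[x] = boxes *%R n g (fun i j => x + content F i j).
Proof.
rewrite /contpoly /boxes horner_prod; apply: eq_bigr => i _; rewrite horner_prod.
by apply: eq_bigr => j _; rewrite hornerD hornerX hornerC.
Qed.

Lemma contpoly_strip : (contpoly F n ga).[k%:R] = (contpoly F n gm).[k%:R] * striprod.
Proof.
rewrite !contpoly_horner boxes_last; congr (_ * _); apply: eq_bigr => i ik.
by rewrite /content natrB 1?ltnW // addrCA.
Qed.

Lemma contpoly_neq0 g : (forall i, (k <= i)%N -> g i = 0%N) -> (contpoly F n g).[k%:R] != 0.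
Proof.
move=> g0; rewrite contpoly_horner; apply/prodf_neq0 => i _; apply/prodf_neq0 => j _.
case: (ltnP i k) => ik; last by have := ltn_ord j; have := g0 _ ik; lia.
apply/eqP => E; have [] := @jf_indep F j (k - i) 0 0.
  by rewrite mulr0 addr0 natrB 1?ltnW // addrCA.
by move=> _ /eqP; rewrite subn_eq0 leqNgt ik.
Qed.

End Strip.

Lemma rows_count d ga : diagram n d ga ->
  exists2 k, (k <= n)%N & forall i, (0 < ga i)%N = (i < k)%N.
Proof.
move=> [mono out _].
have ex : exists i, ga i == 0%N by exists n; rewrite out.
case: (ex_minnP ex) => k /eqP gk mn; exists k; first by apply: mn; rewrite out.
move=> i; case: (ltnP i k) => ik.
  by rewrite lt0n; apply: contraTN ik => /mn; rewrite -leqNgt.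
suff : ga i = 0%N by move=> ->.
apply/eqP; rewrite -leqn0 -gk -(subnK ik); elim: (i - k)%N => // m IH.
exact: leq_trans (mono _) IH.
Qed.

(** In as many variables as there are rows, [f] is proportional to [x_1 ... x_k] times the function
    [h] of the diagram without its first column. The factor is found by setting all variables to 1,
    where both functions are values of [contpoly] at [k], and these differ by [striprod]. *)
Lemma lead_hook d ga f : (d <= n)%N -> diagram n d ga -> homo_at d 0 f -> jackspace ga f ->
  psX f = contpoly F n ga -> (evk n f)@_[multinom ga i | i < n] = hookg ga.
Proof.
elim/ltn_ind: d ga f => d IH ga f hd hga hf jf pf.
have [k kn gk] := rows_count hga; have [mono out sm] := hga.
case: (posnP k) => k0.
  have z i : ga i = 0%N by apply/eqP; rewrite -leqn0 leqNgt gk k0.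
  have d0 : d = 0%N by rewrite -sm big1.
  have fC : f = (f@_0)%:MP.
    apply/mpolyP => m; rewrite mcoeffC; case: (eqVneq 0%MM m) => [<-|m0]; first by rewrite mulr1.
    rewrite mulr0; apply/eqP; apply: contraT => /hf; rewrite d0 addn0 /wt => /eqP.
    rewrite sum_nat_eq0 => /forallP h; exfalso; move/eqP: m0; apply; apply/mnmP => i.
    by rewrite mnm0E; have := h i; rewrite muln_eq0 /= => /eqP.
  have f1 : f = 1.
    move: pf; rewrite fC /psX mmapC /contpoly boxes0 // => /(congr1 (fun p : {poly F} => p`_0)).
    by rewrite coefC coef1 /= => ->.
  rewrite f1 evk1 mcoeff1 /hookg boxes0 //.
  have -> : [multinom ga i | i < n] = 0%MM by apply/mnmP => i; rewrite mnmE mnm0E z.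
  by rewrite eqxx.
pose gm i := (ga i).-1.
have hgm : diagram n (d - k) gm.
  split=> [i|i ni|]; [| by rewrite /gm out |].
    by rewrite /gm; have := mono i; case: (ga i) => [|g]; case: (ga i.+1) => //=.
  rewrite -sm -(cols0 gk kn) /cols -sumnB => [|i _]; last by case: (ga i).
  by apply: eq_bigr => i _; rewrite /gm; case: (ga i) => //= g; rewrite subn1.
have dk : (d - k < d)%N.
  rewrite ltn_subrL k0 /= -sm; have n0 := leq_trans k0 kn.
  by rewrite (bigD1 (Ordinal n0)) //= addn_gt0 gk k0.
have hd' : (d - k <= n)%N by apply: leq_trans hd; apply: ltnW.
have [h [hh jh _ ph]] := jack_exists F hd' hgm.
have IHh := IH _ dk _ _ hd' hgm hh jh ph.
have ga0 i : (k <= i)%N -> ga i = 0%N.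
  by move=> ki; have := gk i; rewrite [RHS]ltnNge ki; case: (ga i).
have gm0 i : (k <= i)%N -> gm i = 0%N by move=> /ga0; rewrite /gm => ->.
have [H gH eig] : exists2 H : nat -> F,
    gen (den F k ga) (num F k ga) (fun a => if a is a'.+1 then H a' else 1)
    & forall a, \sum_(j < k) iter a (xi j) (evk k f) = H a *: evk k f.
  by apply: (jackspace_moments hd kn _ hf jf) => i /andP [/ga0].
have [H' gH' eig'] : exists2 H : nat -> F,
    gen (den F k gm) (num F k gm) (fun a => if a is a'.+1 then H a' else 1)
    & forall a, \sum_(j < k) iter a (xi j) (evk k h) = H a *: evk k h.
  by apply: (jackspace_moments hd' kn _ hh jh) => i /andP [/gm0].
have c0 : (contpoly F n gm).[k%:R] != 0 by apply: contpoly_neq0.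
have ev0 : evk k h != 0.
  by apply: contraNneq c0 => e; rewrite -ph -meval_evk e meval0.
have gS i : (i < k)%N -> (gm i).+1 = ga i by move=> ik; rewrite /gm prednK // gk.
rewrite -(eq_den F (N := k) (ga := fun i => (gm i).+1)) // in gH.
rewrite -(eq_num F (N := k) (ga := fun i => (gm i).+1)) // in gH.
have [gmono _ _] := hgm.
have := column_strip gmono (evk_sym k f) (evk_sym k h) ev0 _ gH gH' eig eig'.
move=> /(_ (d - k)%N (fun m => evk_homo hh)) /(congr1 (meval (fun=> 1))).
rewrite !mevalZ mevalM !meval_evk ph pf mevalX big1 ?mul1r => [|i _]; last by rewrite expr1n.
rewrite (contpoly_strip gk) (evk_stable h kn gm0) IHh.
have -> : [multinom (gm i).+1 | i < k] = [multinom ga i | i < k].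
  by apply/mnmP => i; rewrite !mnmE gS.
rewrite (evk_stable f kn ga0) (hookg_strip gk kn) => E.
by apply: (mulIf c0); rewrite -E mulrAC mulrA.
Qed.

End Hook.

(** * Partitions as multiplicity vectors and as rows *)

Section Parts.
Variable n : nat.
Implicit Types (m mu la : 'X_{1..n}).

Lemma parts_sum m (G : nat -> nat) :
  (\sum_(x <- parts m) G x = \sum_(i < n) m i * G i.+1)%N.
Proof.
rewrite /parts big_flatten big_map (perm_big (enum 'I_n)) ?perm_rev //= big_enum /=.
by apply: eq_bigr => i _; rewrite big_nseq iter_addn_0 mulnC.
Qed.

Lemma size_parts m : size (parts m) = mdeg m.
Proof.
by rewrite -sum1_size parts_sum mdegE; apply: eq_bigr => i _; rewrite muln1.
Qed.

Lemma mdeg_wt m : (mdeg m <= wt m)%N.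
Proof. by rewrite mdegE /wt; apply: leq_sum => i _; rewrite leq_pmull. Qed.

Lemma parts_sorted m : sorted geq (parts m).
Proof.
have tr : transitive geq by move=> y x z h1 h2; exact: leq_trans h2 h1.
rewrite (sorted_pairwise tr) /parts.
have : pairwise (fun i j : 'I_n => (j < i)%N) (rev (enum 'I_n)).
  have -> : pairwise (fun i j : 'I_n => (j < i)%N) (rev (enum 'I_n))
      = pairwise gtn (map val (rev (enum 'I_n))).
    by rewrite pairwise_map.
  rewrite map_rev val_enum_ord -sorted_pairwise ?rev_sorted; last first.
    by move=> y x z /= h1 h2; exact: ltn_trans h2 h1.
  exact: iota_ltn_sorted.
elim: (rev _) => //= i s IH /andP [hi /IH hs].
rewrite pairwise_cat hs andbT; apply/andP; split.
  apply/allrelP => x y /nseqP [-> _] /flatten_mapP [j js /nseqP [-> _]].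
  by move/allP: hi => /(_ j js) /= h; apply: ltnW.
by elim: (m i) => //= c ->; rewrite andbT all_nseq /= leqnn orbT.
Qed.

Lemma part_mono m i : (part m i.+1 <= part m i)%N.
Proof.
rewrite /part; case: (ltnP i.+1 (size (parts m))) => h; last by rewrite nth_default.
by have /sortedP -/(_ 0%N i) := parts_sorted m; apply.
Qed.

Lemma part_out m i : (mdeg m <= i)%N -> part m i = 0%N.
Proof. by move=> h; rewrite /part nth_default // size_parts. Qed.

Lemma part_sum m (G : nat -> nat) N : (mdeg m <= N)%N -> G 0%N = 0%N ->
  (\sum_(i < N) G (part m i) = \sum_(i < n) m i * G i.+1)%N.
Proof.
move=> h G0; rewrite -parts_sum (big_nth 0%N) size_parts big_mkord.
rewrite (big_ord_widen N (fun i => G (nth 0%N (parts m) i)) h).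
rewrite [LHS](bigID (fun i : 'I_N => i < mdeg m)%N) /= [X in (_ + X)%N]big1 ?addn0 // => i.
by rewrite -leqNgt => hi; rewrite part_out.
Qed.

Lemma diagram_part m : wt m = n -> diagram n n (part m).
Proof.
move=> wm; have dm : (mdeg m <= n)%N by rewrite -{2}wm mdeg_wt.
split=> [i|i hi|]; [exact: part_mono | by rewrite part_out // (leq_trans dm) |].
rewrite (part_sum (G := id) dm) // -[RHS]wm /wt.
by apply: eq_bigr => i _; rewrite mulnC.
Qed.

Lemma part_inj mu la : wt mu = n -> wt la = n ->
  (forall i, (i < n)%N -> part mu i = part la i) -> mu = la.
Proof.
move=> hm hl E; apply/mnmP => i.
have P m : wt m = n -> (\sum_(j < n) (part m j == i.+1) = m i)%N.
  move=> wm; rewrite (part_sum (G := fun x => nat_of_bool (x == i.+1))) //; last first.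
    by rewrite -{2}wm mdeg_wt.
  rewrite (bigD1 i) //= eqxx muln1 big1 ?addn0 // => j ji.
  by rewrite eqSS val_eqE (negbTE ji) muln0.
by rewrite -(P _ hm) -(P _ hl); apply: eq_bigr => j _; rewrite E.
Qed.

Lemma abel_le (a b mu : nat -> nat) N : (forall i, (mu i.+1 <= mu i)%N) ->
  (forall k, (\sum_(j < k) a j <= \sum_(j < k) b j)%N) ->
  (\sum_(j < N) mu j * a j <= \sum_(j < N) mu j * b j)%N.
Proof.
(* Abel summation, in a form without subtraction: the claim strengthened by the boundary term at
   [mu N] is what the induction carries. *)
move=> mono le; suff : (\sum_(j < N) mu j * a j + mu N * \sum_(j < N) b j
    <= \sum_(j < N) mu j * b j + mu N * \sum_(j < N) a j)%N.
  by have := leq_mul (leqnn (mu N)) (le N); lia.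
elim: N => [|N IH]; first by rewrite !big_ord0.
have := le N.+1; rewrite !big_ord_recr /=; have := mono N.
move: IH; set A := (\sum_(_ < N) a _)%N; set B := (\sum_(_ < N) b _)%N.
set C := (\sum_(_ < N) _ * _)%N; set D := (\sum_(_ < N) _ * _)%N => IH h1 h2.
have : (mu N.+1 * (B + b N - (A + a N)) <= mu N * (B + b N - (A + a N)))%N by rewrite leq_mul.
nia.
Qed.

(** By Abel summation [rho] of [mu] is at most the sum of the products of rows, which is at most the
    mean of the two values of [rho]. If these are equal, then equality holds in each inequality
    between a product and a mean of squares, so the rows agree. *)
Lemma dominated_rho mu la : wt mu = n -> wt la = n -> dominated mu la ->
  (rho (xexp mu) <= rho (xexp la))%N /\ (rho (xexp mu) = rho (xexp la) -> mu = la).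
Proof.
move=> hm hl dom.
have E m : rho (xexp m) = (\sum_(i < n) part m i ^ 2)%N.
  by rewrite /rho; apply: eq_bigr => i _; rewrite !mnmE.
have C1 := abel_le n (part_mono mu) dom.
have {}C1 : (rho (xexp mu) <= \sum_(i < n) part mu i * part la i)%N.
  by rewrite E (leq_trans _ C1) // leq_sum.
have C2 := leqif_sum (fun (i : 'I_n) (_ : xpredT i) => nat_Cauchy (part mu i) (part la i)).
rewrite -big_distrr big_split /= -!E in C2.
case: C2 => C2 C3; split; first by move: C1 C2; set S := (\sum_(i < n) _ * _)%N; lia.
move=> e; apply: part_inj => // i hi; apply/eqP.
have : (2 * \sum_(i < n) part mu i * part la i == rho (xexp mu) + rho (xexp la))%N.
  by apply/eqP; move: C1 C2 e; set S := (\sum_(i < n) _ * _)%N; lia.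
by rewrite C3 => /forall_inP /(_ (Ordinal hi) isT).
Qed.

End Parts.

(** * The Jack basis and its uniqueness *)

Section JackBasis.
Variables (F : jackField) (n : nat).
Local Notation alpha := (jf_alpha F).
Local Notation A := {mpoly F[n]}.
Implicit Types (f h : A) (m : 'X_{1..n}).

Definition ptn := {m : 'X_{1..n < n.+1} | wt m == n}.
HB.instance Definition _ := Finite.on ptn.
Definition pmon (t : ptn) : 'X_{1..n} := bmnm (val t).

Lemma wt_pmon t : wt (pmon t) = n. Proof. exact/eqP/(valP t). Qed.
Lemma pmon_inj : injective pmon. Proof. by move=> s t /val_inj/val_inj. Qed.

Lemma ptnP m : wt m = n -> exists t, m = pmon t.
Proof.
move=> wm; have h : (mdeg m < n.+1)%N by rewrite ltnS -{2}wm mdeg_wt.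
have h' : wt (BMultinom h) == n by apply/eqP.
by exists (exist (fun m : 'X_{1..n < n.+1} => wt m == n) (BMultinom h) h').
Qed.

Definition pwt m : F := alpha ^+ plen m * (zee m)%:R.

Lemma pwt_neq0 m : pwt m != 0.
Proof. by rewrite mulf_neq0 ?expf_neq0 ?alpha_neq0 // natF_eq0 -lt0n zee_gt0. Qed.

Lemma ip_ptn f h : homo_at n 0 f ->
  ip f h = \sum_(t : ptn) f@_(pmon t) * h@_(pmon t) * pwt (pmon t).
Proof.
move=> hf; rewrite (ip_subset (s := map pmon (enum {: ptn}))).
- by rewrite big_map big_enum; apply: eq_bigr => t _; rewrite /pwt mulrA.
- by rewrite map_inj_uniq ?enum_uniq //; exact: pmon_inj.
move=> m; rewrite mcoeff_msupp => /hf; rewrite addn0 => /ptnP [t ->].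
by apply: map_f; rewrite mem_enum.
Qed.

Definition jack_basis (E : ptn -> A) := forall t,
  [/\ homo_at n 0 (E t), jackspace (part (pmon t)) (E t),
      lapbel (E t) = contsum F n (part (pmon t)) *: E t
    & psX (E t) = contpoly F n (part (pmon t))].

Lemma jack_basis_exists : exists E, jack_basis E.
Proof.
have H t := jack_exists F (leqnn n) (diagram_part (wt_pmon t)).
by have [E HE] := fin_all_exists H; exists E.
Qed.

Section Basis.
Variable E : ptn -> A.
Hypothesis EP : jack_basis E.

Let dg t := diagram_part (wt_pmon t).

Lemma basis_orth s t : s != t -> ip (E s) (E t) = 0.
Proof.
move=> st; have [_ js _ _] := EP s; have [_ jt _ _] := EP t.
apply/eqP; apply: contraNT st => /(jackspace_orth (dg s) (dg t) js jt) e.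
by apply/eqP/pmon_inj/part_inj; rewrite ?wt_pmon.
Qed.

Lemma evk_basis_neq0 t : evk n (E t) != 0.
Proof.
have [_ _ _ pt] := EP t; have : (contpoly F n (part (pmon t))).[n%:R] != 0.
  by apply: (contpoly_neq0 F (leqnn n)) => i; have [_ out _] := dg t; apply: out.
by rewrite -pt -meval_evk; apply: contraNneq => ->; rewrite meval0.
Qed.

Lemma ip_basis_neq0 t : ip (E t) (E t) != 0.
Proof.
by apply: contraNneq (evk_basis_neq0 t) => /ip_eq0 ->; rewrite raddf0.
Qed.

(* Orthogonality says that the coefficient matrix has a right inverse; this is the left one. *)
Lemma basis_complete s u :
  \sum_t (E t)@_(pmon s) * (E t)@_(pmon u) / ip (E t) (E t) = (s == u)%:R / pwt (pmon s).
Proof.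
pose e (i : 'I_#|{: ptn}|) : ptn := enum_val i.
pose M := \matrix_(i, j) (E (e i))@_(pmon (e j)).
pose X := \matrix_(i, j) (pwt (pmon (e i)) * M j i / ip (E (e j)) (E (e j))).
have sumE (G : ptn -> F) : \sum_t G t = \sum_i G (e i).
  rewrite (reindex_onto e enum_rank) => [|t _]; last exact: enum_rankK.
  by apply: eq_bigl => i; rewrite /e enum_valK eqxx.
have MX : M *m X = 1%:M.
  apply/matrixP => i j; rewrite mxE [RHS]mxE.
  have [hi _ _ _] := EP (e i).
  have -> : \sum_k M i k * X k j = ip (E (e i)) (E (e j)) / ip (E (e j)) (E (e j)).
    rewrite (ip_ptn _ hi) sumE mulr_suml; apply: eq_bigr => k _; rewrite !mxE; ring.
  case: (eqVneq i j) => [->|ij]; first by rewrite divff ?ip_basis_neq0.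
  by rewrite basis_orth ?mul0r //; apply: contra ij => /eqP/enum_val_inj ->.
have /matrixP /(_ (enum_rank s) (enum_rank u)) := mulmx1C MX.
rewrite !mxE (inj_eq enum_rank_inj) => <-; rewrite sumE mulr_suml.
apply: eq_bigr => k _; rewrite !mxE /e !enum_rankK.
move: (pwt_neq0 (pmon s)) (ip_basis_neq0 (enum_val k)).
move: (pwt _) (ip _ _) (_@__) (_@__) => p j x y p0 j0; field; exact/andP.
Qed.

Lemma basis_expand f : homo_at n 0 f -> f = \sum_t (ip f (E t) / ip (E t) (E t)) *: E t.
Proof.
move=> hf; apply/mpolyP => m; rewrite raddf_sum /=; under eq_bigr do rewrite mcoeffZ.
case: (eqVneq (wt m) n) => [/ptnP [u ->]|wm]; last first.
  have out h : homo_at n 0 h -> h@_m = 0.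
    by move=> hh; apply: contraNeq wm => /hh; rewrite addn0 => ->.
  by rewrite out // big1 // => t _; rewrite (out (E t)) ?mulr0 //; case: (EP t).
under eq_bigr => t _ do rewrite (ip_ptn _ hf) !mulr_suml.
rewrite exchange_big /= (bigD1 u) //= [X in _ + X]big1 ?addr0 => [|s su].
  have := basis_complete u u; rewrite eqxx => H.
  transitivity (f@_(pmon u) * pwt (pmon u) * (1 / pwt (pmon u))).
    by rewrite mulrA mulr1 mulfK ?pwt_neq0.
  by rewrite -H mulr_sumr; apply: eq_bigr => t _; ring.
have := basis_complete s u; rewrite (negbTE su) mul0r => H.
transitivity (f@_(pmon s) * pwt (pmon s) * 0); last by rewrite mulr0.
by rewrite -[0 in RHS]H mulr_sumr; apply: eq_bigr => t _; ring.
Qed.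

Lemma basis_lead t : (evk n (E t))@_(xexp (pmon t)) = hookg F n (part (pmon t)).
Proof. by have [h1 h2 _ h4] := EP t; apply: (lead_hook (leqnn n) (dg t)). Qed.

Lemma basis_eigen t : exists2 H : nat -> F,
  gen (den F n (part (pmon t))) (num F n (part (pmon t))) (fun a => if a is a'.+1 then H a' else 1)
  & forall a, \sum_(j < n) iter a (xi j) (evk n (E t)) = H a *: evk n (E t).
Proof.
have [h1 h2 _ _] := EP t; apply: (jackspace_moments (leqnn n) (leqnn n) _ h1 h2).
by move=> i /andP [ni _]; have [_ out _] := dg t; apply: out.
Qed.

Lemma basis_top t : rho_le (rho (xexp (pmon t))) (evk n (E t))
  /\ hookg F n (part (pmon t)) != 0.
Proof.
have [H gH eig] := basis_eigen t; have [mono _ _] := dg t.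
rewrite -basis_lead; exact: (eigen_lead (evk_sym n (E t)) (evk_basis_neq0 t) mono gH eig).
Qed.

(** A nonzero coefficient at another partition of the same [rho] would be a top coefficient, and
    [lead_moments] would give both diagrams the same moments. *)
Lemma basis_triangular s t : s != t -> rho (xexp (pmon s)) = rho (xexp (pmon t)) ->
  (evk n (E s))@_(xexp (pmon t)) = 0.
Proof.
move=> st er; apply/eqP; apply: contraNT st => nz; apply/eqP/pmon_inj/part_inj; rewrite ?wt_pmon //.
have [H gH eig] := basis_eigen s; have [mono _ _] := dg s; have [mono' _ _] := dg t.
have [top _] := basis_top s; rewrite er in top.
have gt := lead_moments mono' (evk_sym n (E s)) top nz eig.
by move=> i hi; apply: (rows_unique mono mono' (gen_unique gH gt)).
Qed.

(* Gram-Schmidt with respect to [rho], which is strictly increasing for dominance. *)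
Lemma jack_family_unique (J : ptn -> A) :
  (forall t, homo_at n 0 (J t)) ->
  (forall t s, (evk n (J t))@_(xexp (pmon s)) != 0 -> dominated (pmon s) (pmon t)) ->
  (forall t, (evk n (J t))@_(xexp (pmon t)) = hookg F n (part (pmon t))) ->
  (forall s t, s != t -> ip (J s) (J t) = 0) -> forall t, J t = E t.
Proof.
move=> hJ dom lead orth t; pose r s := rho (xexp (pmon s)).
move: {2}(r t) (erefl (r t)) => R; elim/ltn_ind: R t => R IH t rt.
pose c s := ip (J t) (E s) / ip (E s) (E s).
have Jt : J t = \sum_s c s *: E s := basis_expand (hJ t).
(* A basis element of maximal [rho] among those occurring in [J t] shows its leading coefficient in
   [J t]: the others have smaller [rho], or vanish there by [basis_triangular]. So the dominance
   hypothesis applies to it. *)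
have dom_of s : c s != 0 -> (forall u, c u != 0 -> (r u <= r s)%N) ->
    (r s <= r t)%N /\ (r s = r t -> s = t).
  move=> cs mx; have : dominated (pmon s) (pmon t).
    apply: dom; rewrite Jt raddf_sum raddf_sum /= (bigD1 s) //= evkZ mcoeffZ basis_lead.
    rewrite big1 ?addr0 => [|u us]; first by rewrite mulf_neq0 //; case: (basis_top s).
    rewrite evkZ mcoeffZ; case: (eqVneq (c u) 0) => [->|cu]; first by rewrite mul0r.
    case: (eqVneq (r u) (r s)) => [e|ne]; first by rewrite basis_triangular ?mulr0.
    have lt : (r u < r s)%N by rewrite ltn_neqAle ne mx.
    have [top _] := basis_top u; suff -> : (evk n (E u))@_(xexp (pmon s)) = 0 by rewrite mulr0.
    by apply/eqP; apply: contraTT lt => /top; rewrite -leqNgt.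
  by move=> /(dominated_rho (wt_pmon s) (wt_pmon t)) [h1 h2]; split=> // /h2 /pmon_inj.
(* Every other element occurring in [J t] has smaller [rho], where [J] and [E] agree by induction,
   and orthogonality of [J] removes it. *)
have c0 s : s != t -> c s = 0.
  move=> st; apply/eqP; apply: contraT => cs.
  have [u cu mx] : exists2 u, c u != 0 & forall v, c v != 0 -> (r v <= r u)%N.
    by case: (@arg_maxnP _ s (fun v => c v != 0) r cs) => u cu mx; exists u.
  have [le _] := dom_of u cu mx.
  have lt : (r s < r t)%N.
    rewrite ltn_neqAle (leq_trans (mx s cs) le) andbT; apply: contra st => /eqP e.
    have [|_ ->//] := dom_of s cs.
    by move=> v cv; rewrite e (leq_trans (mx v cv)).
  have Es := IH _ _ s erefl; rewrite rt in lt.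
  by move: cs; rewrite /c -(Es lt) orth ?mul0r ?eqxx // eq_sym.
have Jc : J t = c t *: E t.
  by rewrite Jt (bigD1 t) //= big1 ?addr0 // => s /c0 ->; rewrite scale0r.
have [_ h0] := basis_top t.
have := lead t; rewrite Jc evkZ mcoeffZ basis_lead -[RHS]mul1r => /(mulIf h0) ->.
by rewrite scale1r.
Qed.

End Basis.
End JackBasis.

(** * Coefficients of the Jack functions *)

Section SpecialMonomials.
Variable n : nat.
Implicit Types m : 'X_{1..n}.

Lemma wt_mdeg m : wt m = (mdeg m + \sum_(i < n) i * m i)%N.
Proof. by rewrite mdegE /wt -big_split; apply: eq_bigr => i _ /=; rewrite mulSn. Qed.

Definition pones : 'X_{1..n} := [multinom (if i == 0 :> nat then n else 0)%N | i < n].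

(** Weight minus length is the sum of the parts each lowered by one; here it is zero, so all parts
    are 1. *)
Lemma mdeg_pones m : wt m = n -> mdeg m = n -> m = pones.
Proof.
move=> wm dm; have : (\sum_(i < n) i * m i == 0)%N by apply/eqP; have := wt_mdeg m; lia.
rewrite sum_nat_eq0 => /forallP z.
have z' (i : 'I_n) : i != 0 :> nat -> m i = 0%N.
  by move=> i0; have := z i; rewrite muln_eq0 (negbTE i0) /= => /eqP.
apply/mnmP => i; rewrite mnmE; case: eqP => [i0|/eqP /z' //].
rewrite -{2}dm mdegE (bigD1 i) //= big1 ?addn0 // => j ji; apply: z'.
by apply: contra ji => /eqP j0; apply/eqP/val_inj; rewrite /= j0 i0.
Qed.

(** The parts lowered by one now sum to 1, so exactly one part exceeds 1, and it is 2. *)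
Lemma mdeg_ptrans m : (2 <= n)%N -> wt m = n -> mdeg m = n.-1 -> m = ptrans n.
Proof.
move=> n2 wm dm; have S1 : (\sum_(i < n) i * m i = 1)%N by have := wt_mdeg m; lia.
have [j jm] : exists j : 'I_n, (j * m j != 0)%N.
  apply/existsP; apply: contraPT S1 => /existsPn z.
  by rewrite big1 // => i _; apply/eqP; rewrite -[_ == _]negbK z.
move: S1; rewrite (bigD1 j) //= => S1.
have Ej : (j * m j = 1)%N by move: jm S1; case: (_ * _)%N => // -[|x] //=; lia.
have [jv mj] : j = 1%N :> nat /\ m j = 1%N.
  by move: Ej => /eqP; rewrite muln_eq1 => /andP [/eqP -> /eqP ->].
have S0 : (\sum_(i < n | i != j) i * m i == 0)%N.
  by move: S1; rewrite Ej; set u := (\sum_(i < n | _) _)%N; lia.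
rewrite sum_nat_eq0 in S0; have z := forallP S0.
have z' (i : 'I_n) : i != 0 :> nat -> i != j -> m i = 0%N.
  by move=> i0 ij; have := z i; rewrite ij muln_eq0 (negbTE i0) /= => /eqP.
apply/mnmP => i; rewrite mnmE; case: eqP => [i0|/eqP i0].
  have ji : j != i by apply/eqP => e; move: jv; rewrite e i0.
  move: dm; rewrite mdegE (bigD1 i) //= (bigD1 j) //= mj big1 => [|k /andP [ki kj]]; first by lia.
  by apply: z' => //; apply: contra ki => /eqP k0; apply/eqP/val_inj; rewrite /= k0 i0.
case: eqP => [e|/eqP ne]; last by apply: z' => //; apply: contra ne => /eqP ->; apply/eqP.
by have -> : i = j by apply: val_inj; rewrite /= e jv.
Qed.

Lemma mdeg_prow m : wt m = n -> mdeg m = 1%N -> m = prow n.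
Proof.
move=> wm /eqP; rewrite mdeg_eq1 => /existsP [i /eqP e].
move: wm; rewrite e wtU => wi; apply/mnmP => j; rewrite mnm1E mnmE.
have -> : (i == j) = (j.+1 == n) by rewrite -val_eqE /= -eqSS wi eq_sym.
by case: (_ == _).
Qed.

Lemma wt_pones : (0 < n)%N -> wt pones = n /\ mdeg pones = n.
Proof.
move=> n0; have E (G : nat -> nat) : (\sum_(i < n) G i * pones i = G 0 * n)%N.
  rewrite (bigD1 (Ordinal n0)) //= mnmE /= big1 ?addn0 // => i i0.
  by rewrite mnmE; case: eqP => [e|_]; [case/eqP: i0; apply: val_inj | rewrite muln0].
split; first by rewrite /wt (E S) mul1n.
by rewrite mdegE -[RHS]mul1n -(E (fun=> 1%N)); apply: eq_bigr => i _; rewrite mul1n.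
Qed.

Lemma zee_pones : (0 < n)%N -> zee pones = n`!.
Proof.
move=> n0; rewrite /zee (bigD1 (Ordinal n0)) //= mnmE /= exp1n mul1n big1 ?muln1 // => i i0.
by rewrite mnmE; case: eqP => [e|_]; [case/eqP: i0; apply: val_inj | rewrite expn0].
Qed.

Lemma wt_ptrans : (2 <= n)%N -> wt (ptrans n) = n /\ mdeg (ptrans n) = n.-1.
Proof.
move=> n2; have n0 : (0 < n)%N by apply: leq_trans n2.
have E (G : nat -> nat) : (\sum_(i < n) G i * ptrans n i = G 0 * (n - 2) + G 1)%N.
  rewrite (bigD1 (Ordinal n0)) //= mnmE /= (bigD1 (Ordinal n2)) //= mnmE /= muln1.
  rewrite big1 ?addn0 // => i /andP [i0 i1]; rewrite mnmE.
  case: eqP => [e|_]; first by case/eqP: i0; apply: val_inj.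
  by case: eqP => [e|_]; [case/eqP: i1; apply: val_inj | rewrite muln0].
split; first by rewrite /wt (E S); lia.
have -> : mdeg (ptrans n) = (\sum_(i < n) 1 * ptrans n i)%N.
  by rewrite mdegE; apply: eq_bigr => i _; rewrite mul1n.
by rewrite (E (fun=> 1%N)); lia.
Qed.

Lemma wt_prow : (0 < n)%N -> wt (prow n) = n /\ mdeg (prow n) = 1%N.
Proof.
move=> n0; have h : (n.-1 < n)%N by rewrite prednK.
have -> : prow n = U_(Ordinal h)%MM.
  apply/mnmP => i; rewrite mnm1E mnmE.
  have -> : (Ordinal h == i) = (i.+1 == n) by rewrite -val_eqE /= -eqSS prednK // eq_sym.
  by case: (_ == _).
by rewrite wtU mdeg1 /= prednK.
Qed.

End SpecialMonomials.

Section ContentPolynomial.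
Variables (F : jackField) (n : nat).
Local Notation A := {mpoly F[n]}.
Implicit Types (f : A) (ga : nat -> nat).

(** The specialisation adds up the coefficients of all monomials of a given length, so it isolates
    [m0] when no other monomial of [f] has its length. *)
Lemma psX_coef f m0 : (forall m, f@_m != 0 -> mdeg m = mdeg m0 -> m = m0) ->
  (psX f)`_(mdeg m0) = f@_m0.
Proof.
move=> un; rewrite /psX /mmap coef_sum /=.
have E m : (polyC f@_m * mmap1 (fun=> 'X) m)`_(mdeg m0) = if m == m0 then f@_m0 else 0.
  rewrite coefCM /mmap1 prodrXr /=.
  have -> : (\sum_(i < n) m i)%N = mdeg m by rewrite mdegE.
  rewrite coefXn; case: (eqVneq m m0) => [->|ne]; first by rewrite eqxx mulr1.
  case: (eqVneq f@_m 0) => [->|nz]; first by rewrite mul0r.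
  case: eqP => [e|_]; last by rewrite mulr0.
  by case/eqP: ne; apply: un.
rewrite (eq_bigr _ (fun m _ => E m)).
case: (boolP (m0 \in msupp f)) => [h|h].
  by rewrite (bigD1_seq m0) //= eqxx big1 ?addr0 // => m /negbTE ->.
by rewrite (memN_msupp_eq0 h) big1 // => m _; case: ifP.
Qed.

Definition boxseq ga := [seq (i, j) | i <- iota 0 n, j <- iota 0 (ga i)].

Lemma boxesE (R : Type) (idx : R) (op : Monoid.com_law idx) ga G :
  boxes op n ga G = \big[op/idx]_(p <- boxseq ga) G p.1 p.2.
Proof.
rewrite /boxseq big_allpairs_dep /boxes -(big_mkord xpredT (fun i => \big[op/idx]_(j < ga i) G i j)).
rewrite /index_iota subn0; apply: eq_bigr => i _.
by rewrite -(big_mkord xpredT (G i)) /index_iota subn0.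
Qed.

Lemma size_boxseq d ga : diagram n d ga -> size (boxseq ga) = d.
Proof.
move=> [_ _ <-]; rewrite -sum1_size -(boxesE _ ga (fun _ _ => 1%N)) /boxes.
by apply: eq_bigr => i _; rewrite sum1_card card_ord.
Qed.

Lemma contpolyE ga : contpoly F n ga =
  \prod_(z <- [seq - content F p.1 p.2 | p <- boxseq ga]) ('X - z%:P).
Proof.
rewrite /contpoly boxesE big_map; apply: eq_bigr => p _.
by rewrite polyCN opprK.
Qed.

Lemma contpoly_coefn ga : diagram n n ga -> (contpoly F n ga)`_n = 1.
Proof.
move=> hga; have := size_boxseq hga; rewrite contpolyE => sz.
have /monicP := monic_prod_XsubC [seq - content F p.1 p.2 | p <- boxseq ga] xpredT id.
by rewrite /lead_coef size_prod_XsubC size_map sz.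
Qed.

Lemma contpoly_coefn1 ga : (0 < n)%N -> diagram n n ga -> (contpoly F n ga)`_(n.-1) = contsum F n ga.
Proof.
move=> n0 hga; rewrite contpolyE; have := size_boxseq hga => sz.
have := @coefPn_prod_XsubC _ [seq - content F p.1 p.2 | p <- boxseq ga].
rewrite size_map sz -lt0n => -> //.
by rewrite big_map sumrN opprK /contsum boxesE.
Qed.

(** The corner box supplies the factor ['X]; the other factors contribute their constant terms. *)
Lemma contpoly_coef1 ga : (0 < n)%N -> diagram n n ga -> (contpoly F n ga)`_1 = contprod F n ga.
Proof.
move=> n0 hga; have g0 : (0 < ga 0)%N.
  have [mono out sm] := hga; rewrite lt0n; apply: contraTneq n0 => z.
  rewrite -{1}sm big1 // => i _; apply/eqP; rewrite -leqn0 -z.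
  exact: (diagram_le hga).
have un : uniq (boxseq ga).
  apply: allpairs_uniq_dep => [|i _|]; rewrite ?iota_uniq //.
  by move=> [i j] [i' j'] _ _ /= [-> ->].
have [s Es] : exists s, boxseq ga = (0, 0)%N :: s.
  by rewrite /boxseq; case: (n) n0 => //= n' _; case: (ga 0) g0 => //= g _; eexists.
rewrite /contpoly /contprod !boxesE Es !big_cons /= mul1r /content mulr0 subrr addr0 coefXM /=.
rewrite -horner_coef0 horner_prod big_seq [RHS]big_seq; apply: eq_bigr => p ps.
rewrite hornerD hornerX hornerC add0r; case: p ps => i j ps /=; case: eqP => //= i0; case: eqP => //= j0.
by move: un; rewrite Es /= -{1}i0 -{1}j0 ps.
Qed.

End ContentPolynomial.

Section PathCoefficient.
Variables (F : jackField) (n : nat) (hn : (2 <= n)%N).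
Local Notation alpha := (jf_alpha F).
Local Notation A := {mpoly F[n]}.
Variable E : ptn n -> A.
Hypothesis EP : jack_basis E.

Lemma basis_psX t m0 : (forall m, wt m = n -> mdeg m = mdeg m0 -> m = m0) ->
  (E t)@_m0 = (contpoly F n (part (pmon t)))`_(mdeg m0).
Proof.
move=> un; have [h _ _ <-] := EP t; rewrite psX_coef // => m /h; rewrite addn0.
exact: un.
Qed.

Let n0 : (0 < n)%N. Proof. exact: leq_trans hn. Qed.

Lemma basis_pones t : (E t)@_(pones n) = 1.
Proof.
have [_ d] := wt_pones n0; rewrite basis_psX => [|m wm]; rewrite d; last exact: mdeg_pones.
by rewrite contpoly_coefn //; apply/diagram_part/wt_pmon.
Qed.

Lemma basis_ptrans t : (E t)@_(ptrans n) = contsum F n (part (pmon t)).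
Proof.
have [_ d] := wt_ptrans hn; rewrite basis_psX => [|m wm]; rewrite d; last exact: mdeg_ptrans.
by rewrite contpoly_coefn1 //; apply/diagram_part/wt_pmon.
Qed.

Lemma basis_prow t : (E t)@_(prow n) = contprod F n (part (pmon t)).
Proof.
have [_ d] := wt_prow n0; rewrite basis_psX => [|m wm]; rewrite d; last exact: mdeg_prow.
by rewrite contpoly_coef1 //; apply/diagram_part/wt_pmon.
Qed.

Lemma iter_del0 k : (k < n)%N -> iter k (@del F n 0) (alpha^-1 *: Pm 1 1) =
  alpha ^- k.+1 *: 'X_(Ordinal n0) ^+ k.+1.
Proof.
have P1 (f : A) : Pm 1 f = 'X_(Ordinal n0) * f.
  have e : pv F n 1 = 'X_(Ordinal n0) := pvE F (Ordinal n0).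
  by rewrite Pm.unlock e.
elim: k => [|k IH] hk; first by rewrite /= P1 mulr1 !expr1.
by rewrite iterS IH 1?ltnW //= P1 mpZr scalerA -exprS -exprVn -exprS exprVn.
Qed.

(** Both sides are compared through the expansion in the basis [E]. A path vector has a nonzero
    product only with the element of its own diagram, so [contprod] may be read at [t];
    self-adjointness of [lapbel] moves the power of [contsum] out. *)
Lemma path_coef l r la :
  (iter r (@lapbel F n) (iter n.-1 (del l) (alpha^-1 *: Pm 1 1)))@_la =
  n`!%:R * \sum_t (E t)@_la * (contprod F n (part (pmon t)) ^+ l * contsum F n (part (pmon t)) ^+ r)
    / ip (E t) (E t).
Proof.
have np : (n.-1 < n)%N by rewrite prednK.
have [I [ga [f [Hf Hp]]]] := del_paths F np.
set u := iter n.-1 (del l) _.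
have hf t : homo_at n 0 (f t).
  case: (eqVneq (f t) 0) => [->|/Hf [_ h _ _]]; first exact: homo0.
  by rewrite prednK in h.
have hu : homo_at n 0 u.
  by rewrite /u Hp; apply: homo_sum => t _; apply: homoZ.
have hDu : homo_at n 0 (iter r (@lapbel F n) u).
  by elim: (r) => //= r' IH; apply: homo_lapbel.
have ipf t s : ip (contprod F n (ga s) ^+ l *: f s) (E t)
    = contprod F n (part (pmon t)) ^+ l * ip (f s) (E t).
  rewrite ipZl; case: (eqVneq (ip (f s) (E t)) 0) => [->|nz]; first by rewrite !mulr0.
  have f0 : f s != 0 by apply: contraNneq nz => ->; rewrite ip0l.
  have [dg _ js _] := Hf s f0; have [_ jt _ _] := EP t.
  by have E' := jackspace_orth dg (diagram_part (wt_pmon t)) js jt nz; rewrite (contprod_ext F (fun i _ => E' i)).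
have ipu t : ip u (E t) = contprod F n (part (pmon t)) ^+ l * n`!%:R.
  rewrite /u Hp ip_suml; under eq_bigr do rewrite ipf.
  rewrite -mulr_sumr -ip_suml; congr (_ * _).
  (* Taking [l = 0] identifies the sum with [(p_1 / alpha) ^ n], whose product with [E t] is [n!]
     times the coefficient 1 of [p_1 ^ n]. *)
  have -> : \sum_s f s = iter n.-1 (@del F n 0) (alpha^-1 *: Pm 1 1).
    by rewrite Hp; apply: eq_bigr => s _; rewrite expr0 scale1r.
  rewrite iter_del0 // prednK // ipZl mpolyXn.
  have [_ d] := wt_pones n0.
  have -> : (U_(Ordinal n0) *+ n)%MM = pones n.
    apply/mnmP => i; rewrite mulmnE mnm1E mnmE -val_eqE /= eq_sym.
    by case: (_ == _); rewrite ?mul1n.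
  rewrite ipX basis_pones zee_pones // /plen d mul1r mulrA mulVf ?mul1r //.
  by rewrite expf_neq0 ?alpha_neq0.
have ipDu t : ip (iter r (@lapbel F n) u) (E t) = contsum F n (part (pmon t)) ^+ r * ip u (E t).
  elim: (r) => [|r' IH]; first by rewrite mul1r.
  by rewrite iterS ip_lapbel; have [_ _ -> _] := EP t; rewrite ipZr IH mulrA -exprS.
rewrite [iter r _ u](basis_expand EP) // raddf_sum /= mulr_sumr; apply: eq_bigr => t _.
rewrite mcoeffZ ipDu ipu.
by move: (_ ^+ r) (_ ^+ l) (_`!%:R) (_@__) (ip _ _)^-1 => *; ring.
Qed.

End PathCoefficient.

(** * The notions of the statement over the field Q(alpha) *)

Lemma LB_lapbel n (f : Sym n) : LB f = lapbel (F := Kjack) f.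
Proof. by rewrite lapbel.unlock pv.unlock dv.unlock. Qed.

Lemma pvar_Pm n (f : Sym n) : pvar n 1 * f = Pm (F := Kjack) 1 f.
Proof. by rewrite Pm.unlock pv.unlock. Qed.

Lemma Delta_del n k (f : Sym n) : Delta k f = del (F := Kjack) k f.
Proof.
elim: k f => [|k IH] f /=; last by rewrite !LB_lapbel !IH.
by rewrite -pvar_Pm -scalerAl.
Qed.

Lemma jip_ip n (f h : Sym n) : jip f h = ip (F := Kjack) f h.
Proof. by rewrite ip.unlock. Qed.

Lemma mcoef_evk n (f : Sym n) mu : mcoef f mu = (evk (F := Kjack) n f)@_(xexp mu).
Proof. by rewrite evk.unlock. Qed.

Lemma hookprod_hookg n (g : 'X_{1..n}) : wt g = n -> hookprod g = hookg Kjack n (part g).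
Proof.
move=> wg; have dg : (mdeg g <= n)%N by rewrite -{2}wg mdeg_wt.
have C j : cols n (part g) j = cpart g j.
  rewrite /cols (part_sum (G := fun x => nat_of_bool (j < x)%N)) // -(parts_sum g (fun x => nat_of_bool (j < x)%N)) /cpart.
  by rewrite -sum1_count [RHS]big_mkcond; apply: eq_bigr => x _; case: (_ < _)%N.
rewrite /hookg /boxes [RHS](bigID (fun i : 'I_n => i < size (parts g))%N) /=.
rewrite [X in _ * X]big1 ?mulr1 => [|i hi]; last first.
  by rewrite part_out ?big_ord0 // -size_parts leqNgt.
have sz : (size (parts g) <= n)%N by rewrite size_parts.
rewrite (big_ord_narrow sz) /hookprod.
by apply: eq_bigr => i _; apply: eq_bigr => j _; rewrite C.
Qed.

Lemma big_ptn (R : Type) (idx : R) (op : Monoid.com_law idx) n (G : 'X_{1..n} -> R) :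
  \big[op/idx]_(g : 'X_{1..n < n.+1} | wt g == n) G g = \big[op/idx]_(t : ptn n) G (pmon t).
Proof.
rewrite (reindex_omap (fun t : ptn n => val t) insub) /=; last first.
  by move=> g hg; rewrite insubT.
by apply: eq_bigl => t; rewrite valK eqxx (valP t).
Qed.

Lemma iter_lapbel n l k r :
  iter r (@LB n) (iter k (Delta l) (alpha^-1 *: pvar n 1)) =
  iter r (@lapbel Kjack n) (iter k (@del Kjack n l) (alpha^-1 *: @Pm Kjack n 1 1)).
Proof.
rewrite (eq_iter (@LB_lapbel n)) (eq_iter (@Delta_del n l)).
by rewrite -pvar_Pm mulr1.
Qed.

Lemma cancel_weights (F : fieldType) (a z N S S' : F) : a != 0 -> z != 0 -> S = S' ->
  a^-1 * (N / z) * (a * z * S) = N * S'.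
Proof. by move=> a0 z0 ->; field; rewrite a0 z0. Qed.

Lemma path_identity n (J : 'X_{1..n} -> Sym n) (l r : nat) la : (2 <= n)%N ->
  JackFamily J -> wt la = n ->
  alpha ^- plen la * classize la * alr J l r la
    = (iter r (@LB n) (iter n.-1 (Delta l) (alpha^-1 *: pvar n 1)))@_la.
Proof.
move=> hn [Jsupp Jdom Jlead Jorth] hla.
have [E EP] := jack_basis_exists Kjack n.
have JE t : J (pmon t) = E t.
  apply: (jack_family_unique EP (J := fun t => J (pmon t))).
  - move=> s m; rewrite -mcoeff_msupp addn0; apply: Jsupp; exact: wt_pmon.
  - move=> s u; rewrite -mcoef_evk => nz.
    exact: (Jdom _ (wt_pmon s) _ (wt_pmon u) nz).
  - move=> s; rewrite -mcoef_evk (Jlead _ (wt_pmon s)).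
    exact: (hookprod_hookg (wt_pmon s)).
  move=> s u su; rewrite -jip_ip; apply: (Jorth _ _ (wt_pmon s) (wt_pmon u)).
  by rewrite (inj_eq (@pmon_inj n)).
rewrite iter_lapbel (path_coef hn EP) /alr /conn /classize; apply: cancel_weights.
- exact: (expf_neq0 _ (alpha_neq0 Kjack)).
- by have := natF_eq0 Kjack (zee la); rewrite -[zee la == 0%N]negbK -lt0n zee_gt0 => /negbT.
rewrite (big_ptn _ (fun g => ((J g)@_la * \prod_(mu <- nseq l (prow n) ++ nseq r (ptrans n)) (J g)@_mu)
   / jip (J g) (J g))).
apply: eq_bigr => t _; rewrite JE jip_ip big_cat !big_nseq !iter_mulr_1 /=.
by rewrite (basis_prow hn EP) (basis_ptrans hn EP).
Qed.

(** * Integrality and palindromicity *)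

Section Palindromes.
Implicit Types (P Q : {poly int}) (M : nat).

(* The centre of symmetry is [(M - 1) / 2]; for [M = 0] only [P = 0] qualifies. *)
Definition pal M P :=
  (forall i, (M <= i)%N -> P`_i = 0) /\
  (forall i j, (i + j).+1 = M -> P`_i = (-1) ^+ (i + j) * P`_j).

Lemma pal0 M : pal M 0.
Proof. by split=> *; rewrite !coef0 ?mulr0. Qed.

Lemma palD M P Q : pal M P -> pal M Q -> pal M (P + Q).
Proof.
move=> [zP sP] [zQ sQ]; split=> [i hi|i j h]; first by rewrite coefD zP // zQ // addr0.
by rewrite !coefD (sP i j h) (sQ i j h) mulrDr.
Qed.

Lemma palN M P : pal M P -> pal M (- P).
Proof.
move=> [zP sP]; split=> [i hi|i j h]; first by rewrite coefN zP // oppr0.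
by rewrite !coefN (sP i j h) mulrN.
Qed.

Lemma palMn M P k : pal M P -> pal M (P *+ k).
Proof.
by move=> h; elim: k => [|k IH]; rewrite ?mulr0n ?mulrS; [exact: pal0 | exact: palD].
Qed.

(** For [M > 0] the symmetry reads [P(X) = (-X)^(M-1) P(1/X)], and [M - 1] is additive over
    products; ['X] has it with [M - 1 = 2]. *)
Lemma palX M P : pal M P -> pal M.+2 ('X * P).
Proof.
move=> [zP sP]; split=> [i hi|i j h]; first by case: i hi => [|i] hi; rewrite coefXM //= zP // ltnW.
case: i h => [|i] h; case: j h => [|j] h //; rewrite !coefXM /=.
- by rewrite (zP j) ?mulr0 //; lia.
- by rewrite (zP i) ?mulr0 //; lia.
by rewrite (sP i j); [rewrite addSn addnS !exprS; ring | lia].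
Qed.

(** In the same sense ['X - 1] has [M - 1 = 1]. *)
Lemma palX1 M P : pal M P -> pal M.+1 (('X - 1) * P).
Proof.
move=> [zP sP]; have C i : (('X - 1) * P)`_i = (if i is i'.+1 then P`_i' else 0) - P`_i.
  by rewrite mulrBl mul1r coefB coefXM; case: i.
split=> [i hi|i j [h]].
  by case: i hi => [|i] hi; rewrite C ?zP ?subrr // ltnW.
rewrite !C; case: i j h => [|i] [|j] h.
- by rewrite /= mul1r.
- have -> : P`_0 = (-1) ^+ j * P`_j by rewrite (sP 0%N j) ?add0n.
  by rewrite (zP j.+1) -?h // add0n exprS; ring.
- have -> : P`_i = (-1) ^+ i * P`_0 by rewrite (sP i 0%N) ?addn0 // -h addn0.
  by rewrite (zP i.+1) -?h addn0 // exprS; ring.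
rewrite (sP i j.+1); last by lia.
by rewrite (sP i.+1 j); [rewrite !addSn !addnS !exprS; ring | lia].
Qed.

End Palindromes.

Section Integrality.
Variables (F : jackField) (n : nat).
Local Notation alpha := (jf_alpha F).
Local Notation A := {mpoly F[n]}.
Implicit Types (f h : A) (m : 'X_{1..n}) (P Q : {poly int}) (t s : nat).

Lemma mulZr (c : F) (u v : A) : u * (c *: v) = c *: (u * v).
Proof. by rewrite scalerAr. Qed.
Lemma dv_linearZ i c f : dv i (c *: f) = c *: dv i f.
Proof. exact: linearZ. Qed.

Definition evp P : F := (map_poly (fun z : int => z%:~R) P).[alpha].

Lemma evpD P Q : evp (P + Q) = evp P + evp Q.
Proof. by rewrite /evp rmorphD hornerD. Qed.
Lemma evpN P : evp (- P) = - evp P.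
Proof. by rewrite /evp rmorphN hornerN. Qed.
Lemma evpMn P k : evp (P *+ k) = k%:R * evp P.
Proof. by rewrite /evp rmorphMn /= hornerMn mulr_natl. Qed.
Lemma evpX P : evp ('X * P) = alpha * evp P.
Proof. by rewrite /evp rmorphM /= map_polyX hornerM hornerX. Qed.
Lemma evpX1 P : evp (('X - 1) * P) = (alpha - 1) * evp P.
Proof. by rewrite mulrBl mul1r evpD evpN evpX mulrBl mul1r. Qed.

(* [alpha ^+ mdeg m * f@_m] is the coefficient of [f] in the variables [p_i / alpha]. *)
Definition good t s f := forall m, exists P,
  [/\ evp P = alpha ^+ mdeg m * f@_m, (size P <= s.+1)%N & pal (t + mdeg m) P].

Lemma good0 t s : good t s 0.
Proof.
move=> m; exists 0; split; [|by rewrite size_poly0|exact: pal0].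
by rewrite /evp rmorph0 horner0 mcoeff0 mulr0.
Qed.

Lemma goodD t s f h : good t s f -> good t s h -> good t s (f + h).
Proof.
move=> hf hh m; have [P [eP zP pP]] := hf m; have [Q [eQ zQ pQ]] := hh m.
exists (P + Q); split; [by rewrite evpD eP eQ mcoeffD mulrDr | | exact: palD].
by rewrite (leq_trans (size_polyD _ _)) // geq_max zP.
Qed.

Lemma goodN t s f : good t s f -> good t s (- f).
Proof.
move=> hf m; have [P [eP zP pP]] := hf m.
by exists (- P); split; [rewrite evpN eP mcoeffN mulrN | rewrite size_polyN | exact: palN].
Qed.

Lemma goodMn t s f k : good t s f -> good t s (k%:R *: f).
Proof.
move=> hf m; have [P [eP zP pP]] := hf m; exists (P *+ k); split; last exact: palMn.
  by rewrite evpMn eP mcoeffZ mulrCA.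
by rewrite -scaler_nat (leq_trans (size_scale_leq _ _)).
Qed.

Lemma good_sum t s (I : Type) (r : seq I) (C : pred I) (G : I -> A) :
  (forall x, C x -> good t s (G x)) -> good t s (\sum_(x <- r | C x) G x).
Proof. by move=> h; apply: big_ind => //; [exact: good0 | move=> *; exact: goodD]. Qed.

Lemma good_alpha1 t s f : good t s f -> good t.+1 s.+1 ((alpha - 1) *: f).
Proof.
move=> hf m; have [P [eP zP pP]] := hf m; exists (('X - 1) * P); split; last exact: palX1.
  by rewrite evpX1 eP mcoeffZ mulrCA.
by rewrite (leq_trans (size_polyMleq _ _)) // (_ : 'X - 1 = 'X - 1%:P :> {poly int}) // size_XsubC.
Qed.

(** Multiplication by [q_i = p_i / alpha]; [dm] is the derivation along [q_i]. *)
Definition qm i f : A := alpha^-1 *: (pv F n i * f).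
Definition dm i f : A := alpha *: dv i f.

Lemma mcoeff_qm (i : 'I_n) f m : alpha ^+ mdeg m * (qm i.+1 f)@_m =
  if m i == 0%N then 0 else alpha ^+ mdeg (m - U_(i))%MM * f@_(m - U_(i)).
Proof.
rewrite /qm mcoeffZ (pvE F i) mcoeffXM; case: eqP => [_|/eqP m0]; first by rewrite !mulr0.
have le : (U_(i) <= m)%MM by rewrite lep1mP.
rewrite -{1}(submK le) mdegD mdeg1 addn1 exprSr -mulrA; congr (_ * _).
by rewrite mulrA divff ?mul1r // alpha_neq0.
Qed.

Lemma qm0 i f : (i == 0%N) || (n < i)%N -> qm i f = 0.
Proof.
rewrite /qm; case: i => [|i] h; first by rewrite pv0 mul0r scaler0.
by rewrite pv_out // mul0r scaler0.
Qed.

(** The polynomials themselves do not change, but each is now attached to a monomial with one more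
    part, which costs one unit of [t]. *)
Lemma good_qm t s i f : good t.+1 s f -> good t s (qm i f).
Proof.
move=> hf; case: (boolP ((i == 0%N) || (n < i)%N)) => [/qm0 ->|]; first exact: good0.
case: i => //= i; rewrite -leqNgt => hi m; rewrite (mcoeff_qm (Ordinal hi)).
case: eqP => [_|/eqP m0].
  by exists 0; split; [rewrite /evp rmorph0 horner0 | rewrite size_poly0 | exact: pal0].
have [P [eP zP pP]] := hf (m - U_(Ordinal hi))%MM; exists P; split=> //.
have le : (U_(Ordinal hi) <= m)%MM by rewrite lep1mP.
by rewrite -{1}(submK le) mdegD mdeg1 addn1 addnS.
Qed.

Lemma good_alpha_qm t s i f : good t s f -> good t.+1 s.+1 (alpha *: qm i f).
Proof.
move=> hf; case: (boolP ((i == 0%N) || (n < i)%N)) => [/qm0 ->|].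
  by rewrite scaler0; exact: good0.
case: i => //= i; rewrite -leqNgt => hi m; rewrite mcoeffZ mulrCA (mcoeff_qm (Ordinal hi)).
case: eqP => [_|/eqP m0].
  by exists 0; split; [rewrite /evp rmorph0 horner0 mulr0 | rewrite size_poly0 | exact: pal0].
have [P [eP zP pP]] := hf (m - U_(Ordinal hi))%MM; exists ('X * P); split.
- by rewrite evpX eP.
- by rewrite (leq_trans (size_polyMleq _ _)) // size_polyX.
have le : (U_(Ordinal hi) <= m)%MM by rewrite lep1mP.
by rewrite -{1}(submK le) mdegD mdeg1 addn1 addSn addnS; apply: palX.
Qed.

Lemma dm0 i f : (i == 0%N) || (n < i)%N -> dm i f = 0.
Proof.
rewrite /dm; case: i => [|i] h; first by rewrite dv0 scaler0.
by rewrite dv_out // scaler0.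
Qed.

Lemma good_dm t s i f : good t s f -> good t.+1 s (dm i f).
Proof.
move=> hf; case: (boolP ((i == 0%N) || (n < i)%N)) => [/dm0 ->|]; first exact: good0.
case: i => //= i; rewrite -leqNgt => hi m; pose x := Ordinal hi.
have [P [eP zP pP]] := hf (m + U_(x))%MM; exists (P *+ (m x).+1); split.
- rewrite evpMn eP /dm mcoeffZ (dvE x) mcoeff_mderiv mdegD mdeg1 addn1 exprS -mulr_natl; ring.
- by rewrite -scaler_nat (leq_trans (size_scale_leq _ _)).
by apply: palMn; move: pP; rewrite mdegD mdeg1 addn1 addnS.
Qed.

(** Half of the product of the two exponents that a repeated derivation brings down is a binomial
    coefficient. *)
Lemma good_half_dm t s i f : good t s f -> good t.+2 s ((1 / 2%:R) *: dm i (dm i f)).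
Proof.
move=> hf; case: (boolP ((i == 0%N) || (n < i)%N)) => [/dm0 ->|].
  by rewrite scaler0; exact: good0.
case: i => //= i; rewrite -leqNgt => hi m; pose x := Ordinal hi.
have [P [eP zP pP]] := hf (m + U_(x) + U_(x))%MM.
exists (P *+ 'C((m x).+2, 2)); split.
- rewrite evpMn eP /dm !mcoeffZ (dvE x) mcoeff_mderiv mcoeffZ (dvE x) mcoeff_mderiv.
  rewrite !mdegD mdeg1 !addn1 !exprS -[_@__ *+ _]mulr_natl -[(_ * (_ * _)) *+ _]mulr_natl.
  rewrite mnmDE mnm1E eqxx addn1.
  have two := two_neq0 F.
  have E : 2%:R * 'C((m x).+2, 2)%:R = (m x).+2%:R * (m x).+1%:R :> F.
    by rewrite -!natrM; congr (_%:R); rewrite mulnC; have := bin_ffact (m x).+2 2; rewrite !ffactnS ffactn0 muln1.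
  apply: (mulfI two); rewrite !mulrA E; field; exact: two.
- by rewrite -scaler_nat (leq_trans (size_scale_leq _ _)).
by apply: palMn; move: pP; rewrite !mdegD mdeg1 !addn1 !addnS.
Qed.

Lemma half_sum (G : 'I_n -> 'I_n -> A) : (forall i j : 'I_n, G i j = G j i) ->
  (1 / 2%:R) *: \sum_(i < n) \sum_(j < n) G i j =
  \sum_(i < n) \sum_(j < n | (i < j)%N) G i j + \sum_(i < n) (1 / 2%:R) *: G i i.
Proof.
move=> sym; apply: (scalerI (two_neq0 F)); rewrite scalerDr -scaler_sumr !scalerA.
rewrite [2%:R * _]mulrC divfK ?two_neq0 // !scale1r scaler_nat mulr2n.
have E (i : 'I_n) : \sum_(j < n) G i j = \sum_(j < n | (i < j)%N) G i j + \sum_(j < n | (j < i)%N) G i j + G i i.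
  rewrite (bigID (fun j : 'I_n => i < j)%N) /= -addrA; congr (_ + _).
  rewrite (bigD1 i) ?ltnn //= addrC; congr (_ + _); apply: eq_bigl => j.
  by rewrite -leqNgt ltn_neqAle andbC.
rewrite (eq_bigr _ (fun i _ => E i)) !big_split /=; congr (_ + _ + _).
rewrite (exchange_big_dep xpredT) //=; apply: eq_bigr => i _.
by apply: eq_bigr => j _.
Qed.

(** In the variables [q_i] all coefficients lie in Z[alpha]: the halves disappear into a binomial
    coefficient, into the pairing of [i, j] with [j, i], or, for a repeated derivation, into
    [good_half_dm]. *)
Lemma lapbel_qd f : lapbel f =
  \sum_(i < n) (alpha - 1) *: ('C(i.+1, 2)%:R *: qm i.+1 (dm i.+1 f))
  + (\sum_(i < n) \sum_(j < n | (i < j)%N)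
       (i.+1 * j.+1)%:R *: qm (i.+1 + j.+1) (dm i.+1 (dm j.+1 f))
     + \sum_(i < n) (i.+1 * i.+1)%:R *: qm (i.+1 + i.+1) ((1 / 2%:R) *: dm i.+1 (dm i.+1 f)))
  + (\sum_(i < n) \sum_(j < n | (i < j)%N)
       (i.+1 + j.+1)%:R *: (alpha *: qm i.+1 (qm j.+1 (dm (i.+1 + j.+1) f)))
     + \sum_(i < n) i.+1%:R *: (alpha *: qm i.+1 (qm i.+1 (dm (i.+1 + i.+1) f)))).
Proof.
have two := two_neq0 F; have a0 := alpha_neq0 F.
have sc (x y : F) (u : A) : x = y -> x *: u = y *: u by move=> ->.
have qZ i c h : qm i (c *: h) = c *: qm i h by rewrite /qm mulZr !scalerA mulrC.
have C2 i : 2%:R * 'C(i.+1, 2)%:R = (i.+1 * i)%:R :> F.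
  by rewrite -natrM; congr (_%:R); rewrite mulnC; have := bin_ffact i.+1 2; rewrite !ffactnS ffactn0 muln1.
pose G2 (i j : 'I_n) := (i.+1 * j.+1)%:R *: qm (i.+1 + j.+1) (dm i.+1 (dm j.+1 f)).
pose G3 (i j : 'I_n) := (i.+1 + j.+1)%:R *: (alpha *: qm i.+1 (qm j.+1 (dm (i.+1 + j.+1) f))).
have dC i j h : dm i (dm j h) = dm j (dm i h) by rewrite /dm !dv_linearZ dv_comm.
have qC i j h : qm i (qm j h) = qm j (qm i h) by rewrite /qm !mulZr mulrCA.
rewrite lapbel.unlock; congr (_ + _ + _).
- rewrite scaler_sumr; apply: eq_bigr => i _; rewrite /qm /dm mulZr !scalerA; apply: sc.
  by rewrite -C2; field; rewrite a0 two.
- transitivity ((1 / 2%:R) *: \sum_(i < n) \sum_(j < n) G2 i j).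
    rewrite !scaler_sumr; apply: eq_bigr => i _; rewrite !scaler_sumr; apply: eq_bigr => j _.
    by rewrite /G2 /qm /dm dv_linearZ !mulZr !scalerA; apply: sc; field; rewrite a0 two.
  rewrite half_sum => [|i j]; last by rewrite /G2 mulnC addnC dC.
  congr (_ + _); apply: eq_bigr => i _; rewrite /G2 (qZ _ (1 / 2%:R)) [LHS]scalerA [RHS]scalerA; exact/sc/mulrC.
transitivity ((1 / 2%:R) *: \sum_(i < n) \sum_(j < n) G3 i j).
  rewrite !scaler_sumr; apply: eq_bigr => i _; rewrite !scaler_sumr; apply: eq_bigr => j _.
  by rewrite /G3 /qm /dm !mulZr mulrA !scalerA; apply: sc; field; rewrite a0 two.
rewrite half_sum => [|i j]; last by rewrite /G3 addnC qC.
congr (_ + _); apply: eq_bigr => i _; rewrite /G3 [LHS]scalerA; apply: sc.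
by rewrite addnn -mul2n natrM; field.
Qed.

(** Each kind of term raises [t] by exactly one: [alpha - 1] raises it by one, [alpha] by two, a
    derivation by one, and a multiplication lowers it by one. The terms without [alpha] need no
    larger degree. *)
Lemma good_lapbel t s f : good t s f -> good t.+1 s.+1 (lapbel f).
Proof.
have up t' s' h : good t' s' h -> good t' s'.+1 h.
  by move=> hh m; have [P [e z p]] := hh m; exists P; split=> //; apply: leqW.
move=> hf; rewrite lapbel_qd; apply: goodD; last apply: goodD; first apply: goodD.
- apply: good_sum => i _; apply/good_alpha1/goodMn/good_qm/good_dm; exact: hf.
- apply: goodD; apply: good_sum => i _; last by apply/up/goodMn/good_qm/good_half_dm.
  by apply: good_sum => j _; apply/up/goodMn/good_qm/good_dm/good_dm.
- apply: good_sum => i _; apply: good_sum => j _.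
  by apply/goodMn/good_alpha_qm/good_qm/good_dm.
by apply: good_sum => i _; apply/goodMn/good_alpha_qm/good_qm/good_dm.
Qed.

(** The two sums in the commutator of [lapbel] with [p_1] coincide and cancel the factor one half.
    In the variables [q_i] no [alpha] is left, which is why the degree bound contains [l - 1] and
    not [l]. *)
Lemma del1E f : del 1 f = \sum_(k < n) k.+1%:R *: qm k.+2 (dm k.+1 f).
Proof.
have qmE i j : Pm i (Qm j f) = (alpha * j%:R) *: (pv F n i * dv j f).
  by rewrite Pm.unlock Qm.unlock mulZr.
have [n0|n0] := posnP n.
  have P0 h : Pm 1 h = 0 :> A by apply: Pm_out; rewrite n0.
  rewrite /= !P0 scaler0 linear0 subrr big1 // => k _; have := ltn_ord k; lia.
rewrite /= lapbelZ (lapbel_Pm _ n0) -scalerBr addrAC subrr add0r.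
pose G j := Pm j.+1 (Lop j 0 f).
have -> : \sum_(j < n) Pm j.+1 (Lop j 0 f) = \sum_(k < n) Pm (k + 0).+2 (Qm k.+1 f).
  rewrite -(big_mkord xpredT G) (big_ltn n0) {1}/G Lop_d mulr0 scale0r linear0 add0r.
  rewrite -(big_mkord xpredT (fun k => Pm (k + 0).+2 (Qm k.+1 f))).
  have -> : \sum_(0 <= k < n) Pm (k + 0).+2 (Qm k.+1 f) = \sum_(1 <= j < n.+1) G j.
    by rewrite big_add1 /=; apply: eq_bigr => k _; rewrite /G Lop_Q // subn0 addn0.
  have Gn : G n = 0 by rewrite /G Pm_out.
  by rewrite big_nat_recr //= Gn addr0.
rewrite -mulr2n -scaler_nat !scalerA scaler_sumr; apply: eq_bigr => k _.
rewrite addn0 qmE /qm /dm mulZr !scalerA; congr (_ *: _).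
by field; rewrite (alpha_neq0 F) (two_neq0 F).
Qed.

Lemma good_del k t s f : good t s f -> good (t + k) (s + k) (del k.+1 f).
Proof.
elim: k t s f => [|k IH] t s f hf.
  rewrite !addn0 del1E; apply: good_sum => k _; exact/goodMn/good_qm/good_dm.
rewrite [del _ _]/(lapbel (del k.+1 f) - del k.+1 (lapbel f)).
apply: goodD; first by rewrite !addnS; apply/good_lapbel/IH.
by apply: goodN; rewrite !addnS -!addSn; apply/IH/good_lapbel.
Qed.

End Integrality.

(** The start is [q_1], obtained by [good_qm] from the constant 1; each of the [k] operators adds
    [l] to both indices and each [lapbel] adds 1. *)
Lemma good_paths (F : jackField) n l k r :
  good (l * k + r) (l * k + r) (iter r (@lapbel F n) (iter k (del l.+1) ((jf_alpha F)^-1 *: Pm 1 1))).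
Proof.
elim: r => [|r IH]; last by rewrite addnS; apply: good_lapbel.
rewrite addn0; elim: k => [|k IH]; last by rewrite iterS mulnS addnC; apply: good_del.
rewrite muln0 /= Pm.unlock; apply: good_qm => m.
exists (if m == 0%MM then 1 else 0); rewrite mcoeff1; case: eqP => [->|_]; split.
- by rewrite /evp rmorph1 hornerC mdeg0 mul1r.
- by rewrite size_poly1.
- rewrite mdeg0; split=> [[|i]|[|i] [|j]] //; rewrite ?coef1 //=.
- by rewrite /evp rmorph0 horner0 mulr0.
- by rewrite size_poly0.
- exact: pal0.
Qed.

Lemma pal_reflect M (P : {poly int}) i : pal M.+1 P ->
  P`_i = (-1) ^+ M * (if (i <= M)%N then P`_(M - i) else 0).
Proof.
move=> [zP sP]; case: leqP => iM; last by rewrite mulr0 zP.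
by rewrite (sP i (M - i)%N) subnKC.
Qed.

Lemma scale_back (F : fieldType) (a x y : F) : a != 0 -> a^-1 * x = y -> a * y = x.
Proof. by move=> a0 <-; rewrite mulVKf. Qed.

Theorem theorem4 (n : nat) (hn : (2 <= n)%N) (J : 'X_{1..n} -> Sym n)
    (HJ : JackFamily J) (la : 'X_{1..n}) (hla : wt la = n) (l r : nat) :
  alpha ^- plen la * classize la * alr J l r la
    = (iter r (@LB n) (iter n.-1 (Delta l) (alpha^-1 *: pvar n 1)))@_la
  /\ ((2 <= l)%N ->
      exists P : {poly int},
        (map_poly (fun z : int => z%:~R : K) P).[alpha] = classize la * alr J l r la
        /\ (size P <= (n - 1) * (l - 1) + r + 1)%N
        /\ forall i : nat,
             P`_i = (-1) ^+ ((l - 1) * (n - 1) + r + plen la - 1)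
                    * (if (i <= (l - 1) * (n - 1) + r + plen la - 1)%N
                       then P`_((l - 1) * (n - 1) + r + plen la - 1 - i) else 0)).
Proof.
have id1 := path_identity l r hn HJ hla; split=> // l2.
(* From here on [l] stands for the former [l - 1]. *)
case: l l2 id1 => // l _; rewrite subSS subn0 => id1.
have [P [eP sP pP]] := @good_paths Kjack n l n.-1 r la.
exists P; rewrite !subn1; split; last split.
- have a0 : alpha ^+ plen la != 0 := expf_neq0 _ (alpha_neq0 Kjack).
  rewrite -mulrA iter_lapbel in id1.
  by rewrite -(scale_back a0 id1); exact: eP.
- by rewrite addn1 mulnC.
(* [pal] is indexed by one more than the exponent of the reflection, so the length of [la] has to be
   positive. *)
have pos : (0 < plen la)%N.
  rewrite lt0n /plen mdeg_eq0; apply: contraTneq hn => e.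
  by rewrite -hla e wt0.
by move=> i; apply: pal_reflect; rewrite prednK // addn_gt0 pos orbT.
Qed.
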